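(* Let $\Sigma$ be a compact surface with nonempty boundary, let $\widehat\Sigma$ be its double, and let $\mathrm J$ be an involution of $\mathrm{PGL}(n,\mathbb R)$ commuting with all diagonal matrices. Let $\rho$ be a Hitchin representation from $\pi_1(\Sigma)$ to $\mathrm{PSL}(n,\mathbb R)$. Then there exists a unique $\mathrm J$-extension $\widehat\rho$ of $\rho$ (a representation of $\pi_1(\widehat\Sigma)$ in $\mathrm{PSL}(n,\mathbb R)$, unique up to conjugation). Finally, the map $\rho\mapsto\widehat\rho$ is continuous.
   Context: Surfaces are compact, connected and oriented, and the double of $\Sigma$ has genus at least $2$. Representations are considered up to conjugation. Hitchin representations. An element of $\mathrm{PSL}(n,\mathbb R)$ is purely loxodromic if all its eigenvalues are real and of multiplicity $1$. A homomorphism $\pi_1(\Sigma)\to\mathrm{PSL}(n,\mathbb R)$ is $n$-Fuchsian if it is a convex cocompact discrete faithful homomorphism into $\mathrm{PSL}(2,\mathbb R)$ composed with the irreducible homomorphism into $\mathrm{PSL}(n,\mathbb R)$; it is Hitchin if it may be continuously deformed into an $n$-Fuchsian one so that the image of each boundary component stays purely loxodromic at each stage. Good homomorphisms. Each boundary component is oriented and identified with a loop. A good homomorphism based at a point $v$ of a boundary component $\partial_v$ is a homomorphism $\mathbf R:\pi_1(\Sigma,v)\to\mathrm{PSL}(n,\mathbb R)$ such that $\mathbf R(\partial_v)$ is diagonal with decreasing entries and the images of all boundary components are purely loxodromic. A good representative, based at $v$, of a Hitchin representation $\rho$ is a good homomorphism based at $v$ in the conjugacy class of $\rho$. (For Hitchin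 representations, the boundary holonomies have lifts whose eigenvalues are all positive; ''decreasing entries'' refers to such lifts.) The map $\underline{\mathbf R}$. Write $a*b$ for the path $a$ followed by $b$. Let $c$ be a path in $\Sigma$ from $v$ to a point $w$ of a boundary component $\partial_w$. One has $\mathbf R(c*\partial_w*c^{-1})=\mathrm K\Delta_w\mathrm K^{-1}$ with $\Delta_w$ diagonal with decreasing entries and $\mathrm K$ well defined up to right multiplication by a diagonal matrix. For $\Delta$ diagonal set $\underline{\mathbf R}(c,\Delta)=\mathrm K\Delta\mathrm K^{-1}$, which does not depend on the choice of $\mathrm K$. The double. Let $j_0,j_1:\Sigma\to\widehat\Sigma$ be the two injections and $x\mapsto\bar x$ the involution of $\widehat\Sigma$ fixing all points of $\partial\Sigma$ and exchanging $j_0$ and $j_1$; it acts on paths and on $\pi_1(\widehat\Sigma,v)$. $\Sigma$ is identified with $j_0(\Sigma)$. $\mathrm J$-extensions. ''Involution of $\mathrm{PGL}(n,\mathbb R)$'' means an element $\mathrm J\in\mathrm{PGL}(n,\mathbb R)$ with $\mathrm J^2=1$. A $\mathrm J$-extension of a good homomorphism $\mathbf R$ based at $v$ is a homomorphism $\widehat{\mathbf R}:\pi_1(\widehat\Sigma,v)\to\mathrm{PSL}(n,\mathbb R)$ such that: (1) $\widehat{\mathbf R}\circ(j_0)_*=\mathbf R$; (2) $\widehat{\mathbf R}(\bar\gamma)=\mathrm J\,\widehat{\mathbf R}(\gamma)\,\mathrm J$ for all $\gamma\in\pi_1(\widehat\Sigma,v)$; (3) for every arc $c$ in $\Sigma$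 joining $v$ to a boundary component, $\widehat{\mathbf R}(c*\bar c^{-1})=\underline{\mathbf R}(c,\mathrm J)\,\mathrm J$. Every good homomorphism has a unique $\mathrm J$-extension. A $\mathrm J$-extension of a Hitchin representation $\rho$ is a representation $\widehat\rho:\pi_1(\widehat\Sigma)\to\mathrm{PSL}(n,\mathbb R)$ such that the $\mathrm J$-extension of any good representative of $\rho$ (for any base point $v$ on any boundary component) belongs to the conjugacy class of $\widehat\rho$. *)

(* Defs.v *)
From HB Require Import structures.
From mathcomp Require Import all_boot all_order all_algebra.
From mathcomp Require Import generic_quotient.
From mathcomp Require Import all_classical all_reals all_analysis.
From mathcomp Require Import ring lra.

Set Implicit Arguments.
Unset Strict Implicit.
Unset Printing Implicit Defensive.

Import Order.TTheory GRing.Theory Num.Theory.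
Import numFieldNormedType.Exports.

Local Open Scope classical_set_scope.
Local Open Scope ring_scope.
Local Open Scope quotient_scope.

Section Paths.
Context {R : realType}.

(* Only the values of a path on [0, 1] matter. *)
Definition is_path {X : topologicalType} (x y : X) (f : R -> X) : Prop :=
  [/\ {within `[0, 1], continuous f}, f 0 = x & f 1 = y].

Definition path_cat {X : Type} (f g : R -> X) : R -> X :=
  fun t => if t <= 2^-1 then f (2 * t) else g (2 * t - 1).

Definition path_rev {X : Type} (f : R -> X) : R -> X := fun t => f (1 - t).

Definition square : set (R * R) := `[0, 1]%classic `*` `[0, 1]%classic.

(* Homotopy with fixed endpoints; the deformation parameter comes first. *)
Definition path_homotopic {X : topologicalType} (f g : R -> X) : Prop :=
  exists H : R * R -> X,
    [/\ {within square, continuous H},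
        forall t, 0 <= t <= 1 -> H (0, t) = f t /\ H (1, t) = g t &
        forall s, 0 <= s <= 1 -> H (s, 0) = f 0 /\ H (s, 1) = f 1].

Lemma within_comp {S T U : topologicalType} (A : set S) (B : set T)
    (u : S -> T) (f : T -> U) : continuous u ->
  (forall s, A s -> B (u s)) ->
  {within B, continuous f} -> {within A, continuous (f \o u)}.
Proof.
move=> cu AB /subspace_continuousP cf; apply/subspace_continuousP => s As.
apply: cvg_trans (cf _ (AB _ As)) => W /= fW.
have := cu s _ fW; rewrite /within /= !nbhs_simpl /=.
by apply: filterS => z /= h Az; apply: h; exact: AB.
Qed.

Lemma pair_continuous {S T U : topologicalType} (f : S -> T) (g : S -> U) :
  continuous f -> continuous g -> continuous (fun x => (f x, g x)).
Proof. by move=> cf cg x; apply: cvg_pair; [exact: cf|exact: cg]. Qed.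

Lemma within_eq {S U : topologicalType} (A : set S) (f g : S -> U) :
  (forall s, A s -> f s = g s) ->
  {within A, continuous f} -> {within A, continuous g}.
Proof.
move=> fg; apply: subspace_eq_continuous => s; rewrite inE => As.
exact: fg.
Qed.

Lemma within_glue {S U : topologicalType} (A : set S) (u : S -> R)
    (f g : S -> U) : closed A -> continuous u ->
  {within A `&` [set s | u s <= 0], continuous f} ->
  {within A `&` [set s | 0 <= u s], continuous g} ->
  (forall s, A s -> u s = 0 -> f s = g s) ->
  {within A, continuous (fun s => if u s <= 0 then f s else g s)}.
Proof.
move=> cA cu cf cg fg.
have -> : A = (A `&` [set s | u s <= 0]) `|` (A `&` [set s | 0 <= u s]).
  rewrite -setIUr; apply/esym/setIidPl => s _ /=.
  by case: (leP (u s) 0) => [|/ltW]; [left|right].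
apply: withinU_continuous.
- apply: closedI => //; have /continuous_closedP := cu.
  by move=> /(_ _ (@closed_le R 0)).
- apply: closedI => //; have /continuous_closedP := cu.
  by move=> /(_ _ (@closed_ge R 0)).
- apply: within_eq cf => s [_ /= us]; by rewrite us.
- apply: within_eq cg => s [As /= us]; case: ifPn => // us'.
  by rewrite fg//; apply/eqP; rewrite eq_le us'.
Qed.

Lemma squareE (p : R * R) : square p = ((0 <= p.1 <= 1) && (0 <= p.2 <= 1)) :> Prop.
Proof.
by apply/propext; rewrite /square /= !in_itv /=; split=> [[-> ->]|/andP[-> ->]].
Qed.

Lemma closed_square : closed square.
Proof.
have cI : closed (`[0, 1]%classic : set R) by exact: interval_closed.
have cf : continuous (fst : R * R -> R) by move=> x; exact: cvg_fst.
have cs : continuous (snd : R * R -> R) by move=> x; exact: cvg_snd.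
have -> : square = (fst @^-1` `[0, 1]%classic) `&` (snd @^-1` `[0, 1]%classic).
  by [].
apply: closedI.
- by move/continuous_closedP : cf; apply.
- by move/continuous_closedP : cs; apply.
Qed.

Lemma closed_I01 : closed (`[0, 1]%classic : set R).
Proof. exact: interval_closed. Qed.

Lemma path_homotopic_refl {X : topologicalType} (x y : X) f : is_path x y f ->
  path_homotopic f f.
Proof.
move=> [cf f0 f1]; exists (f \o snd); split => //.
by apply: within_comp cf => [z|[s t] [_]//]; exact: cvg_snd.
Qed.

Lemma path_homotopic_sym {X : topologicalType} (f g : R -> X) :
  path_homotopic f g -> path_homotopic g f.
Proof.
move=> [H [cH H01 Hs]].
have g0 : g 0 = f 0 by rewrite -(H01 0 _).2 ?(Hs 1 _).1 ?lexx ?ler01.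
have g1 : g 1 = f 1 by rewrite -(H01 1 _).2 ?(Hs 1 _).2 ?lexx ?ler01.
exists (H \o (fun p => (1 - p.1, p.2))); split.
- apply: within_comp cH => [|p].
    apply: pair_continuous => z; last exact: cvg_snd.
    by apply: cvgB; [exact: cvg_cst|exact: cvg_fst].
  by rewrite !squareE /= => /andP[/andP[? ?] ->]; rewrite andbT; lra.
- by move=> t /H01[h0 h1] /=; rewrite subr0 subrr.
- by move=> s s01; rewrite g0 g1; apply: Hs => /=; lra.
Qed.

Lemma path_homotopic_trans {X : topologicalType} (g f h : R -> X) :
  path_homotopic f g -> path_homotopic g h -> path_homotopic f h.
Proof.
move=> [H [cH H01 Hs]] [K [cK K01 Ks]].
have g0 : g 0 = f 0 by rewrite -(H01 0 _).2 ?(Hs 1 _).1 ?lexx ?ler01.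
have g1 : g 1 = f 1 by rewrite -(H01 1 _).2 ?(Hs 1 _).2 ?lexx ?ler01.
exists (fun p => if p.1 - 2^-1 <= 0 then H (2 * p.1, p.2)
                 else K (2 * p.1 - 1, p.2)); split.
- apply: within_glue.
  + exact: closed_square.
  + by move=> z; apply: cvgB; [exact: cvg_fst|exact: cvg_cst].
  + apply: (within_comp (u := fun p : R * R => (2 * p.1, p.2))) cH => [|p].
      apply: pair_continuous => z; last exact: cvg_snd.
      by apply: cvgM; [exact: cvg_cst|exact: cvg_fst].
    by move=> []; rewrite !squareE /= => /andP[? ->] ?; rewrite andbT; lra.
  + apply: (within_comp (u := fun p : R * R => (2 * p.1 - 1, p.2))) cK => [|p].
      apply: pair_continuous => z; last exact: cvg_snd.
      apply: cvgB; last exact: cvg_cst.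
      by apply: cvgM; [exact: cvg_cst|exact: cvg_fst].
    by move=> []; rewrite !squareE /= => /andP[? ->] ?; rewrite andbT; lra.
  + move=> [s t]; rewrite squareE /= => /andP[_ t01] s2.
    have -> : 2 * s = 1 by lra.
    by rewrite subrr (H01 t t01).2 (K01 t t01).1.
- move=> t t01 /=; rewrite ifT ?ifF; [|lra..].
  by rewrite mulr0 (H01 t t01).1 mulr1 -(K01 t t01).2; split => //; congr (K (_, _)); lra.
- move=> s s01 /=; case: ifPn => s2; first by apply: Hs; lra.
  by rewrite -g0 -g1; apply: Ks; move: s2; rewrite -ltNge; lra.
Qed.

Lemma path_catE {X : Type} (f g : R -> X) t :
  path_cat f g t = if t - 2^-1 <= 0 then f (2 * t) else g (2 * t - 1).
Proof. by rewrite /path_cat subr_le0. Qed.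

Lemma is_path_cat {X : topologicalType} (x y z : X) f g :
  is_path x y f -> is_path y z g -> is_path x z (path_cat f g).
Proof.
move=> [cf f0 f1] [cg g0 g1]; split; last 2 first.
- by rewrite /path_cat ifT ?mulr0//; lra.
- by rewrite /path_cat ifF; [rewrite -g1; congr g; lra|lra].
rewrite (_ : path_cat f g = fun t => if t - 2^-1 <= 0 then f (2 * t)
                                     else g (2 * t - 1)); last first.
  by apply/funext => t; exact: path_catE.
apply: within_glue.
- exact: closed_I01.
- by move=> t; apply: cvgB; [exact: cvg_id|exact: cvg_cst].
- apply: (within_comp (u := fun t : R => 2 * t)) cf => [t|t [/=]].
    by apply: cvgM; [exact: cvg_cst|exact: cvg_id].
  by rewrite !in_itv /=; lra.
- apply: (within_comp (u := fun t : R => 2 * t - 1)) cg => [t|t [/=]].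
    by apply: cvgB; [apply: cvgM; [exact: cvg_cst|exact: cvg_id]|exact: cvg_cst].
  by rewrite !in_itv /=; lra.
- move=> t _ t2; have -> : 2 * t = 1 by lra.
  by rewrite subrr f1 g0.
Qed.

Lemma is_path_rev {X : topologicalType} (x y : X) f :
  is_path x y f -> is_path y x (path_rev f).
Proof.
move=> [cf f0 f1]; split; rewrite /path_rev ?subr0 ?subrr//.
apply: (within_comp (u := fun t : R => 1 - t)) cf => [t|t /=].
  by apply: cvgB; [exact: cvg_cst|exact: cvg_id].
by rewrite !in_itv /=; lra.
Qed.

Lemma is_path_cst {X : topologicalType} (x : X) : is_path x x (fun=> x).
Proof. by split => //; apply: continuous_subspaceT => t; exact: cvg_cst. Qed.

Lemma path_homotopic_cat {X : topologicalType} (x y z : X) f f' g g' :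
  is_path x y f -> is_path y z g ->
  path_homotopic f f' -> path_homotopic g g' ->
  path_homotopic (path_cat f g) (path_cat f' g').
Proof.
move=> [cf f0 f1] [cg g0 g1] [H [cH H01 Hs]] [K [cK K01 Ks]].
exists (fun p => if p.2 - 2^-1 <= 0 then H (p.1, 2 * p.2)
                 else K (p.1, 2 * p.2 - 1)); split.
- apply: within_glue.
  + exact: closed_square.
  + by move=> p; apply: cvgB; [exact: cvg_snd|exact: cvg_cst].
  + apply: (within_comp (u := fun p : R * R => (p.1, 2 * p.2))) cH => [|p].
      apply: pair_continuous => p; first exact: cvg_fst.
      by apply: cvgM; [exact: cvg_cst|exact: cvg_snd].
    by move=> []; rewrite !squareE /= => /andP[-> ?] ? /=; lra.
  + apply: (within_comp (u := fun p : R * R => (p.1, 2 * p.2 - 1))) cK => [|p].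
      apply: pair_continuous => p; first exact: cvg_fst.
      apply: cvgB; last exact: cvg_cst.
      by apply: cvgM; [exact: cvg_cst|exact: cvg_snd].
    by move=> []; rewrite !squareE /= => /andP[-> ?] ? /=; lra.
  + move=> [s t]; rewrite squareE /= => /andP[s01 _] t2.
    have -> : 2 * t = 1 by lra.
    by rewrite subrr (Hs s s01).2 (Ks s s01).1 f1 g0.
- move=> t t01; rewrite !path_catE /=; case: ifPn => t2; first by apply: H01; lra.
  by apply: K01; move: t2; rewrite -ltNge; lra.
- move=> s s01; rewrite !path_catE /=.
  have -> : (0 - 2^-1 <= 0 :> R) = true by lra.
  have -> : (1 - 2^-1 <= 0 :> R) = false by lra.
  have -> : 2 * 1 - 1 = 1 :> R by lra.
  by rewrite mulr0 (Hs s s01).1 (Ks s s01).2.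
Qed.

Lemma path_homotopic_reparam {X : topologicalType} (x y : X) (p q : R -> R)
    (k : R -> X) : is_path x y k -> continuous p -> continuous q ->
  (forall t, 0 <= t <= 1 -> 0 <= p t <= 1) ->
  (forall t, 0 <= t <= 1 -> 0 <= q t <= 1) ->
  p 0 = q 0 -> p 1 = q 1 ->
  path_homotopic (k \o p) (k \o q).
Proof.
move=> [ck _ _] cp cq p01 q01 pq0 pq1.
exists (k \o (fun z => (1 - z.1) * p z.2 + z.1 * q z.2)); split.
- apply: within_comp ck => [z|z].
    apply: cvgD; apply: cvgM.
    + by apply: cvgB; [exact: cvg_cst|exact: cvg_fst].
    + by apply: cvg_comp; [exact: cvg_snd|exact: cp].
    + exact: cvg_fst.
    + by apply: cvg_comp; [exact: cvg_snd|exact: cq].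
  rewrite squareE /= in_itv /= => /andP[s01 t01].
  by have := p01 _ t01; have := q01 _ t01; nra.
- by move=> t t01 /=; split; congr k; lra.
- by move=> s s01 /=; rewrite pq0 pq1; split; congr k; lra.
Qed.

Lemma path_homotopic_eq {X : topologicalType} (x y : X) (f g : R -> X) :
  is_path x y f -> (forall t, 0 <= t <= 1 -> f t = g t) -> path_homotopic f g.
Proof.
move=> fp fg; have [H [cH H01 Hs]] := path_homotopic_refl fp.
by exists H; split => // t t01; rewrite -fg//; exact: H01.
Qed.

Lemma path_homotopic_catA {X : topologicalType} (x y z w : X) (f g h : R -> X) :
  is_path x y f -> is_path y z g -> is_path z w h ->
  path_homotopic (path_cat f (path_cat g h)) (path_cat (path_cat f g) h).
Proof.
move=> fp gp hp; set k := path_cat f (path_cat g h).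
have kp : is_path x w k by apply: is_path_cat fp (is_path_cat gp hp).
pose q (t : R) := Num.min (2 * t) (Num.min (t + 4^-1) (t / 2 + 2^-1)).
have cq : continuous q.
  move=> t; apply: continuous_min; last apply: continuous_min.
  - by apply: cvgM; [exact: cvg_cst|exact: cvg_id].
  - by apply: cvgD; [exact: cvg_id|exact: cvg_cst].
  - apply: cvgD; last exact: cvg_cst.
    by apply: cvgM; [exact: cvg_id|exact: cvg_cst].
have q1 t : t <= 4^-1 -> q t = 2 * t by move=> ?; rewrite /q !minElt; do 2 case: ifPn; lra.
have q2 t : 4^-1 <= t -> t <= 2^-1 -> q t = t + 4^-1.
  by move=> ? ?; rewrite /q !minElt; do 2 case: ifPn; lra.
have q3 t : 2^-1 <= t -> q t = t / 2 + 2^-1.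
  by move=> ?; rewrite /q !minElt; do 2 case: ifPn; lra.
have kq : k \o q = path_cat (path_cat f g) h.
  apply/funext => t /=; rewrite /k /path_cat.
  have [t2|t2] := leP t 2^-1.
    have -> : (2 * t <= 2^-1) = (t <= 4^-1) by apply/idP/idP; lra.
    have [t4|t4] := leP t 4^-1.
      by rewrite q1// ifT; [congr f|]; lra.
    rewrite q2//; last by lra.
    by rewrite ifF ?ifT; [congr g|..]; lra.
  rewrite q3; last by lra.
  by rewrite !ifF; [congr h|..]; lra.
rewrite -kq -[X in path_homotopic X _]/(k \o id).
apply: path_homotopic_reparam kp _ cq _ _ _ _ => //.
- by move=> t; exact: cvg_id.
- by move=> t t01; rewrite /q !minElt; do 2 case: ifPn; lra.
- by rewrite q1; lra.
- by rewrite q3; lra.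
Qed.

Lemma path_homotopic_cat1 {X : topologicalType} (x y : X) (f : R -> X) :
  is_path x y f -> path_homotopic (path_cat (fun=> x) f) f.
Proof.
move=> fp; have [_ f0 _] := fp.
pose q (t : R) := Num.max 0 (2 * t - 1).
have cq : continuous q.
  move=> t; apply: (@continuous_max R R (fun=> 0) (fun u => 2 * u - 1));
    first exact: cvg_cst.
  apply: cvgB; last exact: cvg_cst.
  by apply: cvgM; [exact: cvg_cst|exact: cvg_id].
have <- : f \o q = path_cat (fun=> x) f.
  apply/funext => t; rewrite /path_cat /q /= maxElt.
  by case: ifPn => ?; case: ifPn => ?; rewrite -?f0; congr f; lra.
rewrite -[X in path_homotopic _ X]/(f \o id).
apply: path_homotopic_reparam fp cq _ _ _ _ _ => //.
- by move=> t; exact: cvg_id.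
- by move=> t t01; rewrite /q maxElt; case: ifPn; lra.
- by rewrite /q maxElt /=; case: ifPn; lra.
- by rewrite /q maxElt /=; case: ifPn; lra.
Qed.

Lemma path_homotopic_1cat {X : topologicalType} (x y : X) (f : R -> X) :
  is_path x y f -> path_homotopic (path_cat f (fun=> y)) f.
Proof.
move=> fp; have [_ _ f1] := fp.
pose q (t : R) := Num.min (2 * t) 1.
have cq : continuous q.
  move=> t; apply: (@continuous_min R R (fun u => 2 * u) (fun=> 1));
    last exact: cvg_cst.
  by apply: cvgM; [exact: cvg_cst|exact: cvg_id].
have <- : f \o q = path_cat f (fun=> y).
  apply/funext => t; rewrite /path_cat /q /= minElt.
  by case: ifPn => ?; case: ifPn => ?; rewrite -?f1; congr f; lra.
rewrite -[X in path_homotopic _ X]/(f \o id).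
apply: path_homotopic_reparam fp cq _ _ _ _ _ => //.
- by move=> t; exact: cvg_id.
- by move=> t t01; rewrite /q minElt; case: ifPn; lra.
- by rewrite /q minElt /=; case: ifPn; lra.
- by rewrite /q minElt /=; case: ifPn; lra.
Qed.

Lemma path_homotopic_catV {X : topologicalType} (x y : X) (f : R -> X) :
  is_path x y f -> path_homotopic (path_cat (path_rev f) f) (fun=> y).
Proof.
move=> fp; have [_ _ f1] := fp.
pose q (t : R) := `|1 - 2 * t|.
have cq : continuous q.
  move=> t; apply: cvg_norm; apply: cvgB; first exact: cvg_cst.
  by apply: cvgM; [exact: cvg_cst|exact: cvg_id].
have <- : f \o q = path_cat (path_rev f) f.
  apply/funext => t; rewrite /path_cat /path_rev /q /=.
  case: ifPn => ?; congr f; first by rewrite ger0_norm; lra.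
  by rewrite ltr0_norm; lra.
have -> : (fun _ : R => y) = f \o (fun _ : R => 1).
  by apply/funext => t /=; rewrite f1.
apply: path_homotopic_reparam fp cq _ _ _ _ _ => //.
- by move=> t; exact: cvg_cst.
- by move=> t t01; rewrite /q normr_ge0 ler_norml /=; lra.
- by move=> *; rewrite ler01 lexx.
- by rewrite /q mulr0 subr0 normr1.
- by rewrite /q (_ : 1 - 2 * 1 = -1) ?normrN1//; lra.
Qed.

Lemma path_revK {X : Type} (f : R -> X) : path_rev (path_rev f) = f.
Proof. by apply/funext => t; rewrite /path_rev; congr f; lra. Qed.

End Paths.

Section FundamentalGroup.
Context (R : realType) {X : topologicalType} (x : X).

Definition loops : set (R -> X) := [set f | is_path x x f].

Definition loop_cst : loops := SigSub (mem_set (is_path_cst x)).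

Definition loop_rel (f g : loops) : bool :=
  `[< path_homotopic (val f) (val g) >].

Lemma loopP (f : loops) : is_path x x (val f).
Proof. by have := valP f; rewrite inE. Qed.

Lemma loop_rel_refl : reflexive loop_rel.
Proof. by move=> f; apply/asboolP/path_homotopic_refl/loopP. Qed.

Lemma loop_rel_sym : symmetric loop_rel.
Proof.
by move=> f g; apply/asboolP/asboolP; exact: path_homotopic_sym.
Qed.

Lemma loop_rel_trans : transitive loop_rel.
Proof.
move=> g f h /asboolP fg /asboolP gh; apply/asboolP.
exact: path_homotopic_trans fg gh.
Qed.

Definition loop_equiv :=
  EquivRel loop_rel loop_rel_refl loop_rel_sym loop_rel_trans.

Definition pi1 : Type := {eq_quot loop_equiv}.

HB.instance Definition _ := Quotient.on pi1.
HB.instance Definition _ := Choice.on pi1.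

(* The class of the loop [f] based at [x]; only used for such loops, and equal
   to the neutral element when [f] is not a loop at [x]. *)
Definition pi1_class (f : R -> X) : pi1 := \pi_pi1 (insubd loop_cst f).

Lemma pi1_class_eq f g : is_path x x f -> is_path x x g ->
  pi1_class f = pi1_class g <-> path_homotopic f g.
Proof.
move=> fp gp.
have fE : val (insubd loop_cst f) = f by rewrite insubdK// inE.
have gE : val (insubd loop_cst g) = g by rewrite insubdK// inE.
split=> [/eqmodP|fg]; first by rewrite /= /loop_rel fE gE => /asboolP.
by apply/eqmodP; rewrite /= /loop_rel fE gE; exact/asboolP.
Qed.

Lemma pi1P (a : pi1) : exists2 f, is_path x x f & a = pi1_class f.
Proof.
exists (val (repr a)); first exact: loopP.
by rewrite /pi1_class valKd reprK.
Qed.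

Definition pi1_one : pi1 := pi1_class (fun=> x).
Definition pi1_inv (a : pi1) : pi1 := pi1_class (path_rev (val (repr a))).
Definition pi1_mul (a b : pi1) : pi1 :=
  pi1_class (path_cat (val (repr a)) (val (repr b))).

Lemma repr_pi1_class f : is_path x x f ->
  path_homotopic (val (repr (pi1_class f))) f.
Proof.
move=> fp; apply/pi1_class_eq => //; first exact: loopP.
by rewrite {1}/pi1_class valKd reprK.
Qed.

Lemma pi1_mulE f g : is_path x x f -> is_path x x g ->
  pi1_mul (pi1_class f) (pi1_class g) = pi1_class (path_cat f g).
Proof.
move=> fp gp; apply/pi1_class_eq.
- by apply: is_path_cat; exact: loopP.
- exact: is_path_cat fp gp.
- by apply: path_homotopic_cat (loopP _) (loopP _) _ _; exact: repr_pi1_class.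
Qed.

Lemma pi1_mulA : associative pi1_mul.
Proof.
move=> a b c; have [f fp ->] := pi1P a; have [g gp ->] := pi1P b.
have [h hp ->] := pi1P c; have fgp := is_path_cat fp gp.
have ghp := is_path_cat gp hp.
rewrite (pi1_mulE gp hp) (pi1_mulE fp ghp) (pi1_mulE fp gp) (pi1_mulE fgp hp).
apply/pi1_class_eq; [exact: is_path_cat fp ghp|exact: is_path_cat fgp hp|].
exact: path_homotopic_catA fp gp hp.
Qed.

Lemma pi1_mul1 : left_id pi1_one pi1_mul.
Proof.
move=> a; have [f fp ->] := pi1P a; have cp := @is_path_cst R _ x.
rewrite pi1_mulE//; apply/pi1_class_eq => //; first exact: is_path_cat cp fp.
exact: path_homotopic_cat1 fp.
Qed.

Lemma pi1_1mul : right_id pi1_one pi1_mul.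
Proof.
move=> a; have [f fp ->] := pi1P a; have cp := @is_path_cst R _ x.
rewrite pi1_mulE//; apply/pi1_class_eq => //; first exact: is_path_cat fp cp.
exact: path_homotopic_1cat fp.
Qed.

Lemma pi1_mulVg : left_inverse pi1_one pi1_inv pi1_mul.
Proof.
move=> a; set f := val (repr a); have fp : is_path x x f := loopP _.
have E : a = pi1_class f by rewrite /pi1_class valKd reprK.
rewrite [X in pi1_mul _ X]E /pi1_inv -/f.
have rp := is_path_rev fp; have cp := @is_path_cst R _ x.
rewrite pi1_mulE//; apply/pi1_class_eq => //; first exact: is_path_cat rp fp.
exact: path_homotopic_catV fp.
Qed.

Lemma pi1_mulgV : right_inverse pi1_one pi1_inv pi1_mul.
Proof.
move=> a; set f := val (repr a); have fp : is_path x x f := loopP _.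
have E : a = pi1_class f by rewrite /pi1_class valKd reprK.
rewrite [X in pi1_mul X _]E /pi1_inv -/f.
have rp := is_path_rev fp; have cp := @is_path_cst R _ x.
rewrite pi1_mulE//; apply/pi1_class_eq => //; first exact: is_path_cat fp rp.
by rewrite -{1}[f]path_revK; exact: path_homotopic_catV rp.
Qed.

HB.instance Definition _ := isGroup.Build pi1 pi1_mulA pi1_mul1 pi1_1mul
  pi1_mulVg pi1_mulgV.

End FundamentalGroup.

Section ProjectiveLinearGroup.
Context (R : realType) (n : nat).

Definition GL : set 'M[R]_n := [set A | A \in unitmx].

Definition GL_one : GL := SigSub (mem_set (unitmx1 R n : GL 1%:M)).

Definition GL_rel (A B : GL) : bool :=
  `[< exists2 c : R, c != 0 & val A = c *: val B >].

Lemma GLP (A : GL) : val A \in unitmx.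
Proof. by have := valP A; rewrite inE. Qed.

Lemma GL_rel_refl : reflexive GL_rel.
Proof. by move=> A; apply/asboolP; exists 1; rewrite ?oner_neq0// scale1r. Qed.

Lemma GL_rel_sym : symmetric GL_rel.
Proof.
suff h A B : GL_rel A B -> GL_rel B A by move=> A B; apply/idP/idP; exact: h.
move=> /asboolP[c c0 AB]; apply/asboolP; exists c^-1; rewrite ?invr_eq0//.
by rewrite AB scalerA mulVf// scale1r.
Qed.

Lemma GL_rel_trans : transitive GL_rel.
Proof.
move=> B A C /asboolP[c c0 AB] /asboolP[d d0 BC]; apply/asboolP.
by exists (c * d); rewrite ?mulf_neq0// AB BC scalerA.
Qed.

Definition GL_equiv := EquivRel GL_rel GL_rel_refl GL_rel_sym GL_rel_trans.

(* PGL(n, R), with the quotient topology. *)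
Definition PGL : Type := quotient_topology {eq_quot GL_equiv}.

HB.instance Definition _ := Quotient.on PGL.
HB.instance Definition _ := Topological.on PGL.

(* The class of an invertible matrix (and 1 for a singular one). *)
Definition PGL_class (A : 'M[R]_n) : PGL := \pi_PGL (insubd GL_one A).

Lemma PGL_class_eq A B : A \in unitmx -> B \in unitmx ->
  PGL_class A = PGL_class B <-> exists2 c : R, c != 0 & A = c *: B.
Proof.
move=> uA uB.
have AE : val (insubd GL_one A) = A by rewrite insubdK// inE.
have BE : val (insubd GL_one B) = B by rewrite insubdK// inE.
split=> [/eqmodP|AB]; first by rewrite /= /GL_rel AE BE => /asboolP.
by apply/eqmodP; rewrite /= /GL_rel AE BE; exact/asboolP.
Qed.

Definition PGL_lift (g : PGL) : 'M[R]_n := val (repr g).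

Lemma PGL_liftP g : PGL_lift g \in unitmx. Proof. exact: GLP. Qed.

Lemma PGL_liftK g : PGL_class (PGL_lift g) = g.
Proof. by rewrite /PGL_class valKd reprK. Qed.

Lemma PGL_classK A : A \in unitmx ->
  exists2 c : R, c != 0 & PGL_lift (PGL_class A) = c *: A.
Proof.
by move=> uA; apply/PGL_class_eq; rewrite ?PGL_liftP// PGL_liftK.
Qed.

Definition PGL_one : PGL := PGL_class 1%:M.
Definition PGL_mul (g h : PGL) : PGL := PGL_class (PGL_lift g *m PGL_lift h).
Definition PGL_inv (g : PGL) : PGL := PGL_class (invmx (PGL_lift g)).

Lemma PGL_mulE A B : A \in unitmx -> B \in unitmx ->
  PGL_mul (PGL_class A) (PGL_class B) = PGL_class (A *m B).
Proof.
move=> uA uB; apply/PGL_class_eq; rewrite ?unitmx_mul ?PGL_liftP ?uA//.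
have [c c0 ->] := PGL_classK uA; have [d d0 ->] := PGL_classK uB.
by exists (c * d); rewrite ?mulf_neq0// -scalemxAl -scalemxAr scalerA.
Qed.

Lemma PGL_mulA : associative PGL_mul.
Proof.
move=> g h k; rewrite -[g]PGL_liftK -[h]PGL_liftK -[k]PGL_liftK.
by rewrite !PGL_mulE ?unitmx_mul ?PGL_liftP// mulmxA.
Qed.

Lemma PGL_mul1 : left_id PGL_one PGL_mul.
Proof.
move=> g; rewrite -[g]PGL_liftK PGL_mulE ?PGL_liftP ?unitmx1//.
by rewrite mul1mx.
Qed.

Lemma PGL_1mul : right_id PGL_one PGL_mul.
Proof.
move=> g; rewrite -[g]PGL_liftK PGL_mulE ?PGL_liftP ?unitmx1//.
by rewrite mulmx1.
Qed.

Lemma PGL_mulVg : left_inverse PGL_one PGL_inv PGL_mul.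
Proof.
move=> g; rewrite -[X in PGL_mul _ X]PGL_liftK /PGL_inv.
by rewrite PGL_mulE ?unitmx_inv ?PGL_liftP// mulVmx ?PGL_liftP.
Qed.

Lemma PGL_mulgV : right_inverse PGL_one PGL_inv PGL_mul.
Proof.
move=> g; rewrite -[X in PGL_mul X _]PGL_liftK /PGL_inv.
by rewrite PGL_mulE ?unitmx_inv ?PGL_liftP// mulmxV ?PGL_liftP.
Qed.

HB.instance Definition _ := isGroup.Build PGL PGL_mulA PGL_mul1 PGL_1mul
  PGL_mulVg PGL_mulgV.

(* PSL(n, R), as the open subgroup of PGL(n, R) image of SL(n, R). *)
Definition PSL : set PGL := [set PGL_class A | A in [set A | \det A = 1]].

Lemma PSLP (g : PGL) : PSL g -> exists2 A, \det A = 1 & g = PGL_class A.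
Proof. by move=> [A dA <-]; exists A. Qed.

Lemma det1_unitmx (A : 'M[R]_n) : \det A = 1 -> A \in unitmx.
Proof. by move=> dA; rewrite unitmxE dA unitr1. Qed.

Lemma PSL1 : PSL 1%g.
Proof. by exists 1%:M => //=; rewrite det1. Qed.

Lemma PSLM g h : PSL g -> PSL h -> PSL (g * h)%g.
Proof.
move=> [A dA <-] [B dB <-]; exists (A *m B); first by rewrite /= det_mulmx dA dB mulr1.
by rewrite -PGL_mulE ?det1_unitmx.
Qed.

Lemma PSLV g : PSL g -> PSL g^-1%g.
Proof.
move=> [A dA <-]; have uA := det1_unitmx dA.
have uV : invmx A \in unitmx by rewrite unitmx_inv.
exists (invmx A); first by rewrite /= det_inv dA invr1.
apply: (mulgI (PGL_class A)); rewrite mulgV.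
by rewrite [LHS](PGL_mulE uA uV) mulmxV.
Qed.

End ProjectiveLinearGroup.

Section Representations.
Context (R : realType) (n : nat).

(* Homomorphisms from the fundamental group at [x] to PSL(n, R), with the
   topology of pointwise convergence. *)
Definition rep_hom {X : topologicalType} (x : X) :
    set {ptws pi1 R x -> PGL R n} :=
  [set f | (forall a b, f (a * b)%g = (f a * f b)%g) /\ forall a, PSL (f a)].

Arguments rep_hom {X} x _ : assert.

Definition rep_conj {X : topologicalType} (x : X) (f g : rep_hom x) : bool :=
  `[< exists2 h, PSL h & forall a, val g a = (h * val f a * h^-1)%g >].

Lemma rep_conj_refl {X : topologicalType} (x : X) : reflexive (@rep_conj X x).
Proof.
move=> f; apply/asboolP; exists 1%g; first exact: PSL1.
by move=> a; rewrite invg1 mul1g mulg1.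
Qed.

Lemma rep_conj_sym {X : topologicalType} (x : X) : symmetric (@rep_conj X x).
Proof.
suff h f g : @rep_conj X x f g -> rep_conj g f.
  by move=> f g; apply/idP/idP; exact: h.
move=> /asboolP[h hS fg]; apply/asboolP; exists h^-1%g; first exact: PSLV.
by move=> a; rewrite fg invgK !mulgA mulVg mul1g -mulgA mulVg mulg1.
Qed.

Lemma rep_conj_trans {X : topologicalType} (x : X) : transitive (@rep_conj X x).
Proof.
move=> g f k /asboolP[h hS fg] /asboolP[h' hS' gk]; apply/asboolP.
exists (h' * h)%g; first exact: PSLM.
by move=> a; rewrite gk fg invgM !mulgA.
Qed.

Definition rep_equiv {X : topologicalType} (x : X) :=
  EquivRel (@rep_conj X x) (@rep_conj_refl X x) (@rep_conj_sym X x)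
    (@rep_conj_trans X x).

Definition Rep {X : topologicalType} (x : X) : Type :=
  quotient_topology {eq_quot (rep_equiv x)}.

HB.instance Definition _ (X : topologicalType) (x : X) := Quotient.on (Rep x).
HB.instance Definition _ (X : topologicalType) (x : X) :=
  Topological.on (Rep x).

End Representations.

Arguments rep_hom R n {X} x _ : assert.


Section Surfaces.
Context {R : realType}.

Definition half_plane : set (R * R) := [set p | 0 <= p.2].

(* A chart is its domain together with its coordinate map. *)
Definition chart (X : Type) : Type := (set X * (X -> R * R))%type.

(* A homeomorphism from an open set onto a relatively open subset of the closed
   half-plane; the last clause says that the inverse map is continuous. *)
Definition is_chart {X : topologicalType} (c : chart X) : Prop :=
  [/\ open c.1, {within c.1, continuous c.2}, set_inj c.1 c.2 &
      forall W, open W -> W `<=` c.1 ->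
        exists2 V, open V & c.2 @` W = V `&` half_plane].

Definition disc (p : R * R) (r : R) : set (R * R) :=
  [set q | (q.1 - p.1) ^+ 2 + (q.2 - p.2) ^+ 2 <= r ^+ 2].

(* The change of coordinates from [c] to [d] preserves the boundary of the
   half-plane (this is automatic, by invariance of domain) and has local degree
   1 at interior points: the image of a small circle, run counterclockwise
   around [c.2 x], has winding number 1 around [d.2 x], [theta] being a
   continuous determination of its argument. *)
Definition oriented_transition {X : topologicalType} (c d : chart X) : Prop :=
  forall x, c.1 x -> d.1 x ->
    ((c.2 x).2 = 0 <-> (d.2 x).2 = 0) /\
    (0 < (c.2 x).2 -> exists r : R, exists theta : R -> R,
      [/\ 0 < r, disc (c.2 x) r `<=` c.2 @` (c.1 `&` d.1),
          {within `[0, 1], continuous theta}, theta 1 = theta 0 + 2 * pi &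
          forall t y, 0 <= t <= 1 -> c.1 y -> d.1 y ->
            c.2 y = ((c.2 x).1 + r * cos (2 * pi * t),
                     (c.2 x).2 + r * sin (2 * pi * t)) ->
            exists2 m : R, 0 < m &
              d.2 y = ((d.2 x).1 + m * cos (theta t),
                       (d.2 x).2 + m * sin (theta t))]).

(* Compact connected oriented topological surfaces with (possibly empty)
   boundary; the orientation is given by the atlas [A]. *)
Definition oriented_surface (X : topologicalType) (A : set (chart X)) : Prop :=
  [/\ hausdorff_space X /\ @second_countable X,
      compact [set: X] /\ connected [set: X],
      (forall c, A c -> is_chart c),
      (forall x, exists2 c, A c & c.1 x) &
      (forall c d, A c -> A d -> oriented_transition c d)].

Definition boundary {X : topologicalType} (A : set (chart X)) : set X :=
  [set x | exists2 c, A c & c.1 x /\ (c.2 x).2 = 0].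

(* A family of pairwise disjoint simple closed curves, parametrized by R/Z. *)
Definition disjoint_circles {X : topologicalType} (b : nat)
    (e : 'I_b -> R -> X) : Prop :=
  (forall i, continuous (e i)) /\
  (forall i j s t, e i s = e j t <-> i = j /\ exists m : int, s = t + m%:~R).

(* An orientation and a parametrization of each boundary component. *)
Definition oriented_boundary {X : topologicalType} (A : set (chart X))
    (b : nat) (e : 'I_b -> R -> X) : Prop :=
  disjoint_circles e /\ \bigcup_i range (e i) = boundary A.

(* The boundary component with index [i], as a loop based at [e i s]. *)
Definition boundary_loop {X : Type} (b : nat) (e : 'I_b -> R -> X)
    (i : 'I_b) (s : R) : R -> X := fun t => e i (s + t).

(* The genus of a closed surface is the largest number of pairwise disjoint
   simple closed curves whose union does not disconnect it. *)
Definition genus_ge (X : topologicalType) (g : nat) : Prop :=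
  exists c : 'I_g -> R -> X,
    disjoint_circles c /\ connected (~` \bigcup_i range (c i)).

End Surfaces.

Section Double.
Context {X : topologicalType} (B : set X).

Definition double_rel (p q : bool * X) : bool :=
  `[< p = q \/ p.2 = q.2 /\ B p.2 >].

Lemma double_rel_refl : reflexive double_rel.
Proof. by move=> p; apply/asboolP; left. Qed.

Lemma double_rel_sym : symmetric double_rel.
Proof.
suff h p q : double_rel p q -> double_rel q p.
  by move=> p q; apply/idP/idP; exact: h.
move=> /asboolP[->|[pq Bp]]; apply/asboolP; first by left.
by right; rewrite -pq.
Qed.

Lemma double_rel_trans : transitive double_rel.
Proof.
move=> q p r /asboolP[->//|[pq Bp]] /asboolP[<-|[qr Bq]]; apply/asboolP; right.
  by [].
by rewrite pq.
Qed.

Definition double_equiv :=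
  EquivRel double_rel double_rel_refl double_rel_sym double_rel_trans.

(* Two copies of [X] glued along [B]. *)
Definition surface_double : Type := quotient_topology {eq_quot double_equiv}.

HB.instance Definition _ := Quotient.on surface_double.
HB.instance Definition _ := Topological.on surface_double.

Definition double_inj (k : bool) (x : X) : surface_double := \pi_surface_double (k, x).

Definition double_bar (q : surface_double) : surface_double :=
  double_inj (~~ (repr q).1) (repr q).2.

Lemma double_injE k l x y :
  double_inj k x = double_inj l y <-> x = y /\ (k = l \/ B x).
Proof.
split=> [/eqmodP/asboolP /=|[-> h]].
  by move=> [[-> ->]|[-> Bx]]; split; auto.
by apply/eqmodP/asboolP => /=; case: h => [->|By]; [left|right].
Qed.

Lemma double_barE k x : double_bar (double_inj k x) = double_inj (~~ k) x.
Proof.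
apply/double_injE.
have : double_inj (repr (double_inj k x)).1 (repr (double_inj k x)).2 =
       double_inj k x by rewrite /double_inj -surjective_pairing reprK.
by move=> /double_injE[-> [->|Bx]]; split; auto.
Qed.

End Double.

Section HitchinRepresentations.
Context {R : realType}.

Definition purely_loxodromic {n} (g : PGL R n) : Prop :=
  exists A : 'M[R]_n, [/\ \det A = 1, g = PGL_class A &
    exists2 s : seq R, uniq s & char_poly A = \prod_(a <- s) ('X - a%:P)].

(* The matrix, on the basis of monomials of degree n - 1 in two variables, of
   the substitution X := a X + b Y, Y := c X + d Y. *)
Definition sym_mx n (A : 'M[R]_2) : 'M[R]_n :=
  \matrix_(i, j) (((A 0 0)%:P + A 0 1 *: 'X) ^+ (n.-1 - i) *
                  ((A 1 0)%:P + A 1 1 *: 'X) ^+ i)`_j.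

(* The irreducible homomorphism from PSL(2, R) to PSL(n, R). *)
Definition irreducible_hom n (g : PGL R 2) : PGL R n :=
  PGL_class (sym_mx n (PGL_lift g)).

(* The upper sheet of the hyperboloid det = 1 in the space of symmetric
   matrices; A in SL(2, R) acts by P |-> A P A^T, and geodesic segments are the
   intersections of the sheet with plane sectors from the origin. *)
Definition hyperbolic_plane : set 'M[R]_2 :=
  [set P | [/\ P^T = P, \det P = 1 & 0 < \tr P]].

Definition geodesically_convex (C : set 'M[R]_2) : Prop :=
  forall P Q s t, C P -> C Q -> 0 <= s -> 0 <= t ->
    \det (s *: P + t *: Q) = 1 -> C (s *: P + t *: Q).

(* [G] acts cocompactly on a nonempty closed convex invariant set. *)
Definition convex_cocompact (G : set (PGL R 2)) : Prop :=
  exists C : set 'M[R]_2,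
    [/\ C !=set0 /\ C `<=` hyperbolic_plane, closed C, geodesically_convex C,
        (forall A P, \det A = 1 -> G (PGL_class A) -> C P ->
           C (A *m P *m A^T)) &
        exists K : set 'M[R]_2, [/\ compact K, K `<=` C &
          forall P, C P -> exists A Q,
            [/\ \det A = 1, G (PGL_class A), K Q & P = A *m Q *m A^T]]].

Definition discrete_subgroup (G : set (PGL R 2)) : Prop :=
  exists2 U, open U & U `&` G = [set 1%g].

(* The irreducible homomorphism is only defined up to conjugation by an element
   [g] of PGL(n, R). *)
Definition fuchsian {n} {X : topologicalType} {x : X}
    (f : rep_hom R n x) : Prop :=
  exists f0 : rep_hom R 2 x,
    [/\ injective (val f0), discrete_subgroup (range (val f0)),
        convex_cocompact (range (val f0)) &
        exists g, forall a,
          val f a = (g * irreducible_hom n (val f0 a) * g^-1)%g].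

(* The loop c * l * c^-1. *)
Definition lasso {X : Type} (c l : R -> X) : R -> X :=
  path_cat c (path_cat l (path_rev c)).

Context {X : topologicalType} {b : nat} (e : 'I_b -> R -> X).

Definition boundary_loxodromic {n} {x : X} (f : rep_hom R n x) : Prop :=
  forall i s c, is_path x (e i s) c ->
    purely_loxodromic (val f (pi1_class x (lasso c (boundary_loop e i s)))).

Definition hitchin {n} {x : X} : set (Rep R n x) :=
  [set rho | exists f : R -> rep_hom R n x,
    [/\ {within `[0, 1], continuous f}, \pi_(Rep R n x) (f 0) = rho,
        fuchsian (f 1) &
        forall t, 0 <= t <= 1 -> boundary_loxodromic (f t)]].

End HitchinRepresentations.

Section JExtensions.
Context {R : realType} {n : nat}.

(* [f], based at [v], belongs to the conjugacy class [rho], based at [x]: the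
   fundamental groups are identified by means of a path from [x] to [v]. *)
Definition in_class {X : topologicalType} {x v : X} (rho : Rep R n x)
    (f : rep_hom R n v) : Prop :=
  exists p g, [/\ is_path x v p, PSL g & forall l, is_path v v l ->
    val f (pi1_class v l) = (g * val (repr rho) (pi1_class x (lasso p l)) * g^-1)%g].

Definition decreasing_diagonal (D : PGL R n) : Prop :=
  exists d : 'rV[R]_n, [/\ forall i, 0 < d 0 i,
    forall i j : 'I_n, (i < j)%N -> d 0 j < d 0 i & D = PGL_class (diag_mx d)].

Section Good.
Context {X : topologicalType} {b : nat} (e : 'I_b -> R -> X).

Definition good_hom (i : 'I_b) (s : R) (f : rep_hom R n (e i s)) : Prop :=
  decreasing_diagonal (val f (pi1_class (e i s) (boundary_loop e i s))) /\
  boundary_loxodromic e f.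

(* K D K^-1, where f (c * l * c^-1) = K Delta K^-1 with [Delta] diagonal with
   decreasing entries; here [l] is a boundary loop based at the end of [c]. *)
Definition underline {v : X} (f : rep_hom R n v) (c l : R -> X) (D : PGL R n) :
    PGL R n :=
  let K := xget 1%g [set K | exists2 Delta, decreasing_diagonal Delta &
             val f (pi1_class v (lasso c l)) = (K * Delta * K^-1)%g] in
  (K * D * K^-1)%g.

Context (B : set X) (J : PGL R n).
Let j0 : X -> surface_double B := double_inj B false.

Definition J_extension_hom (i : 'I_b) (s : R) (f : rep_hom R n (e i s))
    (F : rep_hom R n (j0 (e i s))) : Prop :=
  let v := e i s in
  [/\ forall l, is_path v v l ->
        val F (pi1_class (j0 v) (j0 \o l)) = val f (pi1_class v l),
      forall l, is_path (j0 v) (j0 v) l ->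
        val F (pi1_class (j0 v) (@double_bar X B \o l)) =
        (J * val F (pi1_class (j0 v) l) * J)%g &
      forall j t c, is_path v (e j t) c ->
        val F (pi1_class (j0 v)
          (path_cat (j0 \o c) (path_rev (@double_bar X B \o (j0 \o c))))) =
        (underline f c (boundary_loop e j t) J * J)%g].

Definition J_extension {x : X} {y : surface_double B} (rho : Rep R n x)
    (rhoh : Rep R n y) : Prop :=
  forall i s (f : rep_hom R n (e i s)), good_hom f -> in_class rho f ->
    exists2 F, unique (J_extension_hom f) F & in_class rhoh F.

End Good.

End JExtensions.

(* Main.v *)
Require Import Defs.
From mathcomp Require Import all_boot all_order all_algebra.
From mathcomp Require Import generic_quotient perm.
From mathcomp Require Import all_classical all_reals all_analysis.
From mathcomp Require Import ring lra zify.

Set Implicit Arguments.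
Unset Strict Implicit.
Unset Printing Implicit Defensive.

Import Order.TTheory GRing.Theory Num.Theory.
Import numFieldNormedType.Exports.

Local Open Scope classical_set_scope.
Local Open Scope ring_scope.
Local Open Scope quotient_scope.

(* A homomorphism from the fundamental group, together with a choice of paths
   from the base point, is the same as a functor [phi] from homotopy classes of
   paths to the group. A Hitchin representation has boundary holonomies that are
   conjugate to diagonal matrices with positive decreasing entries: positivity
   holds for Fuchsian representations, because a matrix of positive determinant
   in dimension 2 is plus or minus a square, and it persists along a deformation
   that stays purely loxodromic. Hence each boundary point [p] carries an
   involution [t p], the conjugate of [J] commuting with the boundary holonomy at
   [p], and [t] is flat along the boundary. So [phi] on the first copy and
   [t phi t^-1] on the second copy glue to a flat bundle over the double, whose
   holonomy [Phi] is the extension; sections of flat bundles over a square give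
   its homotopy invariance. Uniqueness holds because paths of the double are
   homotopic to concatenations of paths in either copy. For the same reason [Phi]
   depends continuously on [phi] as soon as [t] does, which follows from the
   continuity of simple eigenvalues and Lagrange interpolation. *)

(** Base points force the use of path functors: [J_extension] quantifies over good representatives
    at every boundary point, and one functor serves all of them. A path of the double cannot be cut
    where it meets the boundary, since it may cross infinitely often; hence flat sections,
    continuity inductions and contractions acting on both copies at once. Working in PGL puts an
    unknown scalar in every matrix identity: commutation of [J] with diagonal classes holds a priori
    up to a factor, and a positive spectrum is one whose entries share a sign. Comparing strictly
    decreasing positive spectra controls the factor; it shows that [J] is diagonal and that its
    conjugate at a boundary point does not depend on the diagonalizing matrix. The twists need not
    lie in PSL, but [t p * phi f * (t q)^-1] does, because both twists are conjugates of the same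
    [J]. Finally the quotient map to conjugacy classes is open, so continuity is tested on
    homomorphisms, and the extended functors may be chosen arbitrarily since their values on each
    copy are forced. *)

Section Homotopies.
Context {R : realType} {X : topologicalType}.
Implicit Types (x y z w : X) (f g h c d : R -> X).

(** The square is convex, so the straight-line deformation from [u] to [v] stays in it. *)
Lemma square_homotopic (H : R * R -> X) (u v : R -> R * R) :
  {within square, continuous H} -> continuous u -> continuous v ->
  (forall t, 0 <= t <= 1 -> square (u t)) ->
  (forall t, 0 <= t <= 1 -> square (v t)) ->
  u 0 = v 0 -> u 1 = v 1 -> path_homotopic (H \o u) (H \o v).
Proof.
move=> cH cu cv su sv uv0 uv1.
pose K (p : R * R) : R * R := ((1 - p.1) * (u p.2).1 + p.1 * (v p.2).1,
                               (1 - p.1) * (u p.2).2 + p.1 * (v p.2).2).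
have cc (F : R * R -> R) (k : R -> R * R) : continuous F -> continuous k ->
    continuous (fun p : R * R => F (k p.2)).
  move=> cF ck p; apply: (@cvg_comp _ _ _ (fun p : R * R => k p.2) F).
    by apply: cvg_comp; [exact: cvg_snd|exact: ck].
  exact: cF.
have c1 : continuous (fst : R * R -> R) by move=> ?; exact: cvg_fst.
have c2 : continuous (snd : R * R -> R) by move=> ?; exact: cvg_snd.
exists (H \o K); split.
- apply: within_comp cH.
    apply: pair_continuous => p; apply: cvgD; apply: cvgM;
      by [exact: cc|exact: cvg_fst|apply: cvgB; [exact: cvg_cst|exact: cvg_fst]].
  move=> p; rewrite !squareE => /andP[p1 p2] /=.
  move: (su _ p2) (sv _ p2); rewrite !squareE.
  move=> /andP[/andP[a1 a2] /andP[a3 a4]] /andP[/andP[b1 b2] /andP[b3 b4]].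
  by move/andP: p1 => [p10 p11]; apply/andP; split; apply/andP; split; nra.
- move=> t t01 /=; split; congr H; rewrite [RHS]surjective_pairing /K /=;
    congr pair; ring.
- move=> s s01 /=; rewrite /K /= -uv0 -uv1; split; congr H;
    rewrite [RHS]surjective_pairing; congr pair; ring.
Qed.

Lemma path_homotopic_Vcat x y f :
  is_path x y f -> path_homotopic (path_cat f (path_rev f)) (fun=> x).
Proof.
move=> /is_path_rev fp.
by rewrite -{1}(path_revK f); exact: path_homotopic_catV fp.
Qed.

Lemma path_homotopic_catK x y z f g : is_path x y f -> is_path y z g ->
  path_homotopic (path_cat (path_rev f) (path_cat f g)) g.
Proof.
move=> fp gp; have rp := is_path_rev fp.
apply: (path_homotopic_trans (path_homotopic_catA rp fp gp)).
apply: path_homotopic_trans (path_homotopic_cat1 gp).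
apply: path_homotopic_cat (is_path_cat rp fp) gp _ (path_homotopic_refl gp).
exact: path_homotopic_catV fp.
Qed.

Lemma path_homotopic_catl x y z f g g' : is_path x y f -> is_path y z g ->
  path_homotopic g g' -> path_homotopic (path_cat f g) (path_cat f g').
Proof.
move=> fp gp; apply: (path_homotopic_cat fp gp).
exact: path_homotopic_refl fp.
Qed.

Lemma path_homotopic_catr x y z f f' g : is_path x y f -> is_path y z g ->
  path_homotopic f f' -> path_homotopic (path_cat f g) (path_cat f' g).
Proof.
move=> fp gp ff'; apply: (path_homotopic_cat fp gp ff').
exact: path_homotopic_refl gp.
Qed.

(** [path_homotopic] does not ask [g] to be a path: its continuity on [0, 1] is that of the last
    slice of [H]. *)
Lemma path_homotopic_path x y f g :
  is_path x y f -> path_homotopic f g -> is_path x y g.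
Proof.
move=> [cf f0 f1] [H [cH H01 Hs]]; split.
- apply: within_eq (_ : {within _, continuous (H \o (fun t => (1, t)))}).
    by move=> t; rewrite /= in_itv /= => /H01[].
  apply: within_comp cH.
    by apply: pair_continuous => t; [exact: cvg_cst|exact: cvg_id].
  by move=> t; rewrite squareE /= in_itv /= => ->; rewrite ler01 lexx.
- by rewrite -(H01 0 _).2 ?(Hs 1 _).1 ?lexx ?ler01.
- by rewrite -(H01 1 _).2 ?(Hs 1 _).2 ?lexx ?ler01.
Qed.

End Homotopies.

Lemma continuous_comp_within {S T U : topologicalType} (A : set S) (f : S -> T)
    (j : T -> U) :
  continuous j -> {within A, continuous f} -> {within A, continuous (j \o f)}.
Proof.
move=> cj cf p.
by apply: (@continuous_comp (subspace A) T U f j); [exact: cf|exact: cj].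
Qed.

Lemma path_homotopic_comp {R : realType} {X Y : topologicalType} (j : X -> Y)
    (f g : R -> X) :
  continuous j -> path_homotopic f g -> path_homotopic (j \o f) (j \o g).
Proof.
move=> cj [H [cH H01 Hs]]; exists (j \o H); split.
- exact: continuous_comp_within.
- by move=> t /H01[/= -> ->].
- by move=> s /Hs[/= -> ->].
Qed.

Lemma is_path_comp {R : realType} {X Y : topologicalType} (j : X -> Y)
    (x y : X) (f : R -> X) :
  continuous j -> is_path x y f -> is_path (j x) (j y) (j \o f).
Proof.
move=> cj [cf f0 f1]; split; rewrite /= ?f0 ?f1//.
exact: continuous_comp_within.
Qed.

Lemma path_cat_comp {R : realType} {X Y : Type} (j : X -> Y) (f g : R -> X) :
  j \o path_cat f g = path_cat (j \o f) (j \o g).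
Proof. by apply/funext => t; rewrite /path_cat /=; case: ifP. Qed.

(** * Functors on homotopy classes of paths *)

Section PathFunctors.
Context {R : realType} {X : topologicalType} {G : groupType}.
Implicit Types (phi : (R -> X) -> G).

(** A functor from the fundamental groupoid to [G]. Nothing is required of functions that are not
    paths. *)
Definition path_functor phi : Prop :=
  (forall x y z f g, is_path x y f -> is_path y z g ->
     phi (path_cat f g) = (phi f * phi g)%g) /\
  (forall x y f g, is_path x y f -> is_path x y g -> path_homotopic f g ->
     phi f = phi g).

Lemma path_functor_cst phi x : path_functor phi -> phi (fun=> x) = 1%g.
Proof.
move=> [phiM phiH]; have cp := @is_path_cst R _ x.
apply: (mulgI (phi (fun=> x))); rewrite mulg1 -(phiM _ _ _ _ _ cp cp).
exact: (phiH x x _ _ (is_path_cat cp cp) cp (path_homotopic_cat1 cp)).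
Qed.

Lemma path_functor_rev phi x y f : path_functor phi -> is_path x y f ->
  phi (path_rev f) = (phi f)^-1%g.
Proof.
move=> pf fp; have [phiM phiH] := pf; have rp := is_path_rev fp.
apply: (mulIg (phi f)); rewrite mulVg -(phiM _ _ _ _ _ rp fp).
rewrite -(path_functor_cst y pf).
exact: (phiH y y _ _ (is_path_cat rp fp) (@is_path_cst R _ y)
  (path_homotopic_catV fp)).
Qed.

Lemma is_path_lasso (x y : X) (c l : R -> X) :
  is_path x y c -> is_path y y l -> is_path x x (lasso c l).
Proof.
by move=> cp lp; exact: (is_path_cat cp (is_path_cat lp (is_path_rev cp))).
Qed.

Lemma path_functor_lasso phi x y c l : path_functor phi ->
  is_path x y c -> is_path y y l ->
  phi (lasso c l) = (phi c * phi l * (phi c)^-1)%g.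
Proof.
move=> pf cp lp; have rp := is_path_rev cp.
rewrite (pf.1 _ _ _ _ _ cp (is_path_cat lp rp)) (pf.1 _ _ _ _ _ lp rp).
by rewrite (path_functor_rev pf cp) mulgA.
Qed.

End PathFunctors.

Lemma path_functor_comp {R : realType} {X Z : topologicalType} {G : groupType}
    (j : X -> Z) (phi : (R -> Z) -> G) :
  continuous j -> path_functor phi -> path_functor (fun f => phi (j \o f)).
Proof.
move=> cj [phiM phiH]; split=> [x y z f g fp gp|x y f g fp gp fg].
  by rewrite path_cat_comp; exact: phiM (is_path_comp cj fp) (is_path_comp cj gp).
exact: phiH (is_path_comp cj fp) (is_path_comp cj gp) (path_homotopic_comp cj fg).
Qed.

(** Reduces the comparison of two functors on arbitrary paths to loops at [v] and to reference
    arms. *)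
Lemma path_functor_close {R : realType} {X : topologicalType} {G : groupType}
    (phi : (R -> X) -> G) (v x y : X) c d f : path_functor phi ->
  is_path v x c -> is_path v y d -> is_path x y f ->
  phi f = ((phi c)^-1 * (phi (path_cat c (path_cat f (path_rev d))) * phi d))%g.
Proof.
move=> pphi cp dp fp; have rp := is_path_rev dp.
rewrite (pphi.1 _ _ _ _ _ cp (is_path_cat fp rp)) (pphi.1 _ _ _ _ _ fp rp).
by rewrite (path_functor_rev pphi dp) !mulgA mulgVK mulVg mul1g.
Qed.

Section FunctorOfHom.
Context {R : realType} {X : topologicalType} {G : groupType} (x0 : X).
Variables (f : pi1 R x0 -> G) (c : X -> R -> X).
Hypothesis fM : forall a b, f (a * b)%g = (f a * f b)%g.
Hypothesis cp : forall x, is_path x0 x (c x).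

Definition hom_functor (g : R -> X) : G :=
  f (pi1_class x0 (path_cat (c (g 0)) (path_cat g (path_rev (c (g 1)))))).

Let based x y g : is_path x y g ->
  is_path x0 x0 (path_cat (c x) (path_cat g (path_rev (c y)))).
Proof.
by move=> gp; exact: (is_path_cat (cp x) (is_path_cat gp (is_path_rev (cp y)))).
Qed.

Lemma hom_functorP : path_functor hom_functor.
Proof.
split=> [x y z g h gp hp|x y g h gp hp gh]; last first.
  have [_ g0 g1] := gp; have [_ h0 h1] := hp; rewrite /hom_functor g0 g1 h0 h1.
  congr f; apply/pi1_class_eq; [exact: based|exact: based|].
  have rp := is_path_rev (cp y).
  apply: (path_homotopic_catl (cp x) (is_path_cat gp rp)).
  exact: path_homotopic_catr gp rp gh.
have ghp := is_path_cat gp hp.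
have [_ g0 g1] := gp; have [_ h0 h1] := hp; have [_ gh0 gh1] := ghp.
rewrite /hom_functor g0 g1 h0 h1 gh0 gh1 -fM; congr f.
rewrite [RHS](pi1_mulE (based gp) (based hp)); apply/pi1_class_eq.
- exact: based.
- by apply: is_path_cat; exact: based.
have ry := is_path_rev (cp y); have rz := is_path_rev (cp z).
have hr := is_path_cat hp rz; have chr := is_path_cat (cp y) hr.
have gr := is_path_cat gp ry.
apply: path_homotopic_trans (path_homotopic_catA (cp x) gr chr).
apply: (path_homotopic_catl (cp x) (is_path_cat ghp rz)).
apply: path_homotopic_trans (path_homotopic_catA gp ry chr).
apply: path_homotopic_trans (path_homotopic_sym (path_homotopic_catA gp hp rz)) _.
apply: (path_homotopic_catl gp hr).
exact/path_homotopic_sym/path_homotopic_catK/hr/(cp y).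
Qed.

(** The arm [c x0] is not assumed to be trivial, which is where the conjugation comes from. *)
Lemma hom_functor_loop l : is_path x0 x0 l ->
  hom_functor l = (f (pi1_class x0 (c x0)) * f (pi1_class x0 l) *
                   (f (pi1_class x0 (c x0)))^-1)%g.
Proof.
move=> lp; have [_ l0 l1] := lp; rewrite /hom_functor l0 l1.
have rp := is_path_rev (cp x0).
apply: (mulIg (f (pi1_class x0 (c x0)))); rewrite mulgVK -!fM; congr f.
rewrite [LHS](pi1_mulE (based lp) (cp x0)) [RHS](pi1_mulE (cp x0) lp).
apply/pi1_class_eq; [exact: is_path_cat (based lp) (cp _)|exact: is_path_cat (cp _) lp|].
have lr := is_path_cat lp rp; have rc := is_path_cat rp (cp x0).
apply: path_homotopic_trans (path_homotopic_sym (path_homotopic_catA (cp x0) lr (cp x0))) _.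
apply: (path_homotopic_catl (cp x0) (is_path_cat lr (cp x0))).
apply: path_homotopic_trans (path_homotopic_sym (path_homotopic_catA lp rp (cp x0))) _.
apply: path_homotopic_trans (path_homotopic_1cat lp).
apply: path_homotopic_catl lp rc _; exact: path_homotopic_catV (cp x0).
Qed.

End FunctorOfHom.

(** * Continuity induction along an interval *)

Section LocallyConstant.
Context {R : realType}.

Lemma locally_constant_const {T : Type} (k : R -> T) :
  (forall t, \forall t' \near t, k t' = k t) -> forall s t, k s = k t.
Proof.
move=> lk s t; have cR : connected [set: R].
  by apply/connected_intervalP => x y _ _ z _.
have oA A : open (k @^-1` A).
  by rewrite openE => u /= Au; have := lk u; apply: filterS => v /= ->.
suff : k @^-1` [set k s] = setT by rewrite -subTset => /(_ t I) /= ->.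
apply: cR; first by exists s.
- by exists (k @^-1` [set k s]); [exact: oA|rewrite setTI].
- exists (k @^-1` [set k s]); last by rewrite setTI.
  by rewrite -[X in closed X]setCK; exact/open_closedC/(oA (~` [set k s])).
Qed.

(** Retraction onto [0, 1]: composing with it turns continuity within the interval into continuity
    on the whole line. *)
Definition clamp (t : R) : R := Num.max 0 (Num.min t 1).

Lemma clamp01 (t : R) : 0 <= clamp t <= 1.
Proof. by rewrite /clamp maxElt minElt; do 2 case: ifPn; lra. Qed.

Lemma clamp_id (t : R) : 0 <= t <= 1 -> clamp t = t.
Proof. by rewrite /clamp maxElt minElt; do 2 case: ifPn; lra. Qed.

Lemma clamp_ge1 (t : R) : 1 <= t -> clamp t = 1.
Proof. by rewrite /clamp maxElt minElt; do 2 case: ifPn; lra. Qed.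

Lemma clamp_le0 (t : R) : t <= 0 -> clamp t = 0.
Proof. by rewrite /clamp maxElt minElt; do 2 case: ifPn; lra. Qed.

Lemma clamp_continuous : continuous clamp.
Proof.
move=> t; apply: (@continuous_max R R (fun=> 0) (fun u => Num.min u 1)).
  exact: cvg_cst.
apply: (@continuous_min R R id (fun=> 1)); [exact: cvg_id|exact: cvg_cst].
Qed.

(** Also used with [T] being [Prop]: a property that propagates locally in both directions holds at
    1 as soon as it holds at 0. This replaces subdivision arguments throughout. *)
Lemma unit_locally_constant {T : Type} (k : R -> T) :
  (forall t : R, 0 <= t <= 1 -> \forall t' \near t, 0 <= t' <= 1 -> k t' = k t) ->
  forall s t, 0 <= s <= 1 -> 0 <= t <= 1 -> k s = k t.
Proof.
move=> lk s t s01 t01; rewrite -(clamp_id s01) -(clamp_id t01).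
apply: (locally_constant_const (k := k \o clamp)) => u.
have := clamp_continuous (lk _ (clamp01 u)).
by rewrite /= nbhs_simpl /=; apply: filterS => t' /=; apply; exact: clamp01.
Qed.

End LocallyConstant.

(** * Flat bundles, their sections over a square, and parallel transport *)

Section LocalSystems.
Context {R : realType} {Y : topologicalType} {G : groupType} {I : Type}.
Variables (U : I -> set Y) (a : I -> Y -> G).

(* A principal G-bundle with locally constant transition functions
   [a i y * (a j y)^-1]; [a i] is the expression of a multivalued flat section
   in the chart [U i]. *)
Definition local_system : Prop :=
  [/\ forall i, open (U i), forall y, exists i, U i y &
      forall i j y, U i y -> U j y -> \forall z \near y,
        (a i z * (a j z)^-1 = a i y * (a j y)^-1)%g].

Hypothesis ls : local_system.

(** A parallel section, over [S], of the bundle pulled back by [H]: in each chart it is locally a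
    constant left multiple of [a i]. *)
Definition flat_section {Z : topologicalType} (H : Z -> Y) (S : set Z)
    (g : Z -> G) : Prop :=
  forall z i, S z -> U i (H z) -> \forall z' \near z, S z' ->
    (g z' * (a i (H z'))^-1 = g z * (a i (H z))^-1)%g.

Section Sections.
Context {Z : topologicalType} (H : Z -> Y).
Hypothesis cH : continuous H.
Implicit Types (S : set Z) (g : Z -> G).

(** Two charts differ by a locally constant factor, so one chart around each point is enough. *)
Lemma flat_section1 S g :
  (forall z, S z -> exists2 i, U i (H z) & \forall z' \near z, S z' ->
     (g z' * (a i (H z'))^-1 = g z * (a i (H z))^-1)%g) ->
  flat_section H S g.
Proof.
have [_ _ aU] := ls; move=> h z j Sz Uj; have [i Ui gi] := h _ Sz.
have := cH (aU _ _ _ Ui Uj); rewrite nbhs_simpl /= => aij.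
near=> z' => Sz'.
have /= e1 : (g z' * (a i (H z'))^-1 = g z * (a i (H z))^-1)%g by apply: (near gi z').
have /= e2 : (a i (H z') * (a j (H z'))^-1 = a i (H z) * (a j (H z))^-1)%g.
  exact: (near aij z').
by rewrite -(mulgVK (a i (H z')) (g z')) e1 -2!mulgA e2 !mulgA mulgVK.
Unshelve. all: by end_near. Qed.

Lemma flat_section_chart S i : (forall z, S z -> U i (H z)) ->
  flat_section H S (a i \o H).
Proof.
move=> SU; apply: flat_section1 => z Sz; exists i; first exact: SU.
by near=> z' => _ /=; rewrite !mulgV.
Unshelve. all: by end_near. Qed.

Lemma flat_section_sub S S' g : S' `<=` S ->
  flat_section H S g -> flat_section H S' g.
Proof.
move=> SS' fg z i S'z Ui; have := fg z i (SS' _ S'z) Ui.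
by apply: filterS => z' h /SS'.
Qed.

Lemma flat_section_mul S g k : flat_section H S g ->
  flat_section H S (fun z => k * g z)%g.
Proof.
move=> fg z i Sz Ui; have := fg z i Sz Ui; apply: filterS => z' h Sz'.
by rewrite -!mulgA h.
Qed.

Lemma flat_section_uniq S g g' (u : R -> Z) s t :
  flat_section H S g -> flat_section H S g' ->
  continuous u -> (forall t, 0 <= t <= 1 -> S (u t)) ->
  0 <= s <= 1 -> 0 <= t <= 1 ->
  (g (u s) * (g' (u s))^-1 = g (u t) * (g' (u t))^-1)%g.
Proof.
have [_ Uc _] := ls; move=> fg fg' cu Su s01 t01.
apply: (unit_locally_constant (k := fun t => g (u t) * (g' (u t))^-1)%g) s01 t01.
move=> {}t t01; have [i Ui] := Uc (H (u t)).
have := cu _ _ (fg _ _ (Su _ t01) Ui); rewrite nbhs_simpl /= => n1.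
have := cu _ _ (fg' _ _ (Su _ t01) Ui); rewrite nbhs_simpl /= => n2.
near=> t' => t'01.
have /= e1 : (g (u t') * (a i (H (u t')))^-1 = g (u t) * (a i (H (u t)))^-1)%g.
  by apply: (near n1 t') => //; exact: Su.
have /= e2 : (g' (u t') * (a i (H (u t')))^-1 = g' (u t) * (a i (H (u t)))^-1)%g.
  by apply: (near n2 t') => //; exact: Su.
rewrite -(mulgVK (a i (H (u t'))) (g (u t'))) e1.
rewrite -(mulgVK (a i (H (u t'))) (g' (u t'))) e2.
by rewrite !invgM !invgK !mulgA mulgK mulgVK.
Unshelve. all: by end_near. Qed.

(** The overlap is the image of one path, so the sections differ there by a single constant [k];
    replacing [g2] by [k * g2] makes them agree. *)
Lemma flat_section_glue S1 S2 g1 g2 (u : R -> Z) :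
  closed S1 -> closed S2 ->
  flat_section H S1 g1 -> flat_section H S2 g2 -> continuous u ->
  (forall z, S1 z -> S2 z -> exists2 t, 0 <= t <= 1 & u t = z) ->
  (forall t, 0 <= t <= 1 -> S1 (u t) /\ S2 (u t)) ->
  exists g, flat_section H (S1 `|` S2) g.
Proof.
have [_ Uc _] := ls; move=> c1 c2 f1 f2 cu Su uS.
pose k := (g1 (u 0) * (g2 (u 0))^-1)%g.
have gk z : S1 z -> S2 z -> g1 z = (k * g2 z)%g.
  move=> S1z S2z; have [t t01 <-] := Su _ S1z S2z; apply: (mulIg (g2 (u t))^-1%g).
  rewrite mulgK /k.
  have f1' : flat_section H (S1 `&` S2) g1 by apply: flat_section_sub f1 => ? [].
  have f2' : flat_section H (S1 `&` S2) g2 by apply: flat_section_sub f2 => ? [].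
  by apply: (flat_section_uniq f1' f2' cu uS t01); rewrite lexx ler01.
pose g z := if pselect (S1 z) then g1 z else (k * g2 z)%g.
have gS1 z : S1 z -> g z = g1 z by rewrite /g; case: pselect.
have gS2 z : S2 z -> g z = (k * g2 z)%g.
  by rewrite /g; case: pselect => // ? ?; exact: gk.
have {}f2 := flat_section_mul k f2.
have nc (S : set Z) z : closed S -> ~ S z -> \forall z' \near z, ~ S z'.
  by move=> cS nS; move/open_nbhs_nbhs: (conj (closed_openC cS) nS); apply.
exists g; apply: flat_section1 => z Sz; have [i Ui] := Uc (H z); exists i => //.
have h1 : \forall z' \near z, S1 z' ->
    (g z' * (a i (H z'))^-1 = g z * (a i (H z))^-1)%g.
  have [S1z|nS1] := pselect (S1 z).
    by have := f1 _ _ S1z Ui; apply: filterS => z' + ?; rewrite !gS1//; exact.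
  by have := nc _ _ c1 nS1; apply: filterS.
have h2 : \forall z' \near z, S2 z' ->
    (g z' * (a i (H z'))^-1 = g z * (a i (H z))^-1)%g.
  have [S2z|nS2] := pselect (S2 z).
    by have := f2 _ _ S2z Ui; apply: filterS => z' + ?; rewrite !gS2//; exact.
  by have := nc _ _ c2 nS2; apply: filterS.
by near=> z' => -[]; [apply: (near h1 z')|apply: (near h2 z')].
Unshelve. all: by end_near. Qed.

End Sections.

Lemma flat_section_comp {Z Z' : topologicalType} (H : Z -> Y) (u : Z' -> Z) g :
  continuous u -> flat_section H setT g -> flat_section (H \o u) setT (g \o u).
Proof.
move=> cu fg z i _ Ui; have := cu _ _ (fg (u z) i Logic.I Ui).
by rewrite nbhs_simpl /=; apply: filterS => z' h _; exact: h.
Qed.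

Definition box (r1 r2 s1 s2 : R) : set (R * R) :=
  [set p | (r1 <= p.1 <= r2) && (s1 <= p.2 <= s2)].

Lemma closed_box r1 r2 s1 s2 : closed (box r1 r2 s1 s2).
Proof.
have cl (u : R * R -> R) r s : continuous u -> closed [set p | r <= u p <= s].
  move=> /continuous_closedP cu.
  have -> : [set p | r <= u p <= s] =
      u @^-1` [set x | r <= x] `&` u @^-1` [set x | x <= s].
    by apply/seteqP; split => p /=; [move=> /andP[]|move=> [-> ->]].
  by apply: closedI; apply: cu; [exact: closed_ge|exact: closed_le].
have -> : box r1 r2 s1 s2 = [set p | r1 <= p.1 <= r2] `&` [set p | s1 <= p.2 <= s2].
  by apply/seteqP; split => p /=; [move=> /andP[]|move=> [? ?]; apply/andP].
apply: closedI; apply: cl; move=> p; [exact: cvg_fst|exact: cvg_snd].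
Qed.

Section SquareSection.
Variable H : R * R -> Y.
Hypothesis cH : continuous H.

Lemma near_box i s0 t0 : U i (H (s0, t0)) -> exists2 d : R, 0 < d &
  forall p, box (s0 - d) (s0 + d) (t0 - d) (t0 + d) p -> U i (H p).
Proof.
have [Uo _ _] := ls; move=> Ui.
have : nbhs (s0, t0) (H @^-1` U i).
  by apply: cH; apply: open_nbhs_nbhs; split=> //; exact: Uo.
move=> /nbhs_ballP[d /= d0 dH]; exists (d / 2); first by rewrite divr_gt0.
move=> [s t] /andP[/= s1 t1]; apply: dH; split => /=;
  by rewrite /ball /= ltr_norml; lra.
Qed.

(** Continuity induction on the height: near [t0] a strip is prolonged by a box inside one chart,
    glued along a horizontal edge. The strip may get thinner each time, hence the quantified
    width. *)
Lemma strip_section s0 : exists d g, 0 < d /\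
  flat_section H (box (s0 - d) (s0 + d) 0 1) g.
Proof.
have [_ Uc _] := ls.
pose E t := exists d g, 0 < d /\ flat_section H (box (s0 - d) (s0 + d) 0 t) g.
suff : E 0 = E 1.
  have [i Ui] := Uc (H (s0, 0)); have [d d0 dU] := near_box Ui.
  move=> /= E01; have : E 0; last by rewrite E01.
  exists d, (a i \o H); split => //; apply: flat_section_chart => // p.
  by move=> /andP[p1 p2]; apply: dU; apply/andP; split; lra.
apply: unit_locally_constant; [|lra..] => t0 t01.
have [i Ui] := Uc (H (s0, t0)); have [d d0 dU] := near_box Ui.
have EE t t' : 0 <= t -> 0 <= t' -> t0 - d <= t <= t0 + d ->
    t0 - d <= t' <= t0 + d -> E t -> E t'.
  move=> tge0 t'ge0 td t'd [e [g [e0 fg]]].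
  have [tt'|t't] := leP t' t.
    exists e, g; split => //; apply: flat_section_sub fg => p /andP[p1 p2].
    by apply/andP; split; lra.
  pose m := Num.min d e; have m0 : 0 < m by rewrite lt_min d0.
  have md : m <= d by rewrite ge_min lexx.
  have me : m <= e by rewrite ge_min lexx orbT.
  have f1 : flat_section H (box (s0 - m) (s0 + m) 0 t) g.
    by apply: flat_section_sub fg => p /andP[p1 p2]; apply/andP; split; lra.
  have f2 : flat_section H (box (s0 - m) (s0 + m) t t') (a i \o H).
    apply: flat_section_chart => // p /andP[p1 p2]; apply: dU.
    by apply/andP; split; lra.
  have [|||h fh] := flat_section_glue (u := fun x => (s0 - m + 2 * m * x, t)) cH
      (@closed_box _ _ _ _) (@closed_box _ _ _ _) f1 f2.
  - apply: pair_continuous => x; last exact: cvg_cst.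
    by apply: cvgD; [exact: cvg_cst|apply: cvgM; [exact: cvg_cst|exact: cvg_id]].
  - move=> [x y] /andP[/= x1 y1] /andP[/= x2 y2].
    exists ((x - (s0 - m)) / (2 * m)).
      by rewrite divr_ge0 ?ler_pdivrMr ?mulr_gt0//; lra.
    by congr pair; [field; lra|lra].
  - by move=> x x01; split; apply/andP; split => /=; nra.
  exists m, h; split=> //; apply: flat_section_sub fh => p /andP[p1 p2].
  by have [?|?] := leP p.2 t; [left|right]; apply/andP; split; lra.
have : \forall t \near t0, t0 - d <= t <= t0 + d.
  apply/nbhs_ballP; exists d => //= t; rewrite /ball /= ltr_norml; lra.
apply: filterS => t td t1; apply/propext.
by split; apply: EE; lra.
Qed.

(** The same induction in the other direction, where the pieces added are strips glued along
    vertical edges. *)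
Lemma square_section : exists g, flat_section H square g.
Proof.
pose E b := exists g, flat_section H (box 0 b 0 1) g.
suff : E 0 = E 1.
  have [d [g [d0 fg]]] := strip_section 0.
  move=> /= E01; have : E 0.
    exists g; apply: flat_section_sub fg => p /andP[p1 p2].
    by apply/andP; split; lra.
  rewrite E01 => -[h fh]; exists h; apply: flat_section_sub fh => p.
  by rewrite squareE.
apply: unit_locally_constant; [|lra..] => s0 s01.
have [d [k [d0 fk]]] := strip_section s0.
have EE s s' : 0 <= s -> 0 <= s' -> s0 - d <= s <= s0 + d ->
    s0 - d <= s' <= s0 + d -> E s -> E s'.
  move=> sge0 s'ge0 sd s'd [g fg].
  have [ss'|s's] := leP s' s.
    exists g; apply: flat_section_sub fg => p /andP[p1 p2].
    by apply/andP; split; lra.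
  have f2 : flat_section H (box s s' 0 1) k.
    by apply: flat_section_sub fk => p /andP[p1 p2]; apply/andP; split; lra.
  have [|||h fh] := flat_section_glue (u := fun x => (s, x)) cH
      (@closed_box _ _ _ _) (@closed_box _ _ _ _) fg f2.
  - by apply: pair_continuous => x; [exact: cvg_cst|exact: cvg_id].
  - move=> [x y] /andP[/= x1 y1] /andP[/= x2 y2].
    by exists y => //; congr pair; lra.
  - by move=> x x01; split; apply/andP; split => /=; lra.
  exists h; apply: flat_section_sub fh => p /andP[p1 p2].
  by have [?|?] := leP p.1 s; [left|right]; apply/andP; split; lra.
have : \forall s \near s0, s0 - d <= s <= s0 + d.
  apply/nbhs_ballP; exists d => //= s; rewrite /ball /= ltr_norml; lra.
apply: filterS => s sd s1; apply/propext.
by split; apply: EE; lra.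
Qed.

End SquareSection.

Definition clamp2 (p : R * R) : R * R := (clamp p.1, clamp p.2).

Lemma clamp2_continuous : continuous clamp2.
Proof.
have c1 : continuous (clamp \o fst : R * R -> R).
  move=> p; apply: continuous_comp; [exact: cvg_fst|exact: clamp_continuous].
have c2 : continuous (clamp \o snd : R * R -> R).
  move=> p; apply: continuous_comp; [exact: cvg_snd|exact: clamp_continuous].
exact: pair_continuous c1 c2.
Qed.

Lemma continuous_into_within {S T W : topologicalType} (B : set T)
    (u : S -> T) (f : T -> W) : continuous u -> (forall s, B (u s)) ->
  {within B, continuous f} -> continuous (f \o u).
Proof.
move=> cu uB /subspace_continuousP cf s.
apply: cvg_trans (cf _ (uB s)) => V /= fV.
have := cu s _ fV; rewrite /within /= !nbhs_simpl /=.
by apply: filterS => z /= h; apply: h; exact: uB.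
Qed.

Lemma clamped_path_continuous (x y : Y) (f : R -> Y) :
  is_path x y f -> continuous (f \o clamp).
Proof.
move=> [cf _ _]; apply: continuous_into_within cf => [|s].
  exact: clamp_continuous.
by rewrite /= in_itv /=; exact: clamp01.
Qed.

Lemma clamped_square_continuous (H : R * R -> Y) :
  {within square, continuous H} -> continuous (H \o clamp2).
Proof.
apply: continuous_into_within => [|s]; first exact: clamp2_continuous.
by rewrite squareE /= !clamp01.
Qed.

Lemma clamped_square_section (H : R * R -> Y) : {within square, continuous H} ->
  exists g, flat_section (H \o clamp2) setT g.
Proof.
move=> cH; have [g fg] := square_section (clamped_square_continuous cH).
exists (g \o clamp2) => -[x y] i _ Ui.
have [_ _ aU] := ls.
have sq p : square (clamp2 p) by rewrite squareE /= !clamp01.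
have id2 p : clamp2 (clamp2 p) = clamp2 p by rewrite /clamp2 /= !(clamp_id (clamp01 _)).
have := fg (clamp2 (x, y)) i (sq _); rewrite /= id2 => /(_ Ui) /clamp2_continuous.
rewrite nbhs_simpl /=; apply: filterS => z' h.
by move=> _; have := h (sq z'); rewrite /= id2.
Qed.

(** Two flat sections along a path differ by a constant left factor, which cancels here. *)
Definition transport (f : R -> Y) : G :=
  xget 1%g [set x | exists2 g : R -> G, flat_section (f \o clamp) setT g &
                    x = ((g 0)^-1 * g 1%R)%g].

(** Allowing any [H] that agrees with [f] on [0, 1] lets sections found on a larger domain be
    restricted without reparametrizing them first. *)
Lemma transportE x y (f : R -> Y) (H : R -> Y) g : is_path x y f ->
  flat_section H setT g -> (forall t, 0 <= t <= 1 -> f t = H t) ->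
  transport f = ((g 0)^-1 * g 1%R)%g.
Proof.
move=> fp fg fH; have cf := clamped_path_continuous fp.
have {fg} : flat_section (f \o clamp) setT (g \o clamp).
  suff -> : f \o clamp = H \o clamp.
    by apply: flat_section_comp fg; exact: clamp_continuous.
  by apply/funext => t /=; rewrite fH// clamp01.
have -> : (g 0)^-1%g = ((g \o clamp) 0)^-1%g.
  by rewrite /= clamp_id// lexx ler01.
have -> : g 1 = (g \o clamp) 1 by rewrite /= clamp_id// lexx ler01.
move: (g \o clamp) => {}g fg; rewrite /transport; case: xgetP => [_ -> [h fh ->]|].
  have := flat_section_uniq fg fh (u := id) (s := 0) (t := 1).
  move=> /(_ (fun t => cvg_id) (fun _ _ => Logic.I)) e.
  apply/esym/(mulgI (g 0)); rewrite !mulgA mulgV mul1g.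
  by rewrite e ?lexx ?ler01// mulgVK.
by move=> /(_ _)/(_ (ex_intro2 _ _ g fg erefl)).
Qed.

Lemma path_flat_section x y (f : R -> Y) : is_path x y f ->
  exists g, flat_section (f \o clamp) setT g.
Proof.
move=> [cf _ _].
have [|g fg] := @clamped_square_section (f \o snd).
  apply: within_comp cf => [p|p]; first exact: cvg_snd.
  by rewrite squareE /= in_itv /= => /andP[].
exists (g \o (fun t : R => (0, t))).
rewrite [X in flat_section X](_ : _ = (f \o snd \o clamp2) \o (fun t => (0, t)))//.
apply: flat_section_comp fg.
by apply: pair_continuous => t; [exact: cvg_cst|exact: cvg_id].
Qed.

Lemma transport_chart x y (f : R -> Y) i : is_path x y f ->
  (forall t, 0 <= t <= 1 -> U i (f t)) -> transport f = ((a i x)^-1 * a i y)%g.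
Proof.
move=> fp fU; have [_ f0 f1] := fp.
rewrite (transportE (H := f \o clamp) (g := a i \o (f \o clamp)) fp).
- by rewrite /= !clamp_id ?f0 ?f1// lexx ler01.
- apply: flat_section_chart; first exact: clamped_path_continuous fp.
  by move=> t _; apply: fU; exact: clamp01.
- by move=> t t01; rewrite /= clamp_id.
Qed.

Lemma transport_functor : path_functor transport.
Proof.
split=> [x y z f h fp hp|x y f h fp hp [H [cH H01 Hs]]].
  have kp := is_path_cat fp hp; have [g fg] := path_flat_section kp.
  have c1 : continuous (fun t : R => t / 2).
    by move=> t; apply: cvgM; [exact: cvg_id|exact: cvg_cst].
  have c2 : continuous (fun t : R => t / 2 + 2^-1).
    by move=> t; apply: cvgD; [exact: c1|exact: cvg_cst].
  have [_ _ f1] := fp; have [_ h0 _] := hp.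
  rewrite (transportE kp fg); last by move=> t t01; rewrite /= clamp_id.
  rewrite (transportE fp (flat_section_comp c1 fg)); last first.
    move=> t t01; rewrite /= clamp_id; last lra.
    by rewrite /path_cat ifT; [congr f; field|lra].
  rewrite (transportE hp (flat_section_comp c2 fg)); last first.
    move=> t t01; rewrite /= clamp_id; last lra.
    rewrite /path_cat; case: ifPn => t2; last by congr h; field.
    have t0 : t = 0 by lra.
    rewrite t0 h0 -f1; congr f; by field.
  rewrite /= !mul0r add0r !mul1r !mulgA mulgK; congr (_ * g _)%g; lra.
have [g fg] := clamped_square_section cH.
have ch (s : R) : continuous (fun t : R => (s, t)).
  by apply: pair_continuous => t; [exact: cvg_cst|exact: cvg_id].
have cv (s : R) : continuous (fun t : R => (t, s)).
  by apply: pair_continuous => t; [exact: cvg_id|exact: cvg_cst].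
have [_ f0 f1] := fp; have i0 : 0 <= (0 : R) <= 1 by rewrite lexx ler01.
have i1 : 0 <= (1 : R) <= 1 by rewrite lexx ler01.
have E s : 0 <= s <= 1 -> forall k, is_path x y k ->
    (forall t, 0 <= t <= 1 -> H (s, t) = k t) ->
    transport k = ((g (s, 0))^-1 * g (s, 1%R))%g.
  move=> s01 k kp Hk; rewrite (transportE kp (flat_section_comp (ch s) fg))//.
  by move=> t t01; rewrite /= /clamp2 /= !clamp_id// Hk.
rewrite (E 0 i0 f fp); last by move=> t /H01[].
rewrite (E 1 i1 h hp); last by move=> t /H01[].
(* The end points stay fixed during the deformation, and a constant path has trivial transport
   because the constant section [1] is flat over it. *)
have C s : 0 <= s <= 1 -> forall z, (forall t, 0 <= t <= 1 -> H (t, s) = z) ->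
    g (0, s) = g (1, s).
  move=> s01 z Hz; have zp := @is_path_cst R _ z.
  have e1 := transportE zp (flat_section_comp (cv s) fg).
  have e2 : transport (fun=> z) = ((1 : G)^-1 * 1)%g.
    apply: (transportE (H := fun=> z) (g := fun=> 1%g) zp) => //.
    by move=> t i _ _; near=> t'.
  apply: (mulgI (g (0, s))^-1%g); rewrite mulVg.
  rewrite invg1 mulg1 in e2; rewrite -e2 e1// => t t01.
  by rewrite /= /clamp2 /= !clamp_id// Hz.
rewrite (C 0 i0 x); last by move=> t /Hs[-> _].
by rewrite (C 1 i1 y) => // t /Hs[_ ->].
Unshelve. all: by end_near. Qed.

End LocalSystems.

Lemma within_continuous_trans {S T W : topologicalType} (A : set S) (B : set T)
    (f : S -> T) (g : T -> W) : (forall s, A s -> B (f s)) ->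
  {within A, continuous f} -> {within B, continuous g} ->
  {within A, continuous (g \o f)}.
Proof.
move=> AB /subspace_continuousP cf /subspace_continuousP cg.
apply/subspace_continuousP => s As.
apply: cvg_trans (cg _ (AB _ As)) => V /= gV.
have := cf s As _ gV; rewrite /within /= !nbhs_simpl /=.
by apply: filterS => z /= h Az; apply: h => //; exact: AB.
Qed.

(** * Reduction of paths to small pieces *)

Section SmallPaths.
Context {R : realType} {Z : topologicalType}.

Lemma subpath_is_path (x y : Z) (f : R -> Z) a b : is_path x y f ->
  0 <= a <= 1 -> 0 <= b <= 1 ->
  is_path (f a) (f b) (fun s => f (a + s * (b - a))).
Proof.
move=> [cf f0 f1] a01 b01; split; last 2 first.
- by rewrite mul0r addr0.
- by rewrite mul1r addrC subrK.
apply: (within_comp (u := fun s : R => a + s * (b - a))) cf => [s|s].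
  apply: cvgD; first exact: cvg_cst.
  by apply: cvgM; [exact: cvg_id|exact: cvg_cst].
by rewrite /= !in_itv /=; nra.
Qed.

(** Both sides are reparametrizations of [f], so [a], [b], [c] may come in any order. *)
Lemma subpath_cat (x y : Z) (f : R -> Z) a b c : is_path x y f ->
  0 <= a <= 1 -> 0 <= b <= 1 -> 0 <= c <= 1 ->
  path_homotopic (path_cat (fun s => f (a + s * (b - a)))
                           (fun s => f (b + s * (c - b))))
                 (fun s => f (a + s * (c - a))).
Proof.
move=> fp a01 b01 c01.
pose q (t : R) := a + Num.min (2 * t) 1 * (b - a) + Num.max 0 (2 * t - 1) * (c - b).
have -> : path_cat (fun s => f (a + s * (b - a))) (fun s => f (b + s * (c - b))) =
    f \o q.
  apply/funext => t; rewrite /path_cat /q /=; case: ifPn => t2; congr f.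
    rewrite (_ : Num.min _ _ = 2 * t); last by rewrite minElt; case: ifPn; lra.
    by rewrite (_ : Num.max _ _ = 0); [ring|rewrite maxElt; case: ifPn; lra].
  rewrite (_ : Num.min _ _ = 1); last by rewrite minElt; case: ifPn; lra.
  rewrite (_ : Num.max _ _ = 2 * t - 1); last by rewrite maxElt; case: ifPn; lra.
  by ring.
apply: path_homotopic_reparam fp _ _ _ _ _ _.
- have c2 : continuous (fun t : R => 2 * t).
    by move=> t; apply: cvgM; [exact: cvg_cst|exact: cvg_id].
  move=> t; apply: cvgD; first apply: cvgD; first exact: cvg_cst.
    apply: cvgM; last exact: cvg_cst.
    by apply: (@continuous_min R R (fun t => 2 * t) (fun=> 1)); [exact: c2|exact: cvg_cst].
  apply: cvgM; last exact: cvg_cst.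
  apply: (@continuous_max R R (fun=> 0) (fun t => 2 * t - 1)); first exact: cvg_cst.
  by apply: cvgB; [exact: c2|exact: cvg_cst].
- move=> t; apply: cvgD; first exact: cvg_cst.
  by apply: cvgM; [exact: cvg_id|exact: cvg_cst].
- by move=> t t01; rewrite /q minElt maxElt; do 2 case: ifPn => ?; nra.
- by move=> t t01; nra.
- by rewrite /q minElt maxElt; do 2 case: ifPn => ?; lra.
- by rewrite /q minElt maxElt; do 2 case: ifPn => ?; lra.
Qed.

(** Takes the place of a Lebesgue number: the truth of [Q] on the initial segment of [f] up to [t]
    is locally constant in [t], as segments are lengthened or shortened by a piece inside one
    [V]. *)
Lemma small_path_ind (Q : (R -> Z) -> Prop) :
  (forall z, exists V, [/\ open V, V z & forall x y f, is_path x y f ->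
     (forall t : R, 0 <= t <= 1 -> V (f t)) -> Q f]) ->
  (forall x y z f g, is_path x y f -> is_path y z g -> Q f -> Q g ->
     Q (path_cat f g)) ->
  (forall x y f g, is_path x y f -> path_homotopic f g -> Q f -> Q g) ->
  forall x y f, is_path x y f -> Q f.
Proof.
move=> Qs Qc Qh x y f fp; pose E (t : R) := Q (fun s => f (0 + s * (t - 0))).
have i0 : 0 <= (0 : R) <= 1 by rewrite lexx ler01.
have i1 : 0 <= (1 : R) <= 1 by rewrite lexx ler01.
suff E01 : E 0 = E 1.
  have [V [_ Vx QV]] := Qs x.
  have : E 0.
    apply: QV (subpath_is_path fp i0 i0) _ => t _.
    by have [_ f0 _] := fp; rewrite subrr mulr0 addr0 f0.
  rewrite E01 /E; congr Q; apply/funext => s; congr f; ring.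
apply: unit_locally_constant => // t t01.
have [V [oV Vt QV]] := Qs (f t).
have cf := clamped_path_continuous fp.
have : \forall t' \near t, V (f (clamp t')).
  apply: cf; apply: open_nbhs_nbhs; split => //.
  by rewrite /= clamp_id.
move=> /nbhs_ballP[d /= d0 dV].
have EE a b : 0 <= a <= 1 -> 0 <= b <= 1 -> ball t d a -> ball t d b -> E a -> E b.
  move=> a01 b01; rewrite /ball /= !ltr_norml => ta tb Ea.
  have ap := subpath_is_path fp i0 a01; have abp := subpath_is_path fp a01 b01.
  apply: (Qh _ _ _ _ (is_path_cat ap abp) (subpath_cat fp i0 a01 b01)).
  apply: (Qc _ _ _ _ _ ap abp Ea); apply: (QV _ _ _ abp) => s s01.
  rewrite -[X in f X]clamp_id; last by nra.
  apply: dV; rewrite /ball /= ltr_norml.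
  have [ab|ba] := leP a b.
    by have : a <= a + s * (b - a) <= b; [nra|lra].
  by have : b <= a + s * (b - a) <= a; [nra|lra].
apply/nbhs_ballP; exists d => // t' tt' t'01; apply/propext.
by split; apply: EE => //; exact: ballxx.
Qed.

End SmallPaths.

(** * Contractible neighbourhoods relative to a boundary *)

Section Contraction.
Context {R : realType} {Z : topologicalType}.

Lemma contract_path (x y o : Z) (f : R -> Z) (H : R * R -> Z) : is_path x y f ->
  {within square, continuous H} ->
  (forall t, 0 <= t <= 1 -> H (0, t) = f t /\ H (1, t) = o) ->
  path_homotopic f (path_cat (fun s => H (s, 0))
    (path_cat (fun=> o) (path_rev (fun s => H (s, 1))))).
Proof.
move=> fp cH Hf.
(* The three other sides of the square, through (1, 0) and (1, 1), at the speeds 2, 4 and 4 imposed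
   by the nested [path_cat]. *)
pose v (t : R) : R * R :=
  (clamp (Num.min (2 * t) (4 - 4 * t)), clamp (4 * t - 2)).
have ca (a b : R) : continuous (fun t : R => a * t + b).
  move=> t; apply: cvgD; last exact: cvg_cst.
  by apply: cvgM; [exact: cvg_cst|exact: cvg_id].
have cm : continuous (fun t : R => Num.min (2 * t) (4 - 4 * t)).
  move=> t; apply: (@continuous_min R R (fun t => 2 * t) (fun t => 4 - 4 * t)).
    by apply: cvgM; [exact: cvg_cst|exact: cvg_id].
  apply: cvgB; first exact: cvg_cst.
  by apply: cvgM; [exact: cvg_cst|exact: cvg_id].
have c3 : continuous (clamp \o (fun t : R => 4 * t - 2)).
  by move=> t; apply: continuous_comp; [exact: ca|exact: clamp_continuous].
have c4 : continuous (clamp \o (fun t : R => Num.min (2 * t) (4 - 4 * t))).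
  by move=> t; apply: continuous_comp; [exact: cm|exact: clamp_continuous].
have cv : continuous v by exact: pair_continuous c4 c3.
have v1 t : 0 <= t <= 2^-1 -> v t = (2 * t, 0).
  move=> t2; rewrite /v (clamp_le0 (t := 4 * t - 2)); last lra.
  by rewrite minElt ifT ?clamp_id//; lra.
have v2 t : 2^-1 <= t <= 3 / 4 -> v t = (1, 4 * t - 2).
  move=> t2; rewrite /v (clamp_id (t := 4 * t - 2)); last lra.
  by rewrite minElt clamp_ge1//; case: ifPn; lra.
have v3 t : 3 / 4 <= t <= 1 -> v t = (4 - 4 * t, 1).
  move=> t2; rewrite /v (clamp_ge1 (t := 4 * t - 2)); last lra.
  by rewrite minElt ifF ?clamp_id//; lra.
have h1 := @square_homotopic R Z H (fun t => (0, t)) v cH.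
have h2 : path_homotopic (H \o (fun t => (0, t))) (H \o v).
  apply: h1 => //.
  - by apply: pair_continuous => t; [exact: cvg_cst|exact: cvg_id].
  - by move=> t t01; rewrite squareE /= lexx ler01.
  - by move=> t t01; rewrite squareE /v /= !clamp01.
  - by rewrite v1 ?mulr0//; lra.
  - by rewrite v3; [congr pair|]; lra.
apply: (@path_homotopic_trans _ _ (H \o (fun t => (0, t)))).
  by apply: path_homotopic_eq fp _ => t /Hf[<- _].
apply: (path_homotopic_trans h2).
have vp : is_path (H (0, 0)) (H (0, 1)) (H \o v).
  apply: path_homotopic_path h2; split => //.
  apply: within_comp cH => [|t]; last by rewrite squareE /= in_itv /= lexx ler01.
  by apply: pair_continuous => t; [exact: cvg_cst|exact: cvg_id].
apply: path_homotopic_eq vp _ => t t01; rewrite /path_cat /path_rev /=.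
have [t2|t2] := leP t 2^-1; first by rewrite v1//; lra.
have [t4|t4] := leP (2 * t - 1) 2^-1.
  by rewrite v2; [rewrite (Hf _ _).2//; lra|lra].
by rewrite v3; [congr H; congr pair; lra|lra].
Qed.

(** [cn_boundary] lets the contraction act on both copies of a double glued along [B], and
    [cn_interior] makes a single copy of [N] open in the double when [o] is off [B]. *)
Record contractible_nbhd (B : set Z) (o : Z) (N : set Z) (h : R -> Z -> Z) :
    Prop := ContractibleNbhd {
  cn_open : open N;
  cn_center : N o;
  cn_continuous : {within `[0, 1]%classic `*` N, continuous (fun p => h p.1 p.2)};
  cn_h0 : forall p, N p -> h 0 p = p;
  cn_h1 : forall p, N p -> h 1 p = o;
  cn_stable : forall s p, 0 <= s <= 1 -> N p -> N (h s p);
  cn_boundary : forall s p, 0 <= s <= 1 -> N p -> B p -> B (h s p);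
  cn_interior : ~ B o -> forall p, N p -> ~ B p }.

Definition radial (h : R -> Z -> Z) (p : Z) : R -> Z := fun t => h (1 - t) p.

Lemma radial_is_path B o N h p : contractible_nbhd B o N h -> N p ->
  is_path o p (radial h p).
Proof.
move=> cn Np; split; rewrite /radial ?subr0 ?subrr; last 2 first.
- exact: cn_h1 cn _ Np.
- exact: cn_h0 cn _ Np.
apply: (within_comp (u := fun t : R => (1 - t, p))) (cn_continuous cn) => [|t].
  apply: pair_continuous => t; last exact: cvg_cst.
  by apply: cvgB; [exact: cvg_cst|exact: cvg_id].
by rewrite /= !in_itv /= => t01; split => //=; lra.
Qed.

Lemma contractible_homotopic B o N h p q f : contractible_nbhd B o N h ->
  is_path p q f -> (forall t, 0 <= t <= 1 -> N (f t)) ->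
  path_homotopic f (path_cat (path_rev (radial h p))
                             (path_cat (fun=> o) (radial h q))).
Proof.
move=> cn fp fN; have [_ f0 f1] := fp.
have := @contract_path p q o f (fun z => h z.1 (f (clamp z.2))) fp.
rewrite /= !clamp_id ?f0 ?f1 ?lexx ?ler01//.
have -> : path_rev (radial h p) = h^~ p.
  by apply/funext => t; rewrite /path_rev /radial; congr h; lra.
apply.
  apply: (within_comp (u := fun z : R * R => (z.1, f (clamp z.2))))
    (cn_continuous cn) => [|z].
    apply: pair_continuous => z; first exact: cvg_fst.
    have c2 : continuous ((f \o clamp) \o (snd : R * R -> R)).
      move=> w; apply: continuous_comp; first exact: cvg_snd.
      exact: (clamped_path_continuous fp).
    exact: c2.
  rewrite squareE => /andP[z1 z2]; split; rewrite /= ?in_itv//=.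
  exact/fN/clamp01.
move=> t t01; rewrite clamp_id//; split.
  by rewrite (cn_h0 cn)//; exact: fN.
by rewrite (cn_h1 cn)//; exact: fN.
Qed.

(** Local triviality: inside [N] the value of [phi] depends on the end points only, with
    [phi (radial h p)] as a primitive. *)
Lemma path_functor_contractible {G : groupType} (phi : (R -> Z) -> G)
    B o N h p q f : path_functor phi -> contractible_nbhd B o N h ->
  is_path p q f -> (forall t, 0 <= t <= 1 -> N (f t)) ->
  phi f = ((phi (radial h p))^-1 * phi (radial h q))%g.
Proof.
move=> pf cn fp fN; have hf := contractible_homotopic cn fp fN.
have [_ f0 f1] := fp; have i0 : 0 <= (0 : R) <= 1 by rewrite lexx ler01.
have i1 : 0 <= (1 : R) <= 1 by rewrite lexx ler01.
have Np : N p by rewrite -f0; exact: fN.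
have Nq : N q by rewrite -f1; exact: fN.
have pp := radial_is_path cn Np; have qp := radial_is_path cn Nq.
have rp := is_path_rev pp; have op := @is_path_cst R _ o.
rewrite (pf.2 _ _ _ _ fp (path_homotopic_path fp hf) hf).
rewrite (pf.1 _ _ _ _ _ rp (is_path_cat op qp)) (pf.1 _ _ _ _ _ op qp).
by rewrite (path_functor_rev pf pp) (path_functor_cst _ pf) mul1g.
Qed.

End Contraction.

Definition locally_contractible (R : realType) {Z : topologicalType} (B : set Z) :
    Prop :=
  forall o M, open M -> M o ->
    exists N h, @contractible_nbhd R Z B o N h /\ N `<=` M.

Lemma locally_contractible_path_connected {R : realType} {Z : topologicalType}
    (B : set Z) (x y : Z) :
  locally_contractible R B -> connected [set: Z] ->
  exists f : R -> Z, is_path x y f.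
Proof.
move=> lc cZ; pose P := [set z | exists f : R -> Z, is_path x z f].
have PN o N h : @contractible_nbhd R Z B o N h -> forall p q, N p -> N q -> P p -> P q.
  move=> cn p q Np Nq [f fp]; exists (path_cat f (path_cat (path_rev (radial h p)) (radial h q))).
  apply: is_path_cat fp (is_path_cat _ (radial_is_path cn Nq)).
  exact/is_path_rev/(radial_is_path cn Np).
suff : P = setT by rewrite -subTset => /(_ y Logic.I).
have nP (Q : set Z) : (forall o N h, @contractible_nbhd R Z B o N h ->
    forall p q, N p -> N q -> Q p -> Q q) -> open Q.
  move=> QN; rewrite openE => z Qz; have [N [h [cn _]]] := lc z setT openT Logic.I.
  apply: filterS (open_nbhs_nbhs (conj (cn_open cn) (cn_center cn))) => q Nq.
  exact: QN cn _ _ (cn_center cn) Nq Qz.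
have oP : open P by exact: nP.
have oCP : open (~` P).
  by apply: nP => o N h cn p q Np Nq nPp Pq; apply: nPp; exact: PN cn _ _ Nq Np Pq.
apply: cZ; first by exists x, (fun=> x); exact: is_path_cst.
- by exists P => //; rewrite setTI.
- by exists P; rewrite ?setTI// -[X in closed X]setCK; exact: open_closedC.
Qed.

(** * Topology of the double *)

Section DoubleTopology.
Context {X : topologicalType} (B : set X).
Local Notation Y := (surface_double B).
Local Notation j := (@Defs.double_inj X B).

Definition fold (q : Y) : X := (repr q).2.

Lemma double_reprE (q : Y) : q = j (repr q).1 (fold q).
Proof. by rewrite /Defs.double_inj -surjective_pairing reprK. Qed.

Lemma double_case (q : Y) : exists k x, q = j k x.
Proof. by exists (repr q).1, (fold q); exact: double_reprE. Qed.

Lemma foldE k x : fold (j k x) = x.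
Proof. by have /double_injE[] := double_reprE (j k x). Qed.

Lemma double_injC k l x : B x -> j k x = j l x.
Proof. by move=> Bx; apply/double_injE; split => //; right. Qed.

Lemma double_side_continuous k : continuous (j k).
Proof.
have ck : continuous (fun x : X => (k, x)).
  by apply: pair_continuous => x; [exact: cvg_cst|exact: cvg_id].
move=> x; apply: (@continuous_comp _ _ _ (fun x => (k, x)) \pi_Y); first exact: ck.
exact: pi_continuous.
Qed.

Lemma continuous_double {Z : topologicalType} (f : Y -> Z) :
  (forall k, continuous (f \o j k)) -> continuous f.
Proof.
move=> cf; apply/quotient_continuous => -[k x] W Wf.
exists ([set k], (f \o j k) @^-1` W).
  by split => //=; exact: cf Wf.
by move=> [l x'] /= [-> ].
Qed.

Lemma fold_continuous : continuous fold.
Proof.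
apply: continuous_double => k; rewrite (_ : fold \o j k = id).
  by move=> x; exact: cvg_id.
by apply/funext => x /=; exact: foldE.
Qed.

Lemma double_bar_continuous : continuous (@double_bar X B).
Proof.
apply: continuous_double => k.
rewrite (_ : _ \o _ = j (~~ k)); first exact: double_side_continuous.
by apply/funext => x /=; exact: double_barE.
Qed.

Definition side (k : bool) : set Y := range (j k).

Lemma sideE k l x : side k (j l x) <-> l = k \/ B x.
Proof.
split=> [[x' _ /double_injE[-> [->|?]]]|[->|Bx]]; [by left|by right|by exists x|].
by exists x => //; exact: double_injC.
Qed.

Lemma side_fold k q : side k q -> q = j k (fold q).
Proof. by move=> [x _ <-]; rewrite foldE. Qed.

Lemma side_total q : side false q \/ side true q.
Proof.
have [k [x ->]] := double_case q.
by case: k; [right|left]; exists x.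
Qed.

Lemma open_double (W : set Y) : (forall k, open (j k @^-1` W)) -> open W.
Proof.
move=> oW; rewrite openE => q Wq; have [k [x qE]] := double_case q.
suff : open (\pi_Y @^-1` W : set (bool * X)).
  move=> oW'; have : open W by [].
  by rewrite openE; exact.
rewrite openE => -[l x'] Wlx; exists ([set l], j l @^-1` W).
  by split => //=; apply: open_nbhs_nbhs; split => //; exact: oW.
by move=> [l' x''] /= [-> ].
Qed.

Hypothesis cB : closed B.

Lemma closed_side k : closed (side k).
Proof.
rewrite -[side k]setCK; apply: open_closedC; apply: open_double => l.
have [->|lk] := eqVneq l k.
  rewrite (_ : _ @^-1` _ = set0); first exact: open0.
  by rewrite -subset0 => x /=; apply; exists x.
rewrite (_ : _ @^-1` _ = ~` B); first exact: closed_openC.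
apply/seteqP; split => x /=; rewrite sideE.
  by move=> h Bx; apply: h; right.
by move=> nB [e|//]; rewrite e eqxx in lk.
Qed.

(** Used with [b] equal to [B o]: around a boundary point both copies of [N] are taken, around an
    interior point only the copy [k]. *)
Definition double_over (N : set X) (b : Prop) (k : bool) : set Y :=
  [set q | N (fold q) /\ (b \/ side k q)].

Lemma open_double_over N (b : Prop) k : open N -> (~ b -> forall x, N x -> ~ B x) ->
  open (double_over N b k).
Proof.
move=> oN bN; apply: open_double => l; have [hb|nb] := pselect b.
  rewrite (_ : _ @^-1` _ = N)//; apply/seteqP.
  split => x; rewrite /double_over /= foldE; first by case.
  by move=> Nx; split => //; left.
have [->|lk] := eqVneq l k.
  rewrite (_ : _ @^-1` _ = N)//; apply/seteqP.
  split => x; rewrite /double_over /= foldE; first by case.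
  by move=> Nx; split => //; right; exists x.
rewrite (_ : _ @^-1` _ = set0); first exact: open0.
rewrite -subset0 => x /=; rewrite /double_over /= foldE sideE => -[Nx [//|[e|Bx]]].
  by rewrite e eqxx in lk.
exact: bN Nx Bx.
Qed.

End DoubleTopology.

(** * Paths of the double are generated by paths in either copy *)

Section Generation.
Context {R : realType} {X : topologicalType} (B : set X).
Hypotheses (cB : closed B) (lc : locally_contractible R B).
Local Notation Y := (surface_double B).
Local Notation j := (@Defs.double_inj X B).

(** The contraction of [N] is applied in whichever copy the path currently lies. Since [o] is on
    [B], both copies contract to the same point, and the path falls apart into two radial paths,
    each in one copy. *)
Lemma contract_double (o : X) N h (f : R -> Y) p q : contractible_nbhd B o N h ->
  B o -> is_path p q f -> (forall t : R, 0 <= t <= 1 -> N (fold (f t))) ->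
  exists k l, [/\ p = j k (fold p), q = j l (fold q) &
  path_homotopic f (path_cat (j k \o path_rev (radial h (fold p)))
    (path_cat (fun=> j k o) (j l \o radial h (fold q))))].
Proof.
move=> cn Bo fp fN; have [_ f0 f1] := fp.
have cf := clamped_path_continuous fp.
pose H (z : R * R) : Y := j (repr (f (clamp z.2))).1 (h z.1 (fold (f (clamp z.2)))).
have c2 : continuous ((f \o clamp) \o (snd : R * R -> R)).
  by move=> w; apply: continuous_comp; [exact: cvg_snd|exact: cf].
(* Two closed sets of parameters, according to the copy containing [f]. On their overlap [f] is on
   [B] and stays there by [cn_boundary], so [H] has one continuous expression on each. *)
pose S k : set (R * R) := square `&` ((f \o clamp) \o snd) @^-1` side k.
have cS k : closed (S k).
  apply: closedI; first exact: closed_square.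
  by move/continuous_closedP : c2; apply; exact: closed_side.
have HS k z : S k z -> j k (h z.1 (fold (f (clamp z.2)))) = H z.
  move=> [sz /= fz]; rewrite /H; apply/double_injE; split => //.
  rewrite [X in side _ X]double_reprE in fz; have /sideE[->|Bf] := fz; first by left.
  right; apply: cn_boundary cn _ _ _ _ Bf; last exact/fN/clamp01.
  by move: sz; rewrite squareE => /andP[].
have cH : {within square, continuous H}.
  have -> : square = S false `|` S true :> set (R * R).
    rewrite -setIUr; apply/esym/setIidPl => z _ /=; exact: side_total.
  have cK k : {within S k, continuous (j k \o (fun z => h z.1 (fold (f (clamp z.2)))))}.
    apply: continuous_comp_within; first exact: double_side_continuous.
    apply: (within_comp (u := fun z : R * R => (z.1, fold (f (clamp z.2)))))
      (cn_continuous cn) => [|z].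
      have c3 : continuous ((@fold X B) \o ((f \o clamp) \o (snd : R * R -> R))).
        by move=> z; apply: continuous_comp; [exact: c2|exact: fold_continuous].
      by apply: pair_continuous => [z|]; [exact: cvg_fst|exact: c3].
    move=> [+ _]; rewrite squareE => /andP[z1 z2]; split; rewrite /= ?in_itv//=.
    exact/fN/clamp01.
  apply: withinU_continuous => //; first exact: within_eq (HS _) (cK _).
  exact: within_eq (HS _) (cK _).
have i0 : 0 <= (0 : R) <= 1 by rewrite lexx ler01.
have i1 : 0 <= (1 : R) <= 1 by rewrite lexx ler01.
have Hf t : 0 <= t <= 1 -> H (0, t) = f t /\ H (1, t) = j (repr p).1 o.
  move=> t01; rewrite /H /= clamp_id// (cn_h0 cn); last exact: fN.
  rewrite (cn_h1 cn); last exact: fN.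
  by rewrite -double_reprE; split => //; exact: double_injC.
exists (repr p).1, (repr q).1; rewrite -!double_reprE; split => //.
have := contract_path fp cH Hf; rewrite /H /= !clamp_id// f0 f1.
congr (path_homotopic _ (path_cat _ (path_cat _ _))); apply/funext => t.
by rewrite /= /path_rev /radial; congr (j _ (h _ _)); lra.
Qed.

(** Near an interior point a small path stays in one copy. Near a boundary point it may cross [B]
    infinitely often, and [contract_double] replaces it by radial paths. *)
Lemma double_path_ind (Q : (R -> Y) -> Prop) :
  (forall k x y f, is_path x y f -> Q (j k \o f)) ->
  (forall x y z f g, is_path x y f -> is_path y z g -> Q f -> Q g ->
     Q (path_cat f g)) ->
  (forall x y f g, is_path x y f -> path_homotopic f g -> Q f -> Q g) ->
  forall x y f, is_path x y f -> Q f.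
Proof.
move=> Qj Qc Qh; apply: small_path_ind => // q.
have [k [z0 qE]] := double_case q; move: z0 qE => o ->.
have [N [h [cn _]]] := lc openT (Logic.I : setT o).
exists (double_over N (B o) k); split.
- by apply: open_double_over (cn_open cn) _; exact: cn_interior cn.
- by rewrite /double_over /= foldE; split; [exact: cn_center cn|right; exists o].
move=> x y f fp fU; have [_ f0 f1] := fp.
have i0 : 0 <= (0 : R) <= 1 by rewrite lexx ler01.
have i1 : 0 <= (1 : R) <= 1 by rewrite lexx ler01.
have [Bo|nBo] := pselect (B o).
  have fN t : 0 <= t <= 1 -> N (fold (f t)) by move=> /fU[].
  have [l [m [xl ym hf]]] := contract_double cn Bo fp fN.
  have Nx : N (fold x) by rewrite -f0; exact: fN.
  have Ny : N (fold y) by rewrite -f1; exact: fN.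
  have p1 := is_path_rev (radial_is_path cn Nx).
  have p2 := radial_is_path cn Ny.
  have jp1 := is_path_comp (@double_side_continuous X B l) p1.
  have jp2 := is_path_comp (@double_side_continuous X B m) p2.
  rewrite (double_injC m l Bo) in jp2.
  have p3 := @is_path_cst R _ (j l o).
  have jp3 := is_path_cat p3 jp2.
  apply: Qh (is_path_cat jp1 jp3) (path_homotopic_sym hf) _.
  apply: (Qc _ _ _ _ _ jp1 jp3); first exact: Qj p1.
  apply: (Qc _ _ _ _ _ p3 jp2); last exact: Qj p2.
  exact: Qj (@is_path_cst R _ o).
have jf : path_homotopic (j k \o ((@fold X B) \o f)) f.
  apply/path_homotopic_sym; apply: path_homotopic_eq fp _ => t /fU[_ [//|]].
  by move=> /side_fold.
have ffp := is_path_comp (@fold_continuous X B) fp.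
apply: Qh (is_path_comp (@double_side_continuous X B k) ffp) jf _.
exact: Qj ffp.
Qed.

Lemma double_functor_eq {G : groupType} (phi psi : (R -> Y) -> G) :
  path_functor phi -> path_functor psi ->
  (forall k x y f, is_path x y f -> phi (j k \o f) = psi (j k \o f)) ->
  forall x y f, is_path x y f -> phi f = psi f.
Proof.
move=> pphi ppsi e; apply: double_path_ind => //.
- move=> x y z f g fp gp ef eg.
  by rewrite (pphi.1 _ _ _ _ _ fp gp) (ppsi.1 _ _ _ _ _ fp gp) ef eg.
- move=> x y f g fp fg; have gp := path_homotopic_path fp fg.
  by rewrite (pphi.2 _ _ _ _ fp gp fg) (ppsi.2 _ _ _ _ fp gp fg).
Qed.

End Generation.

(** * Gluing a flat bundle and its twist over the double *)

Section DoubleExtension.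
Context {R : realType} {X : topologicalType} (B : set X) {G : groupType}.
Hypothesis lc : locally_contractible R B.
Local Notation Y := (surface_double B).
Local Notation j := (@Defs.double_inj X B).
Variables (phi : (R -> X) -> G) (t : X -> G).
Hypothesis pphi : path_functor phi.
Hypothesis flat : forall o, B o -> exists M, [/\ open M, M o &
  forall p f, is_path o p f -> (forall s, 0 <= s <= 1 -> M (f s)) -> B p ->
    (t o * phi f = phi f * t p)%g].

Lemma path_functor_gauge : path_functor
  (fun f => t (f 0%R) * phi f * (t (f 1%R))^-1)%g.
Proof.
split=> [x y z f g fp gp|x y f g fp gp fg].
  have [_ f0 f1] := fp; have [_ g0 g1] := gp.
  have [_ h0 h1] := is_path_cat fp gp; rewrite f0 f1 g0 g1 h0 h1.
  by rewrite (pphi.1 _ _ _ _ _ fp gp) !mulgA mulgVK.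
have [_ f0 f1] := fp; have [_ g0 g1] := gp.
by rewrite f0 f1 g0 g1 (pphi.2 _ _ _ _ fp gp fg).
Qed.

Let nbhd_ex (o : X) : exists Nh : set X * (R -> X -> X),
  contractible_nbhd B o Nh.1 Nh.2 /\ (B o -> forall p, Nh.1 p -> B p ->
    (t o * phi (radial Nh.2 p) = phi (radial Nh.2 p) * t p)%g).
Proof.
have [Bo|nBo] := pselect (B o); last first.
  by have [N [h [cn _]]] := lc openT (Logic.I : setT o); exists (N, h).
have [M [oM Mo tM]] := flat Bo; have [N [h [cn NM]]] := lc oM Mo.
exists (N, h); split => // _ p Np Bp; apply: tM Bp.
  exact: radial_is_path cn Np.
by move=> s s01; apply/NM/(cn_stable cn) => //; lra.
Qed.

(** Local primitives of [phi] on one copy and of its gauge transform by [t] on the other agree on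
    [B] by [flat]. They are the charts of a local system on the double, and [Phi] is its
    transport. *)
Theorem double_extension : exists Phi : (R -> Y) -> G, path_functor Phi /\
  forall k x y f, is_path x y f ->
    Phi (j k \o f) = (if k then t x * phi f * (t y)^-1 else phi f)%g.
Proof.
have [Nh NhP] := choice nbhd_ex.
pose N o := (Nh o).1; pose h o := (Nh o).2.
have cn o : contractible_nbhd B o (N o) (h o) := (NhP o).1.
(* No condition on [o] is left: if [o] is interior, [N o] contains no boundary point [p]. *)
have fl o p : N o p -> B p ->
    (t o * phi (radial (h o) p) = phi (radial (h o) p) * t p)%g.
  move=> Np Bp; apply: (NhP o).2 => //; apply: contrapT => nBo.
  exact: cn_interior (cn o) nBo _ Np Bp.
pose U (i : X * bool) : set Y := double_over (N i.1) (B i.1) i.2.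
(* The left factor [t o] is a constant of the chart, chosen so that by [fl] both expressions
   coincide on [B]. The copy picked by [repr] in [a] is then immaterial. *)
pose b o (k : bool) p := (if k then t o * phi (radial (h o) p) * (t p)^-1
                          else phi (radial (h o) p))%g.
pose a (i : X * bool) (q : Y) := b i.1 (repr q).1 (fold q).
have bB o k l p : N o p -> B p -> b o k p = b o l p.
  by move=> Np Bp; rewrite /b; case: k; case: l => //; rewrite fl// mulgK.
have aE i k p : N i.1 p -> a i (j k p) = b i.1 k p.
  move=> Np; rewrite /a foldE.
  have /sideE : side (repr (j k p)).1 (j k p).
    by rewrite {2}[j k p]double_reprE; exists (fold (j k p)).
  by move=> [<-//|Bp]; exact: bB.
have bM o k p q f : is_path p q f -> (forall s, 0 <= s <= 1 -> N o (f s)) ->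
    ((b o k p)^-1 * b o k q = if k then t p * phi f * (t q)^-1 else phi f)%g.
  move=> fp fN; rewrite (path_functor_contractible pphi (cn o) fp fN) /b.
  by case: k => //; rewrite !invgM !invgK !mulgA mulgVK.
have ls : local_system U a.
  split=> [i|q|i i' q].
  - by apply: open_double_over (cn_open (cn i.1)) _; exact: cn_interior (cn i.1).
  - have [k [z ->]] := double_case q; exists (z, k).
    by rewrite /U /double_over /= foldE; split; [exact: cn_center (cn z)|right; exists z].
  have [k [z ->]] := double_case q; rewrite /U /double_over /= foldE.
  move=> [Nz kz] [N'z kz'].
  (* A contractible neighbourhood inside both charts: along its radial path from [z] to [p] both
     primitives compute the same holonomy, so their quotient is the same at [z] and at [p]. *)
  have [N2 [h2 [cn2 N2s]]] := lc (openI (cn_open (cn i.1)) (cn_open (cn i'.1)))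
    (conj Nz N'z).
  have oW : open (double_over N2 (B z) k : set Y).
    by apply: open_double_over (cn_open cn2) _; exact: cn_interior cn2.
  have Wz : (double_over N2 (B z) k : set Y) (j k z).
    by rewrite /double_over /= foldE; split; [exact: cn_center cn2|right; exists z].
  apply: filterS (open_nbhs_nbhs (conj oW Wz)) => w [].
  have [l [p ->]] := double_case w; rewrite foldE sideE => N2p kl.
  have [Np N'p] := N2s _ N2p.
  have {}kl : j k z = j l z.
    by case: kl => [|[<-//|Bp]]; [exact: double_injC|apply: double_injC;
      apply: contrapT => nBz; exact: cn_interior cn2 nBz _ N2p Bp].
  rewrite kl !aE//.
  have rp := radial_is_path cn2 N2p.
  have rN s : 0 <= s <= 1 -> N2 (radial h2 p s).
    by move=> s01; apply: (cn_stable cn2) => //; lra.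
  have e := bM i.1 l _ _ _ rp (fun s s01 => (N2s _ (rN s s01)).1).
  have e' := bM i'.1 l _ _ _ rp (fun s s01 => (N2s _ (rN s s01)).2).
  rewrite -e' in e.
  by apply: (mulgI (b i.1 l z)^-1%g); rewrite !mulgA mulVg mul1g e mulgK.
exists (transport U a); split=> [|k]; first exact: transport_functor.
have pT := @transport_functor R _ _ _ _ _ ls.
pose psi (f : R -> X) := (if k then t (f 0%R) * phi f * (t (f 1%R))^-1 else phi f)%g.
have ppsi : path_functor psi by rewrite /psi; case: (k); [exact: path_functor_gauge|].
suff e x y f : is_path x y f -> transport U a (j k \o f) = psi f.
  move=> x y f fp; rewrite (e _ _ _ fp) /psi.
  by have [_ -> ->] := fp.
apply: (small_path_ind (Q := fun f => transport U a (j k \o f) = psi f)).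
- move=> z; exists (N z); split; [exact: cn_open (cn z)|exact: cn_center (cn z)|].
  move=> {}x {}y {}f fp fN; have [_ f0 f1] := fp.
  have Nx : N z x by rewrite -f0; apply: fN; rewrite lexx ler01.
  have Ny : N z y by rewrite -f1; apply: fN; rewrite lexx ler01.
  have jf := is_path_comp (@double_side_continuous X B k) fp.
  rewrite (transport_chart (i := (z, k)) ls jf); last first.
    by move=> s s01; rewrite /U /double_over /= foldE; split; [exact: fN|right; exists (f s)].
  by rewrite !aE//= (bM z k _ _ _ fp fN) /psi f0 f1.
- move=> {}x {}y z {}f g fp gp ef eg; rewrite path_cat_comp.
  have jf := is_path_comp (@double_side_continuous X B k) fp.
  have jg := is_path_comp (@double_side_continuous X B k) gp.
  by rewrite (pT.1 _ _ _ _ _ jf jg) (ppsi.1 _ _ _ _ _ fp gp) ef eg.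
- move=> {}x {}y {}f g fp fg; have gp := path_homotopic_path fp fg.
  rewrite -(ppsi.2 _ _ _ _ fp gp fg) => <-.
  have cj := @double_side_continuous X B k.
  apply: (pT.2 _ _ _ _ (is_path_comp cj gp) (is_path_comp cj fp)).
  exact/path_homotopic_comp/path_homotopic_sym.
Qed.

End DoubleExtension.

(** * Surfaces with boundary: contractibility near a point, arcs of the boundary *)

Section SurfaceTopology.
Context {R : realType} {X : topologicalType} (A : set (@chart R X)).
Hypothesis sA : oriented_surface A.
Local Notation B := (boundary A).

(** [boundary] is witnessed by one chart; the first clause of [oriented_transition] transfers the
    condition to all the others. *)
Lemma boundary_chart c x : A c -> c.1 x -> B x -> (c.2 x).2 = 0.
Proof.
have [_ _ _ _ tA] := sA => Ac cx [d Ad [dx d0]].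
by have [[_ cd] _] := tA _ _ Ac Ad _ cx dx; exact: cd.
Qed.

Lemma chart_continuous c x : A c -> c.1 x -> {for x, continuous c.2}.
Proof.
have [_ _ cA _ _] := sA => Ac cx; have [oc cc _ _] := cA _ Ac.
move: cc; rewrite continuous_open_subspace// => cc.
by apply: cc; rewrite inE.
Qed.

Lemma chart_half_plane c x : A c -> c.1 x -> 0 <= (c.2 x).2.
Proof.
have [_ _ cA _ _] := sA => Ac cx; have [oc _ _ oi] := cA _ Ac.
have [V _ VE] := oi c.1 oc (fun _ h => h).
have : (c.2 @` c.1) (c.2 x) by exists x.
by rewrite VE => -[].
Qed.

Lemma closed_boundary : closed B.
Proof.
have [_ _ cA covA _] := sA.
rewrite -[B]setCK; apply: open_closedC; rewrite openE => x nBx.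
have [c Ac cx] := covA x; have [oc _ _ _] := cA _ Ac.
have c0 : 0 < (c.2 x).2.
  rewrite lt_neqAle chart_half_plane// andbT eq_sym; apply/eqP => c0.
  by apply: nBx; exists c.
have oU : open [set p : R * R | 0 < p.2].
  have : continuous (snd : R * R -> R) by move=> p; exact: cvg_snd.
  by move=> /continuousP /(_ _ (@open_gt R 0)).
have := chart_continuous Ac cx (open_nbhs_nbhs (conj oU c0)).
rewrite nbhs_simpl /= => n1.
have n2 := open_nbhs_nbhs (conj oc cx).
apply: filterS (filterI n1 n2) => z [/= z0 cz] Bz.
by move: z0; rewrite (boundary_chart Ac cz Bz) ltxx.
Qed.

(** In a chart, a ball cut by the half-plane is convex, and a linear contraction towards a point of
    the boundary line preserves that line. *)
Lemma surface_locally_contractible : locally_contractible R B.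
Proof.
have [_ _ cA covA _] := sA; move=> o M oM Mo.
have [c Ac co] := covA o; have [oc _ ic imc] := cA _ Ac.
(* If [o] is interior, the last set removes the closed set [B], as [cn_interior] demands; otherwise
   it is everything. *)
pose D := c.1 `&` (M `&` [set p | B o \/ ~ B p]).
have oD : open D.
  apply: openI => //; apply: openI => //.
  have [Bo|nBo] := pselect (B o).
    by rewrite (_ : [set p | _] = setT); [exact: openT|apply/seteqP; split => // p _; left].
  rewrite (_ : [set p | _] = ~` B); first exact/closed_openC/closed_boundary.
  by apply/seteqP; split => p /= => [[]//|]; right.
have Dc : D `<=` c.1 by move=> p [].
have Do : D o by split => //; split => //=; have [] := pselect (B o); [left|right].
have [V oV DV] := imc D oD Dc.
(* The inverse chart. The default value [o] only occurs outside the image of [D]. *)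
pose v w := xget o [set x | D x /\ c.2 x = w].
have uv w : V w -> 0 <= w.2 -> D (v w) /\ c.2 (v w) = w.
  move=> Vw w0; have : (V `&` half_plane) w by split.
  rewrite -DV => -[x Dx xw]; rewrite /v.
  by case: xgetP => [_ -> //|/(_ x)]; case.
have vu x : D x -> v (c.2 x) = x.
  move=> Dx; have : (c.2 @` D) (c.2 x) by exists x.
  rewrite DV => -[Vx x0]; have [Dv e] := uv _ Vx x0.
  by apply: ic e; rewrite inE; exact: Dc.
have Du x : D x -> V (c.2 x) /\ 0 <= (c.2 x).2.
  move=> Dx; have : (c.2 @` D) (c.2 x) by exists x.
  by rewrite DV.
(* The last clause of [is_chart] makes images of open sets relatively open in the half-plane, which
   is continuity of the inverse. *)
have cv : {within V `&` half_plane, continuous v}.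
  apply/subspace_continuousP => w [Vw w0] W; rewrite nbhsE => -[W' [oW' W'w] W'W].
  have [Dv e] := uv _ Vw w0.
  have oW : open (W' `&` D) by exact: openI.
  have [V' oV' V'E] := imc _ oW (fun p h => Dc p h.2).
  have V'w : V' w.
    have : (c.2 @` (W' `&` D)) w by exists (v w).
    by rewrite V'E => -[].
  rewrite /within /= nbhs_simpl.
  apply: filterS (open_nbhs_nbhs (conj oV' V'w)) => w' V'w' [Vw' w'0] /=.
  have : (V' `&` half_plane) w' by split.
  rewrite -V'E => -[x [W'x Dx] <-]; by apply: W'W; change (W' (v (c.2 x))); rewrite vu.
have [Vo o0] := Du _ Do.
have /nbhs_ballP[r /= r0 rV] : nbhs (c.2 o) V by apply: open_nbhs_nbhs.
pose N := D `&` c.2 @^-1` ball (c.2 o) r.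
pose lin (s : R) (w : R * R) : R * R :=
  ((1 - s) * w.1 + s * (c.2 o).1, (1 - s) * w.2 + s * (c.2 o).2).
pose h s p := v (lin s (c.2 p)).
have linr (s : R) (w : R * R) : 0 <= s <= 1 -> ball (c.2 o) r w -> ball (c.2 o) r (lin s w).
  by move=> s01 [r1 r2]; split; [move: r1|move: r2];
    rewrite /lin /ball /= !ltr_norml => /andP[b1 b2]; apply/andP; split; nra.
have lin0 (s : R) (w : R * R) : 0 <= s <= 1 -> 0 <= w.2 -> 0 <= (lin s w).2.
  by move=> s01 w0; rewrite /lin /=; nra.
have hP s p : 0 <= s <= 1 -> N p -> D (h s p) /\ c.2 (h s p) = lin s (c.2 p).
  move=> s01 [Dp rp]; apply: uv; first exact/rV/linr.
  by apply: lin0 => //; have [] := Du _ Dp.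
exists N, h; split; last by move=> p [[_ []]].
split.
- rewrite openE => x [Dx rx].
  have n1 := chart_continuous Ac (Dc _ Dx).
  have := n1 _ (open_nbhs_nbhs (conj (ball_open (c.2 o) r) rx)).
  rewrite nbhs_simpl /= => n2.
  exact: filterS (filterI (open_nbhs_nbhs (conj oD Dx)) n2).
- by split => //; exact: ballxx.
- apply: (within_continuous_trans (f := fun p : R * X => lin p.1 (c.2 p.2))
    (g := v) _ _ cv).
    move=> [s p] [/=]; rewrite in_itv /= => s01 [Dp rp]; split; first exact/rV/linr.
    by apply: lin0 => //; have [] := Du _ Dp.
  apply/subspace_continuousP => -[s p] [/=]; rewrite in_itv /= => s01 [Dp rp].
  apply: cvg_within_filter.
  have c21 : continuous (fun q : R * (R * R) => q.2.1).
    by move=> q; apply: (@continuous_comp _ _ _ snd fst); [exact: cvg_snd|exact: cvg_fst].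
  have c22 : continuous (fun q : R * (R * R) => q.2.2).
    by move=> q; apply: (@continuous_comp _ _ _ snd snd); [exact: cvg_snd|exact: cvg_snd].
  have cg : continuous (fun q : R * (R * R) => lin q.1 q.2).
    apply: pair_continuous => q; apply: cvgD; apply: cvgM;
      by [exact: c21|exact: c22|exact: cvg_cst|exact: cvg_fst
         |apply: cvgB; [exact: cvg_cst|exact: cvg_fst]].
  have ck : {for (s, p), continuous (fun q : R * X => (q.1, c.2 q.2))}.
    have k2 : {for (s, p), continuous (c.2 \o (snd : R * X -> X))}.
      apply: continuous_comp; first exact: cvg_snd.
      exact: chart_continuous Ac (Dc _ Dp).
    have k1 : {for (s, p), continuous (fst : R * X -> R)} by exact: cvg_fst.
    move=> W [[W1 W2] /= [w1 w2] WW].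
    have n1 : \forall q \near (s, p), W1 q.1 := k1 W1 w1.
    have n2 : \forall q \near (s, p), W2 (c.2 q.2) := k2 W2 w2.
    have : nbhs (s, p) ((fun q : R * X => (q.1, c.2 q.2)) @^-1` W).
      by near=> q; apply: WW; split; near: q.
    by [].
  exact: continuous_comp ck (cg _).
- move=> p [Dp _]; rewrite /h (_ : lin 0 _ = c.2 p) ?vu//.
  by rewrite [RHS]surjective_pairing /lin; congr pair; ring.
- move=> p [Dp _]; rewrite /h (_ : lin 1 _ = c.2 o) ?vu//.
  by rewrite [RHS]surjective_pairing /lin; congr pair; ring.
- move=> s p s01 Np; have [Dh e] := hP _ _ s01 Np; split => //=.
  by rewrite e; apply: linr => //; have [] := Np.
- move=> s p s01 Np Bp; have [Dh e] := hP _ _ s01 Np.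
  exists c => //; split; first exact: Dc.
  have [[cp [_ /= [Bo|nBp]]] _] := Np; last by case: (nBp Bp).
  by rewrite e /lin /= (boundary_chart Ac cp Bp) (boundary_chart Ac co Bo) !mulr0 addr0.
- by move=> nBo p [[_ [_ /= []]]].
Unshelve. all: by end_near. Qed.

Context (b : nat) (e : 'I_b -> R -> X).
Hypothesis eA : oriented_boundary A e.

Lemma boundary_periodic i s (m : int) : e i (s + m%:~R) = e i s.
Proof. by have [[_ ei] _] := eA; apply/ei; split => //; exists m. Qed.

Lemma boundary_loop_is_path i s : is_path (e i s) (e i s) (boundary_loop e i s).
Proof.
have [[ce _] _] := eA; split; rewrite /boundary_loop ?addr0//.
  have ca : continuous (fun t : R => s + t).
    by move=> t; apply: cvgD; [exact: cvg_cst|exact: cvg_id].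
  have cc : continuous (e i \o (fun t : R => s + t)).
    by move=> t; apply: continuous_comp; [exact: ca|exact: ce].
  exact: continuous_subspaceT cc.
exact: (boundary_periodic i s 1).
Qed.

Definition boundary_arc i s s' : R -> X := fun t => e i (s + t * (s' - s)).

Lemma boundary_arc_is_path i s s' : is_path (e i s) (e i s') (boundary_arc i s s').
Proof.
have [[ce _] _] := eA; split; rewrite /boundary_arc ?mul0r ?addr0//.
  have ca : continuous (fun t : R => s + t * (s' - s)).
    move=> t; apply: cvgD; first exact: cvg_cst.
    by apply: cvgM; [exact: cvg_id|exact: cvg_cst].
  have cc : continuous (e i \o (fun t : R => s + t * (s' - s))).
    by move=> t; apply: continuous_comp; [exact: ca|exact: ce].
  exact: continuous_subspaceT cc.
by rewrite mul1r addrC subrK.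
Qed.

(** Excludes that the boundary comes back close to [e i s] elsewhere than along the short arc
    through it. *)
Lemma boundary_arcs_nbhd i s N : open N -> N (e i s) ->
  exists M, [/\ open M, M (e i s) & forall p, M p -> B p -> exists2 s',
    p = e i s' & forall t, 0 <= t <= 1 -> N (boundary_arc i s s' t)].
Proof.
have [[hX _] _ _ _ _] := sA; have [[ce ei] eB] := eA; move=> oN No.
have /nbhs_ballP[d0 /= d00 dN] := ce i s _ (open_nbhs_nbhs (conj oN No)).
(* The bound 1/2 keeps the complementary arc from [s + d] to [s + 1 - d] nonempty; its last
   parameter represents the end point [s - d] as well. *)
pose d := Num.min d0 2^-1; have d_gt0 : 0 < d by rewrite lt_min d00; lra.
have dd0 : d <= d0 by rewrite ge_min lexx.
have d2 : d <= 2^-1 by rewrite ge_min lexx orbT.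
(* All of the boundary but a short open arc around [e i s]: a finite union of compact sets, hence
   closed in a Hausdorff space. *)
pose C := (\bigcup_(k in [set k | k != i]) (e k @` `[0, 1]%classic)) `|`
          e i @` `[s + d, s + 1 - d]%classic.
have ck k (a a' : R) : closed (e k @` `[a, a']%classic).
  apply: compact_closed => //; apply: continuous_compact (@segment_compact _ _ _).
  by apply: continuous_subspaceT; exact: ce.
have cC : closed C.
  apply: closedU; last exact: ck.
  by apply: closed_bigcup => [|k _]; [exact: finite_finset|exact: ck].
have nC : ~ C (e i s).
  move=> [[k /= ki [t _ /ei[ik _]]]|[t /=]]; first by rewrite ik eqxx in ki.
  rewrite in_itv /= => td /ei[_ [m tm]].
  have m0 : (0 < m)%R by rewrite -(@ltr_int R); lra.
  have m1 : (m < 1)%R by rewrite -(@ltr_int R); lra.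
  by have := lt_le_trans m1 (_ : 1 <= m); rewrite ltxx => /(_ m0).
exists (~` C); split => //; first exact: closed_openC.
move=> p nCp; rewrite -eB => -[k _ [t _ tp]].
have [ki|ki] := eqVneq k i; last first.
  exfalso; apply: nCp; left; exists k => //; exists (t - (Num.floor t)%:~R).
    by rewrite /= in_itv /=; have := floor_itv t; rewrite intrD; lra.
  by rewrite -mulrNz boundary_periodic.
(* Translation by [m] brings the parameter into [s - d, s + 1 - d); avoiding [C] then leaves only
   the open arc from [s - d] to [s + d]. *)
subst k; pose m := Num.floor (t - s + d); exists (t - m%:~R).
  by rewrite -mulrNz boundary_periodic.
have := floor_itv (t - s + d); rewrite intrD -/m => /andP[m1 m2].
have pE a : `|a - (t - m%:~R)| = 0 -> p = e i a.
  move/normr0_eq0/eqP; rewrite subr_eq0 => /eqP ->.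
  by rewrite -mulrNz boundary_periodic.
have u1 : t - m%:~R < s + d.
  rewrite ltNge; apply/negP => h; apply: nCp; right.
  exists (t - m%:~R); last by rewrite -mulrNz boundary_periodic.
  by rewrite /= in_itv /=; lra.
have u2 : s - d < t - m%:~R.
  rewrite ltNge; apply/negP => h; apply: nCp; right.
  have um : t - m%:~R = s - d by lra.
  exists (s + 1 - d); first by rewrite /= in_itv /=; lra.
  rewrite -tp -[in RHS](boundary_periodic i t (- m + 1)).
  by congr e; rewrite intrD mulrNz; lra.
move=> u u01; apply: dN; rewrite /ball /= ltr_norml; nra.
Qed.

End SurfaceTopology.

Section BoundaryFlat.
Context {R : realType} {X : topologicalType} (A : set (@chart R X)).
Context (b : nat) (e : 'I_b -> R -> X) {G : groupType}.
Hypotheses (sA : oriented_surface A) (eA : oriented_boundary A e).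

(** Inside a contractible [N], a path with ends on the boundary has the same value as the boundary
    arc with the same ends, even if it leaves the boundary in between. *)
Lemma boundary_flat (phi : (R -> X) -> G) (t : X -> G) : path_functor phi ->
  (forall i s s', t (e i s) * phi (boundary_arc e i s s') =
                  phi (boundary_arc e i s s') * t (e i s'))%g ->
  forall o, boundary A o -> exists M, [/\ open M, M o &
    forall p f, is_path o p f -> (forall s : R, 0 <= s <= 1 -> M (f s)) ->
      boundary A p -> (t o * phi f = phi f * t p)%g].
Proof.
move=> pf tarc o; have [_ eB] := eA; rewrite -{1}eB => -[i _ [s _ <-{o}]].
have [N [h [cn _]]] := surface_locally_contractible sA openT (Logic.I : setT (e i s)).
have [M [oM Ms Marc]] := boundary_arcs_nbhd sA eA (cn_open cn) (cn_center cn).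
exists (M `&` N); split; [exact: openI (cn_open cn)|by split => //; exact: cn_center cn|].
move=> p f fp fM Bp; have [_ _ f1] := fp.
have [Mp _] : (M `&` N) p by rewrite -f1; apply: fM; rewrite lexx ler01.
have [s' ps' arcN] := Marc _ Mp Bp.
have ap := boundary_arc_is_path eA i s s'; rewrite -ps' in ap.
have -> : phi f = phi (boundary_arc e i s s').
  rewrite (path_functor_contractible pf cn fp (fun t t01 => (fM t t01).2)).
  by rewrite (path_functor_contractible pf cn ap arcN).
by rewrite tarc ps'.
Qed.

End BoundaryFlat.

(** * Limits of matrices and the topology of PGL *)

Section MatrixTopology.
Context {R : realType} {T : Type} {F : set_system T} {FF : Filter F}.

Lemma cvg_mx {m n} (f : T -> 'M[R]_(m, n)) (M : 'M[R]_(m, n)) :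
  (forall i j, f x i j @[x --> F] --> M i j) -> f @ F --> M.
Proof.
move=> h W [P MP PW]; rewrite nbhs_simpl /=.
have : \forall x \near F, forall i j, P i j (f x i j).
  apply: filter_forall => i; apply: filter_forall => k; exact: h (MP i k).
by apply: filterS => x fP; apply: PW.
Qed.

Lemma cvg_mx_coord {m n} (f : T -> 'M[R]_(m, n)) (M : 'M[R]_(m, n)) i j :
  f @ F --> M -> f x i j @[x --> F] --> M i j.
Proof.
move=> fM; apply: (@cvg_comp _ _ _ f (fun N : 'M[R]_(m, n) => N i j) _ _ _ fM).
exact: coord_continuous.
Qed.

Lemma cvg_prod_fin {I : Type} (r : seq I) (P : pred I) (f : I -> T -> R)
    (a : I -> R) : (forall i, f i @ F --> a i) ->
  \prod_(i <- r | P i) f i x @[x --> F] --> \prod_(i <- r | P i) a i.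
Proof.
move=> fM; elim: r => [|i r IHr].
  by rewrite big_nil; under eq_fun do rewrite big_nil; exact: cvg_cst.
rewrite big_cons; under eq_fun do rewrite big_cons.
by case: (P i) => //; exact: cvgM.
Qed.

Lemma cvg_sum_fin {I : Type} (r : seq I) (P : pred I) (f : I -> T -> R)
    (a : I -> R) : (forall i, f i @ F --> a i) ->
  \sum_(i <- r | P i) f i x @[x --> F] --> \sum_(i <- r | P i) a i.
Proof.
move=> fM; elim: r => [|i r IHr].
  by rewrite big_nil; under eq_fun do rewrite big_nil; exact: cvg_cst.
rewrite big_cons; under eq_fun do rewrite big_cons.
by case: (P i) => //; exact: cvgD.
Qed.

Lemma cvg_mulmx {m n p} (f : T -> 'M[R]_(m, n)) (g : T -> 'M[R]_(n, p))
    (M : 'M[R]_(m, n)) (N : 'M[R]_(n, p)) :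
  f @ F --> M -> g @ F --> N -> (f x *m g x) @[x --> F] --> M *m N.
Proof.
move=> fM gN; apply: cvg_mx => i j; rewrite mxE.
under eq_fun do rewrite mxE.
by apply: cvg_sum_fin => k; apply: cvgM; exact: cvg_mx_coord.
Qed.

Lemma cvg_bigmulmx {n} {I : Type} (r : seq I) (P : pred I)
    (f : I -> T -> 'M[R]_n) (M : I -> 'M[R]_n) :
  (forall i, f i @ F --> M i) ->
  \big[mulmx/1%:M]_(i <- r | P i) f i x @[x --> F] -->
  \big[mulmx/1%:M]_(i <- r | P i) M i.
Proof.
move=> fM; elim: r => [|i r IHr].
  by rewrite big_nil; under eq_fun do rewrite big_nil; exact: cvg_cst.
rewrite big_cons; under eq_fun do rewrite big_cons.
by case: (P i) => //; exact: cvg_mulmx.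
Qed.

Lemma cvg_det {n} (f : T -> 'M[R]_n) (M : 'M[R]_n) :
  f @ F --> M -> \det (f x) @[x --> F] --> \det M.
Proof.
move=> fM; rewrite /determinant; apply: cvg_sum_fin => s.
apply: cvgM; first exact: cvg_cst.
by apply: cvg_prod_fin => i; exact: cvg_mx_coord.
Qed.

End MatrixTopology.

Section PGLTopology.
Context {R : realType} {n : nat}.
Implicit Types (A B : 'M[R]_n) (g h : PGL R n).

Lemma PGL_classM A B : A \in unitmx -> B \in unitmx ->
  (PGL_class A * PGL_class B)%g = PGL_class (A *m B).
Proof. by move=> uA uB; exact: PGL_mulE. Qed.

Lemma PGL_classV A : A \in unitmx -> (PGL_class A)^-1%g = PGL_class (invmx A).
Proof.
move=> uA; apply: (mulgI (PGL_class A)); rewrite mulgV PGL_classM ?unitmx_inv//.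
by rewrite mulmxV.
Qed.

Lemma unitmx_nbhs A : A \in unitmx -> \forall B \near A, B \in unitmx.
Proof.
rewrite unitmxE unitfE => dA.
have cd : \det B @[B --> A] --> \det A by apply: (@cvg_det R _ (nbhs A) _ n id A); exact: cvg_id.
have oR : open [set r : R | r != 0] by exact: open_neq.
have := cd _ (open_nbhs_nbhs (conj oR dA)); rewrite nbhs_simpl /=.
by apply: filterS => B; rewrite unitmxE unitfE.
Qed.

Lemma PGL_class_nbhs A (W : set (PGL R n)) : A \in unitmx ->
  nbhs (PGL_class A) W -> \forall B \near A, W (PGL_class B).
Proof.
move=> uA; rewrite nbhsE => -[V [oV VA] VW].
have : open (\pi_(PGL R n) @^-1` V : set (@Defs.GL R n)) by [].
move=> [Q oQ QV].
have vE B : B \in unitmx -> val (insubd (GL_one R n) B) = B.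
  by move=> uB; rewrite insubdK// inE.
have QA : Q A.
  rewrite -(vE _ uA); have : (\pi_(PGL R n) @^-1` V) (insubd (GL_one R n) A) by [].
  by rewrite -QV.
have n1 : \forall B \near A, Q B by exact: open_nbhs_nbhs.
have n2 := unitmx_nbhs uA.
near=> B; apply: VW.
have QB : Q B by near: B.
have uB : B \in unitmx by near: B.
have : (set_val @^-1` Q) (insubd (GL_one R n) B).
  by rewrite /preimage /= [X in Q X](vE _ uB).
by rewrite QV.
Unshelve. all: by end_near. Qed.

(** The saturation of an open set is the union of its rescalings, hence open. This is what lifts
    classes near [PGL_class A] to matrices near [A]. *)
Lemma PGL_class_open A (W : set 'M[R]_n) : A \in unitmx -> nbhs A W ->
  nbhs (PGL_class A) [set PGL_class B | B in [set B | W B /\ B \in unitmx]].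
Proof.
move=> uA; rewrite nbhsE => -[Q [oQ QA] QW].
pose V := [set PGL_class B | B in [set B | Q B /\ B \in unitmx]].
apply: (@filterS _ _ _ V); first by move=> _ [B [QB uB] <-]; exists B => //; split => //; exact: QW.
apply: open_nbhs_nbhs; split; last by exists A.
suff : open (\pi_(PGL R n) @^-1` V : set (@Defs.GL R n)) by [].
have -> : \pi_(PGL R n) @^-1` V =
    \bigcup_(c in [set c : R | c != 0]) (set_val @^-1` [set B | Q (c *: B)]) :> set (@Defs.GL R n).
  apply/seteqP; split => [B|B [c c0 QcB]].
    move=> [C [QC uC] CB]; have := CB.
    rewrite -[\pi_(_) B](_ : PGL_class (val B) = _); last by rewrite /PGL_class valKd.
    move=> /(PGL_class_eq uC (GLP B))[c c0 CE]; exists c => //=.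
    by rewrite -[set_val B]/(val B) -CE.
  exists (c *: val B).
    by split => //; rewrite unitmxZ ?unitfE// GLP.
  rewrite /= -[RHS](_ : PGL_class (val B) = _); last by rewrite /PGL_class valKd.
  by apply/PGL_class_eq; rewrite ?unitmxZ ?unitfE ?GLP//; exists c.
apply: bigcup_open => c c0; exists [set B | Q (c *: B)] => //.
have : continuous (fun B : 'M[R]_n => c *: B) by exact: scaler_continuous.
by move=> /continuousP; apply.
Qed.

Lemma cvg_PGL_mul {T : Type} {F : set_system T} {FF : Filter F}
    (f k : T -> PGL R n) g h : f @ F --> g -> k @ F --> h ->
  (f x * k x)%g @[x --> F] --> (g * h)%g.
Proof.
rewrite -(PGL_liftK g) -(PGL_liftK h).
move: (PGL_lift g) (PGL_liftP g) (PGL_lift h) (PGL_liftP h) => A uA B uB fA kB W.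
rewrite PGL_classM// => /(PGL_class_nbhs _); rewrite unitmx_mul uA uB => /(_ isT).
have cm : (M.1 *m M.2) @[M --> (nbhs A, nbhs B)] --> A *m B.
  by apply: cvg_mulmx; [exact: cvg_fst|exact: cvg_snd].
move=> /cm; rewrite nbhs_simpl /= => -[[U V] /= [UA VB] UV].
have n1 := fA _ (PGL_class_open uA UA); have n2 := kB _ (PGL_class_open uB VB).
rewrite !nbhs_simpl /= in n1 n2 *.
apply: filterS (filterI n1 n2) => x /= [].
move=> [A' [UA' uA'] fx] [B' [VB' uB'] kx].
by rewrite -fx -kx PGL_classM//; apply: (UV (A', B')).
Qed.

Lemma PSL_conj g h : PSL g -> PSL (h * g * h^-1)%g.
Proof.
move=> [A dA <-]; rewrite -(PGL_liftK h); have uL := PGL_liftP h.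
move: (PGL_lift h) uL => L uL; have uA := det1_unitmx dA.
rewrite PGL_classV// !PGL_classM ?unitmx_mul ?unitmx_inv ?uL//.
exists (L *m A *m invmx L) => //=.
by rewrite !det_mulmx dA mulr1 -det_mulmx mulmxV// det1.
Qed.

Lemma PSL_commutator g h : PSL (g * h * g^-1 * h^-1)%g.
Proof.
rewrite -(PGL_liftK g) -(PGL_liftK h).
move: (PGL_lift g) (PGL_liftP g) (PGL_lift h) (PGL_liftP h) => A uA B uB.
rewrite !PGL_classV// !PGL_classM ?unitmx_mul ?unitmx_inv ?uA ?uB//.
exists (A *m B *m invmx A *m invmx B) => //=.
rewrite !det_mulmx !det_inv mulrAC mulfK -?unitfE -?unitmxE// mulfV//.
by rewrite -unitfE -unitmxE.
Qed.

End PGLTopology.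

(** [i <= f i] by induction, and the opposite inequality is the same one for [f] conjugated by
    [rev_ord]. *)
Lemma increasing_ord_id n (f : 'I_n -> 'I_n) :
  (forall i j : 'I_n, (i < j)%N -> (f i < f j)%N) -> forall i, f i = i.
Proof.
have le (g : 'I_n -> 'I_n) : (forall i j : 'I_n, (i < j)%N -> (g i < g j)%N) ->
    forall i : 'I_n, (i <= g i)%N.
  move=> gi [k kn]; elim: k kn => // k IHk kn.
  have kn' : (k < n)%N by exact: ltnW.
  apply: leq_ltn_trans (IHk kn') _; exact: gi.
move=> fi i; apply/val_inj/eqP; rewrite eqn_leq; apply/andP; split; last exact: le.
have := le (fun i => rev_ord (f (rev_ord i))) _ (rev_ord i).
rewrite rev_ordK /= => /(_ _).
have h (a c : 'I_n) : (a < c)%N -> (rev_ord (f (rev_ord a)) < rev_ord (f (rev_ord c)))%N.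
  move=> ac; have : (f (rev_ord c) < f (rev_ord a))%N.
    by apply: fi => /=; have := ltn_ord c; lia.
  by have := ltn_ord (f (rev_ord a)); rewrite /=; lia.
by move=> /(_ h); have := ltn_ord (f i); have := ltn_ord i; lia.
Qed.

(** * Matrices with simple real spectrum *)

Section Spectrum.
Context {F : fieldType}.

Lemma char_poly_sim {n} (A D K : 'M[F]_n) : K \in unitmx ->
  A *m K = K *m D -> char_poly A = char_poly D.
Proof.
move=> uK AK; pose KP := map_mx polyC K.
have dK : \det KP != 0.
  by rewrite det_map_mx polyC_eq0 -unitfE -unitmxE.
apply: (mulIf dK); rewrite /char_poly -det_mulmx [RHS]mulrC -det_mulmx.
congr (\det _); rewrite /char_poly_mx mulmxBl mulmxBr -!map_mxM AK.
by rewrite scalar_mxC.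
Qed.

Lemma char_poly_diag {n} (d : 'rV[F]_n) :
  char_poly (diag_mx d) = \prod_i ('X - (d 0 i)%:P).
Proof.
rewrite char_poly_trig ?diag_mx_is_trig//.
by apply: eq_bigr => i _; rewrite mxE eqxx mulr1n.
Qed.

Lemma char_poly_horner {n} (A : 'M[F]_n) x :
  (char_poly A).[x] = \det (x%:M - A).
Proof.
rewrite -horner_evalE /char_poly -det_map_mx; congr (\det _).
apply/matrixP => i j; rewrite !mxE /= horner_evalE hornerD hornerN hornerC.
by rewrite hornerMn hornerX.
Qed.

Lemma diag_mx_intertwined {n} (M : 'M[F]_n) (d d' : 'rV[F]_n) :
  M *m diag_mx d = diag_mx d' *m M ->
  forall i j, M i j != 0 -> d 0 j = d' 0 i.
Proof.
move=> Md i j Mij; have := congr1 (fun N : 'M[F]_n => N i j) Md.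
by rewrite mul_mx_diag mul_diag_mx !mxE mulrC => /(mulIf Mij).
Qed.

Lemma unitmx_row_neq0 {n} (M : 'M[F]_n) i : M \in unitmx -> exists j, M i j != 0.
Proof.
move=> uM; apply/existsP; apply: contraT; rewrite negb_exists => /forallP M0.
have : (M *m invmx M) i i = 0.
  rewrite mxE big1 // => j _; have := M0 j; rewrite negbK => /eqP ->.
  by rewrite mul0r.
by rewrite mulmxV// mxE eqxx => /eqP; rewrite oner_eq0.
Qed.

Lemma diag_mx_offdiag {n} (M : 'M[F]_n) : (forall i j, i != j -> M i j = 0) ->
  M = diag_mx (\row_i M i i).
Proof.
move=> M0; apply/matrixP => i j; rewrite !mxE.
by have [->|ij] := eqVneq i j; [rewrite mulr1n|rewrite mulr0n M0].
Qed.

Lemma unitmx_diag {n} (d : 'rV[F]_n) :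
  (diag_mx d \in unitmx) = [forall i, d 0 i != 0].
Proof.
rewrite unitmxE det_diag unitfE.
by apply/prodf_neq0/forallP => h i => [|_]; exact: h.
Qed.

Lemma lagrange_diag {n} (A K : 'M[F]_n) (d : 'rV[F]_n) (c : 'I_n -> F)
    (P : pred 'I_n) (r : seq 'I_n) : A *m K = K *m diag_mx d ->
  (\big[mulmx/1%:M]_(k <- r | P k) (A - (c k)%:M)) *m K =
  K *m diag_mx (\row_i \prod_(k <- r | P k) (d 0 i - c k)).
Proof.
move=> AK; elim: r => [|k r IHr].
  rewrite big_nil mul1mx -[LHS]mulmx1; congr (_ *m _).
  by apply/matrixP => i j; rewrite !mxE big_nil.
rewrite big_cons; case Pk: (P k); last first.
  rewrite IHr; congr (_ *m diag_mx _); apply/rowP => i; rewrite !mxE.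
  by rewrite big_cons Pk.
rewrite -mulmxA IHr mulmxA mulmxBl AK -scalar_mxC -mulmxBr -mulmxA.
congr (_ *m _); apply/matrixP => i j; rewrite mulmxBl mul_scalar_mx.
rewrite mul_diag_mx !mxE big_cons Pk mulrBl; case: eqP => [->|_].
  by rewrite !mulr1n.
by rewrite !mulr0n !mulr0 subrr.
Qed.

End Spectrum.

Section SimpleSpectrum.
Context {R : realType} {n : nat}.
Implicit Types (A K : 'M[R]_n) (d : 'rV[R]_n).

Definition decreasing_row d : Prop :=
  forall i j : 'I_n, (i < j)%N -> d 0 j < d 0 i.

Definition simple_spectrum A : Prop :=
  exists2 s : seq R, uniq s & char_poly A = \prod_(a <- s) ('X - a%:P).

Lemma decreasing_row_inj d : decreasing_row d -> injective (fun i => d 0 i).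
Proof.
move=> dd i j e; apply/val_inj/eqP; case: ltngtP => // /dd;
  by rewrite e ltxx.
Qed.

Lemma decreasing_row_lt d i j : decreasing_row d ->
  d 0 j < d 0 i -> (i < j)%N.
Proof.
move=> dd; case: (ltngtP i j) => // [/dd /ltW ?|/val_inj ->]; last by rewrite ltxx.
by rewrite ltNge => /negP.
Qed.

(** Inclusion one way suffices: the index map is strictly increasing on ['I_n], hence the
    identity. *)
Lemma decreasing_row_eq d d' : decreasing_row d -> decreasing_row d' ->
  (forall i, exists k, d' 0 i = d 0 k) -> d = d'.
Proof.
move=> dd dd' /choice[f df]; apply/rowP => i; rewrite df.
rewrite (@increasing_ord_id n f)// => {}i j ij.
by apply: (decreasing_row_lt dd); rewrite -!df; exact: dd'.
Qed.

Lemma char_poly_diagonalized A K d : K \in unitmx -> A *m K = K *m diag_mx d ->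
  char_poly A = \prod_i ('X - (d 0 i)%:P).
Proof. by move=> uK AK; rewrite (char_poly_sim uK AK) char_poly_diag. Qed.

Lemma root_prod_row d x :
  root (\prod_i ('X - (d 0 i)%:P)) x <-> exists i, x = d 0 i.
Proof.
rewrite rootE horner_prod; split=> [/prodf_eq0[i _]|[i ->]].
  by rewrite hornerXsubC subr_eq0 => /eqP ->; exists i.
by apply/prodf_eq0; exists i; rewrite // hornerXsubC subrr.
Qed.

Lemma simple_spectrum_diagonalized A K d : K \in unitmx ->
  A *m K = K *m diag_mx d -> injective (fun i => d 0 i) -> simple_spectrum A.
Proof.
move=> uK AK di; exists [seq d 0 i | i <- enum 'I_n].
  by rewrite map_inj_uniq ?enum_uniq.
by rewrite (char_poly_diagonalized uK AK) big_map big_enum.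
Qed.

End SimpleSpectrum.

Lemma simple_spectrumP {R : realType} {n} (A : 'M[R]_n) : simple_spectrum A ->
  exists K d, [/\ K \in unitmx, decreasing_row d & A *m K = K *m diag_mx d].
Proof.
case: n A => [|n] A sA.
  by exists 1%:M, 0; split; [exact: unitmx1|case|rewrite !flatmx0].
have [s us cA] := sA.
have : diagonalizable A.
  by apply/diagonalizableP; exists s => //; rewrite -cA; exact: mxminpoly_dvd_char.
move=> [P uP /diagonalizable_forPex[d /(simmxP uP) PA]].
have AK : A *m invmx P = invmx P *m diag_mx d.
  by apply: (canLR (mulmxK uP)); rewrite -mulmxA -PA mulKmx.
have uK : invmx P \in unitmx by rewrite unitmx_inv.
move: (invmx P) uK AK => K uK AK {P uP PA}.
have cd := char_poly_diagonalized uK AK.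
have ud : uniq [tuple d 0 i | i < n.+1].
  have e : \prod_(a <- [tuple d 0 i | i < n.+1]) ('X - a%:P) =
      \prod_(a <- s) ('X - a%:P).
    by rewrite -cA cd big_tuple; apply: eq_bigr => i _; rewrite tnth_mktuple.
  by rewrite (perm_uniq (_ : perm_eq _ s))//; apply: prod_XsubC_eq.
(* Negated so that the increasing sort lists the eigenvalues in decreasing order. *)
pose t := [tuple - d 0 i | i < n.+1].
have ut : uniq t.
  rewrite (_ : val t = [seq - x | x <- [tuple d 0 i | i < n.+1]]).
    by rewrite map_inj_uniq//; exact: oppr_inj.
  by rewrite -[RHS]map_comp.
have : perm_eq (sort <=%O t) t by rewrite perm_sort.
move=> /tuple_permP[p pE].
exists (col_perm p K), (\row_i d 0 (p i)); split.
- by rewrite col_permE unitmx_mul uK unitmx_perm.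
- move=> i j ij; rewrite !mxE.
  have ss : sorted <%O (sort <=%O t) by rewrite sort_lt_sorted.
  have sE (k : 'I_n.+1) : nth 0 (sort <=%O t) k = - d 0 (p k).
    rewrite pE (nth_map ord0) ?size_enum_ord// nth_ord_enum.
    by rewrite !tnth_mktuple.
  rewrite -ltrN2 -!sE; apply: (sorted_ltn_nth lt_trans 0 ss) => //;
    by rewrite inE size_sort size_tuple.
- apply/matrixP => i j; rewrite mul_mx_diag !mxE.
  have := congr1 (fun N : 'M[R]_n.+1 => N i (p j)) AK.
  rewrite mul_mx_diag !mxE => <-.
  by apply: eq_bigr => k _; rewrite !mxE.
Qed.

Section RootContinuity.
Context {R : realType} {n : nat}.
Implicit Types (A : 'M[R]_n) (d : 'rV[R]_n).

Lemma prod_row_horner d x :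
  (\prod_i ('X - (d 0 i)%:P)).[x] = \prod_i (x - d 0 i).
Proof. by rewrite horner_prod; apply: eq_bigr => i _; rewrite hornerXsubC. Qed.

(* The product of the values of the characteristic polynomial at
   [d0 i - e] and [d0 i + e] is negative, and stays negative near [A0]; so one
   of its factors [(d0 i - e - d k) * (d0 i + e - d k)] is negative. *)
Lemma eigenvalues_continuous A0 d0 (e : R) : decreasing_row d0 ->
  char_poly A0 = \prod_i ('X - (d0 0 i)%:P) -> 0 < e ->
  \forall A \near A0, forall d, decreasing_row d ->
    char_poly A = \prod_i ('X - (d 0 i)%:P) -> forall i, `|d 0 i - d0 0 i| < e.
Proof.
move=> dd0 cA0 e0.
(* With [2 * r] below all gaps, the product at [A0] has exactly one negative factor, and intervals
   of radius [r] around the eigenvalues are disjoint, which forces the order-preserving matching [f]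
   below to be the identity. *)
have [r [r0 re rd]] : exists r : R, [/\ 0 < r, r <= e &
    forall i k : 'I_n, i != k -> 2 * r < `|d0 0 i - d0 0 k|].
  have n1 : \forall r \near (0 : R)^'+, forall i k : 'I_n, i != k ->
      2 * r < `|d0 0 i - d0 0 k|.
    apply: filter_forall => i; apply: filter_forall => k.
    have [->|ik] := eqVneq i k; first by near=> r.
    have dik : 0 < `|d0 0 i - d0 0 k| / 2.
      rewrite divr_gt0// normr_gt0 subr_eq0; apply: contra ik => /eqP h.
      exact/eqP/(decreasing_row_inj dd0).
    have : \forall r \near (0 : R)^'+, r < `|d0 0 i - d0 0 k| / 2.
      exact: nbhs_right_lt.
    by apply: filterS => r ? _; lra.
  have n2 : \forall r \near (0 : R)^'+, r < e by exact: nbhs_right_lt.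
  have n3 : \forall r \near (0 : R)^'+, 0 < r by exact: nbhs_right_gt.
  have [r [h1 [h2 h3]]] := filter_ex (filterI n1 (filterI n2 n3)).
  by exists r; split => //; exact: ltW.
pose P A i := \det ((d0 0 i - r)%:M - A) * \det ((d0 0 i + r)%:M - A).
have cD x : \det (x%:M - A) @[A --> A0] --> \det (x%:M - A0).
  apply: (@cvg_det R _ (nbhs A0) _ n (fun A => x%:M - A)).
  by apply: cvgB; [exact: cvg_cst|exact: cvg_id].
have cP i : P A i @[A --> A0] --> P A0 i by exact: (cvgM (cD (d0 0 i - r)) (cD (d0 0 i + r))).
have P0 i : P A0 i < 0.
  rewrite /P -!char_poly_horner cA0 !prod_row_horner -big_split /=.
  rewrite (bigD1 i)//= nmulr_rlt0; last by nra.
  apply: prodr_gt0 => k ki; have := rd i k; rewrite eq_sym => /(_ ki) rik.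
  have : (2 * r) ^+ 2 < `|d0 0 i - d0 0 k| ^+ 2 by rewrite ltr_pXn2r ?nnegrE//; lra.
  by rewrite real_normK ?num_real//; nra.
have nP : \forall A \near A0, forall i, P A i < 0.
  apply: (@filter_forall _ _ (fun i A => P A i < 0) _ (nbhs_filter A0)) => i.
  have oN : open [set x : R | x < 0] by exact: open_lt.
  exact: cP i _ (open_nbhs_nbhs (conj oN (P0 i))).
apply: (@filterS _ _ (nbhs_filter A0) _ _ _ nP) => A PA d dd cA.
have : forall i, exists k, (d0 0 i - r - d 0 k) * (d0 0 i + r - d 0 k) < 0.
  move=> i; have := PA i.
  rewrite /P -!char_poly_horner cA !prod_row_horner -big_split /=.
  move=> neg; apply/existsP; apply: contraLR neg; rewrite negb_exists => /forallP h.
  by rewrite -leNgt; apply: prodr_ge0 => k _; have := h k; rewrite -leNgt.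
move=> /choice[f fP].
have fr i : `|d 0 (f i) - d0 0 i| < r.
  by rewrite ltr_norml; have := fP i; nra.
have fi : forall i, f i = i.
  apply: increasing_ord_id => i j ij; apply: (decreasing_row_lt dd).
  have ineqj : i != j by rewrite -val_eqE /= ltn_eqF.
  have := rd _ _ ineqj; have := fr i; have := fr j.
  by rewrite (gtr0_norm (_ : 0 < d0 0 i - d0 0 j)) ?subr_gt0 ?dd0// !ltr_norml; lra.
by move=> i; apply: lt_le_trans re; rewrite -{1}(fi i).
Unshelve. all: by end_near. Qed.

End RootContinuity.

(** * Positively loxodromic classes and the involution attached to them *)

Section PositiveLoxodromic.
Context {R : realType} {n : nat}.
Implicit Types (A M : 'M[R]_n) (d : 'rV[R]_n) (g h : PGL R n).

Definition positively_loxodromic g : Prop :=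
  exists K Delta, decreasing_diagonal Delta /\ g = (K * Delta * K^-1)%g.

(** The scalar [c] is the price of equality in PGL. Nonzero entries of [M] match the two spectra, so
    positivity gives [c > 0] and monotonicity gives [d = c *: d']; then [M] commutes with a diagonal
    matrix with distinct entries. *)
Lemma intertwiner_diag M c d d' : M \in unitmx ->
  (forall i, 0 < d 0 i) -> (forall i, 0 < d' 0 i) ->
  decreasing_row d -> decreasing_row d' ->
  M *m diag_mx d = c *: (diag_mx d' *m M) -> M = diag_mx (\row_i M i i).
Proof.
move=> uM p p' dd dd' e.
have cd : c *: (diag_mx d' *m M) = diag_mx (c *: d') *m M.
  by rewrite linearZ /= -scalemxAl.
have {}e : M *m diag_mx d = diag_mx (c *: d') *m M by rewrite e cd.
have dcd i : exists k, (c *: d') 0 i = d 0 k.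
  have [k Mik] := unitmx_row_neq0 i uM.
  by exists k; rewrite (diag_mx_intertwined e Mik).
have dE : d = c *: d'.
  apply: decreasing_row_eq => // i j ij; rewrite !mxE.
  have [k] := dcd i; rewrite mxE => dk.
  have c0 : 0 < c by rewrite -(pmulr_lgt0 _ (p' i)) dk.
  by rewrite ltr_pM2l//; exact: dd'.
apply: diag_mx_offdiag => i j; apply: contraNeq => Mij.
apply/eqP/(decreasing_row_inj dd).
by rewrite (diag_mx_intertwined e Mij) -dE.
Qed.

Lemma diag_commuting (J : PGL R n) :
  (forall d, (forall i, d 0 i != 0) ->
    (J * PGL_class (diag_mx d) = PGL_class (diag_mx d) * J)%g) ->
  exists2 m : 'rV[R]_n, forall i, m 0 i != 0 & J = PGL_class (diag_mx m).
Proof.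
move=> Jd; pose d : 'rV[R]_n := \row_i (n - i)%:R.
have p i : 0 < d 0 i by rewrite mxE ltr0n subn_gt0.
have dd : decreasing_row d.
  by move=> i j ij; rewrite !mxE ltr_nat; have := ltn_ord j; lia.
have ud : diag_mx d \in unitmx by rewrite unitmx_diag; apply/forallP => i; rewrite gt_eqF.
have uM := PGL_liftP J.
have := Jd d (fun i => lt0r_neq0 (p i)); rewrite -(PGL_liftK J) !PGL_classM//.
move=> /(PGL_class_eq _ _)[]; rewrite ?unitmx_mul ?uM ?ud// => c _ e.
have ME := intertwiner_diag uM p p dd dd e.
exists (\row_i PGL_lift J i i); last by rewrite -ME.
by apply/forallP; rewrite -unitmx_diag -ME.
Qed.

Context (J : PGL R n).
Hypothesis Jd : forall d, (forall i, d 0 i != 0) ->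
  (J * PGL_class (diag_mx d) = PGL_class (diag_mx d) * J)%g.

Lemma decreasing_diagonal_conj (K K' D D' : PGL R n) :
  decreasing_diagonal D -> decreasing_diagonal D' ->
  (K * D * K^-1 = K' * D' * K'^-1)%g -> (K * J * K^-1 = K' * J * K'^-1)%g.
Proof.
move=> [d [p dd ->]] [d' [p' dd' ->]] e; pose L := (K'^-1 * K)%g.
have KE : K = (K' * L)%g by rewrite /L mulVKg.
have Le : (L * PGL_class (diag_mx d) = PGL_class (diag_mx d') * L)%g.
  by rewrite /L -mulgA -[(K * _)%g](mulgVK K) e !mulgA mulVg mul1g.
suff JL : (L * J * L^-1 = J)%g.
  by rewrite KE -{2}JL invgM !mulgA.
have uM := PGL_liftP L.
have u (x : 'rV[R]_n) : (forall i, 0 < x 0 i) -> diag_mx x \in unitmx.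
  by move=> x0; rewrite unitmx_diag; apply/forallP => i; rewrite gt_eqF.
have : PGL_class (PGL_lift L *m diag_mx d) = PGL_class (diag_mx d' *m PGL_lift L).
  by rewrite -!PGL_classM ?u// PGL_liftK.
move=> /(PGL_class_eq _ _)[]; first by rewrite unitmx_mul uM u.
  by rewrite unitmx_mul uM u.
move=> c _ /(intertwiner_diag uM p p' dd dd') ME.
rewrite -(PGL_liftK L) ME -Jd ?mulgK// => i.
by move: i; apply/forallP; rewrite -unitmx_diag -ME.
Qed.

Definition conj_involution g : PGL R n :=
  let K := xget 1%g [set K | exists2 Delta, decreasing_diagonal Delta &
             g = (K * Delta * K^-1)%g] in
  (K * J * K^-1)%g.

Lemma conj_involutionE (K D : PGL R n) : decreasing_diagonal D ->
  conj_involution (K * D * K^-1)%g = (K * J * K^-1)%g.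
Proof.
move=> dD; rewrite /conj_involution; case: xgetP => [K' _ [D' dD' e]|/(_ K)].
  exact/esym/(decreasing_diagonal_conj dD dD').
by case; exists D.
Qed.

Lemma conj_involution_conj h g : positively_loxodromic g ->
  conj_involution (h * g * h^-1)%g = (h * conj_involution g * h^-1)%g.
Proof.
move=> [K [D [dD ->]]].
have -> : (h * (K * D * K^-1) * h^-1 = (h * K) * D * (h * K)^-1)%g.
  by rewrite invgM !mulgA.
by rewrite !conj_involutionE// invgM !mulgA.
Qed.

Lemma conj_involution_ex g : exists K, conj_involution g = (K * J * K^-1)%g.
Proof. by rewrite /conj_involution; eexists. Qed.

Lemma positively_loxodromic_conj h g :
  positively_loxodromic g -> positively_loxodromic (h * g * h^-1)%g.
Proof.
move=> [K [D [dD ->]]]; exists (h * K)%g, D; split => //.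
by rewrite invgM !mulgA.
Qed.

End PositiveLoxodromic.

Section LoxodromicLifts.
Context {R : realType} {n : nat}.
Implicit Types (A K : 'M[R]_n) (d : 'rV[R]_n) (g : PGL R n).

Lemma simple_spectrum_scale (c : R) A : c != 0 ->
  simple_spectrum A -> simple_spectrum (c *: A).
Proof.
move=> c0 /simple_spectrumP[K [d [uK dd AK]]].
apply: (simple_spectrum_diagonalized (d := c *: d) uK).
  by rewrite -scalemxAl AK linearZ /= scalemxAr.
by move=> i j; rewrite !mxE => /(mulfI c0) /(decreasing_row_inj dd).
Qed.

Lemma purely_loxodromic_lift A : A \in unitmx ->
  purely_loxodromic (PGL_class A) -> simple_spectrum A.
Proof.
move=> uA [C [dC AC sC]]; have uC := det1_unitmx dC.
have [c c0 ->] := (PGL_class_eq uA uC).1 AC.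
exact: simple_spectrum_scale.
Qed.

Lemma diagonalized_class A K d : A \in unitmx -> K \in unitmx ->
  A *m K = K *m diag_mx d ->
  diag_mx d \in unitmx /\ PGL_class A =
    (PGL_class K * PGL_class (diag_mx d) * (PGL_class K)^-1)%g.
Proof.
move=> uA uK AK; have ud : diag_mx d \in unitmx.
  by rewrite -[diag_mx d](mulKmx uK) -AK !unitmx_mul unitmx_inv uA uK.
split=> //; rewrite PGL_classV// !PGL_classM ?unitmx_mul ?unitmx_inv ?uK ?ud//.
by rewrite -AK mulmxK.
Qed.

Lemma positively_loxodromic_lift A : A \in unitmx ->
  positively_loxodromic (PGL_class A) -> exists K d c,
  [/\ K \in unitmx, decreasing_row d, forall i, 0 < d 0 i, c != 0 &
      A *m K = K *m diag_mx (c *: d)].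
Proof.
move=> uA [k [_ [[d [p dd ->]]]]]; rewrite -(PGL_liftK k).
move: (PGL_lift k) (PGL_liftP k) => K uK.
have ud : diag_mx d \in unitmx by rewrite unitmx_diag; apply/forallP => i; rewrite gt_eqF.
rewrite PGL_classV// !PGL_classM ?unitmx_mul ?unitmx_inv ?uK ?ud//.
move=> /(PGL_class_eq uA _)[]; first by rewrite !unitmx_mul unitmx_inv uK ud.
move=> c c0 ->; exists K, d, c; split => //.
by rewrite -scalemxAl mulmxKV// linearZ /= scalemxAr.
Qed.

Lemma positively_loxodromicP A K d : A \in unitmx -> K \in unitmx ->
  decreasing_row d -> A *m K = K *m diag_mx d ->
  positively_loxodromic (PGL_class A) <-> forall i j, 0 < d 0 i * d 0 j.
Proof.
move=> uA uK dd AK; have cA := char_poly_diagonalized uK AK; split.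
  move=> /(positively_loxodromic_lift uA)[K' [d' [c [uK' _ p c0 AK']]]].
  have h i : exists k, d 0 i = c * d' 0 k.
    have [|k ->] := (root_prod_row (c *: d') (d 0 i)).1; last by exists k; rewrite mxE.
    by rewrite -(char_poly_diagonalized uK' AK') cA; apply/root_prod_row; exists i.
  move=> i j; have [k ->] := h i; have [l ->] := h j.
  rewrite mulrACA -expr2; apply: mulr_gt0; last exact: mulr_gt0.
  by rewrite exprn_even_gt0.
move=> dij; wlog d0 : A K d uA uK dd AK cA dij / forall i, 0 < d 0 i.
  move=> wl; have [d0|] := pselect (forall i, 0 < d 0 i); first exact: (wl A K d).
  move=> /existsNP[i /negP]; rewrite -leNgt => di.
  have neg k : d 0 k < 0.
    have ik := dij i k.
    rewrite ltNge; apply/negP => dk.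
    by have := mulr_le0_ge0 di dk; rewrite leNgt ik.
  have uN : - A \in unitmx by rewrite -scaleN1r unitmxZ// unitrN1.
  have -> : PGL_class A = PGL_class (- A).
    by apply/PGL_class_eq => //; exists (-1); rewrite ?oppr_eq0 ?oner_eq0// scaleN1r opprK.
  have sA : simple_spectrum (- A).
    rewrite -scaleN1r; apply: simple_spectrum_scale; first by rewrite oppr_eq0 oner_eq0.
    exact: simple_spectrum_diagonalized uK AK (decreasing_row_inj dd).
  have [K' [d' [uK' dd' AK']]] := simple_spectrumP sA.
  have p' k : 0 < d' 0 k.
    have NK : - A *m K = K *m diag_mx (- d) by rewrite mulNmx AK raddfN /= mulmxN.
    have [|l ->] := (root_prod_row (- d) (d' 0 k)).1; last by rewrite mxE oppr_gt0.
    rewrite -(char_poly_diagonalized uK NK) (char_poly_diagonalized uK' AK').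
    by apply/root_prod_row; exists k.
  apply: (wl (- A) K' d') => //; first exact: char_poly_diagonalized uK' AK'.
  by move=> k l; rewrite mulr_gt0.
have [ud ->] := diagonalized_class uA uK AK.
by exists (PGL_class K), (PGL_class (diag_mx d)); split => //; exists d.
Qed.

Lemma positively_loxodromic_path (g : R -> PGL R n) :
  {within `[0, 1], continuous g} ->
  (forall t, 0 <= t <= 1 -> purely_loxodromic (g t)) ->
  positively_loxodromic (g 1) -> positively_loxodromic (g 0).
Proof.
move=> /subspace_continuousP cg gl.
suff -> : positively_loxodromic (g 1) = positively_loxodromic (g 0) by [].
apply: (unit_locally_constant (k := fun t => positively_loxodromic (g t))); try lra.
move=> t t01; have := gl t t01.
have : g @ within `[0, 1]%classic (nbhs t) --> g t.
  by apply: cg; rewrite /= in_itv.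
rewrite -(PGL_liftK (g t)); move: (PGL_lift (g t)) (PGL_liftP (g t)) => A0 uA0 gt lA0.
have [K0 [d0 [uK0 dd0 AK0]]] := simple_spectrumP (purely_loxodromic_lift uA0 lA0).
have cA0 := char_poly_diagonalized uK0 AK0.
have [ud0 _] := diagonalized_class uA0 uK0 AK0.
have nz i : d0 0 i != 0 by move: ud0; rewrite unitmx_diag => /forallP.
have n1 : \forall A \near A0, forall d, decreasing_row d ->
    char_poly A = \prod_i ('X - (d 0 i)%:P) -> forall i, 0 < d 0 i * d0 0 i.
  pose Q i A := forall d, decreasing_row d ->
    char_poly A = \prod_i ('X - (d 0 i)%:P) -> 0 < d 0 i * d0 0 i.
  have nQ : \forall A \near A0, forall i, Q i A.
    apply: (@filter_forall _ _ Q _ (nbhs_filter A0)) => i.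
    have := eigenvalues_continuous dd0 cA0 (_ : 0 < `|d0 0 i|).
    rewrite normr_gt0 nz => /(_ isT) n1.
    apply: (@filterS _ _ (nbhs_filter A0) _ _ _ n1) => A h d dd cA.
    have := h d dd cA i; have := nz i; case: (ltrgt0P (d0 0 i)) => // s _;
      by rewrite ltr_norml; nra.
  by apply: (@filterS _ _ (nbhs_filter A0) _ _ _ nQ) => A h d dd cA i; exact: h.
have gn : \forall t' \near t, `[0, 1]%classic t' -> _ := gt _ (PGL_class_open uA0 n1).
apply: filterS gn => t' + t'01; rewrite /= in_itv /= t'01 => /(_ isT)[A [h uA] Ag].
have := gl t' t'01; rewrite -Ag => /(purely_loxodromic_lift uA)/simple_spectrumP.
move=> [K [d [uK dd AK]]]; have {}h := h d dd (char_poly_diagonalized uK AK).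
apply/propext; rewrite (positively_loxodromicP uA uK dd AK).
rewrite (positively_loxodromicP uA0 uK0 dd0 AK0).
by split=> dij i j; have := dij i j; have := h i; have := h j; nra.
Qed.

End LoxodromicLifts.

Section ConjInvolutionContinuity.
Context {R : realType} {n : nat}.

(* If [A] is diagonalized by [K] with simple spectrum [d], then
   [K (diag m) K^-1] is the Lagrange interpolation polynomial of [m] at [d],
   evaluated at [A]. *)
Definition lagrange_mx (m d : 'rV[R]_n) (A : 'M[R]_n) : 'M[R]_n :=
  \sum_i (m 0 i * (\prod_(k | k != i) (d 0 i - d 0 k))^-1) *:
    \big[mulmx/1%:M]_(k <- index_enum 'I_n | k != i) (A - (d 0 k)%:M).

Lemma lagrange_mxE (m d : 'rV[R]_n) (A K : 'M[R]_n) : decreasing_row d ->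
  A *m K = K *m diag_mx d -> lagrange_mx m d A *m K = K *m diag_mx m.
Proof.
move=> dd AK; rewrite mulmx_suml.
under eq_bigr do rewrite -scalemxAl (lagrange_diag _ _ _ AK) scalemxAr.
rewrite -mulmx_sumr; congr (_ *m _); apply/matrixP => i j; rewrite summxE !mxE.
rewrite (bigD1 j)//= [X in _ + X]big1 ?addr0 => [|k kj].
  rewrite !mxE; case: eqP => [->|_]; last by rewrite !mulr0n mulr0.
  rewrite !mulr1n mulfVK//; apply/prodf_neq0 => l lj; rewrite subr_eq0.
  apply: contra lj => /eqP e; exact/eqP/esym/(decreasing_row_inj dd).
rewrite !mxE; case: eqP => [->|_]; last by rewrite mulr0n mulr0.
by rewrite mulr1n [X in _ * X](bigD1 j) 1?eq_sym//= subrr mul0r mulr0.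
Qed.

Lemma lagrange_mx_cvg (m d0 : 'rV[R]_n) (A0 : 'M[R]_n) : decreasing_row d0 ->
  lagrange_mx m z.1 z.2 @[z --> (nbhs d0, nbhs A0)] --> lagrange_mx m d0 A0.
Proof.
move=> dd0; pose Fp := filter_prod (nbhs d0) (nbhs A0).
have cd i : (z.1 : 'rV[R]_n) 0 i @[z --> Fp] --> d0 0 i.
  by apply: cvg_mx_coord; exact: cvg_fst.
apply: cvg_mx => i j; rewrite /lagrange_mx summxE.
under eq_fun do rewrite summxE.
apply: cvg_sum_fin => k; rewrite mxE; under eq_fun do rewrite mxE.
apply: cvgM.
  apply: cvgM; first exact: cvg_cst.
  apply: cvgV.
    apply/prodf_neq0 => l lk; rewrite subr_eq0; apply: contra lk => /eqP e.
    exact/eqP/esym/(decreasing_row_inj dd0).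
  by apply: cvg_prod_fin => l; apply: cvgB; exact: cd.
apply: cvg_mx_coord; apply: cvg_bigmulmx => l.
apply: cvg_mx => a c; rewrite !mxE; under eq_fun do rewrite !mxE.
apply: cvgB; first by apply: cvg_mx_coord; exact: cvg_snd.
by case: (a == c); [exact: cd|exact: cvg_cst].
Qed.

Lemma conj_involution_continuous (J g0 : PGL R n) :
  (forall d : 'rV[R]_n, (forall i, d 0 i != 0) ->
    (J * PGL_class (diag_mx d) = PGL_class (diag_mx d) * J)%g) ->
  positively_loxodromic g0 ->
  conj_involution J g @[g --> within positively_loxodromic (nbhs g0)] -->
    conj_involution J g0.
Proof.
move=> Jd; have [m m0 JE] := diag_commuting Jd.
have um : diag_mx m \in unitmx by rewrite unitmx_diag; apply/forallP.
have cE A K d : A \in unitmx -> K \in unitmx -> decreasing_row d ->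
    (forall i, 0 < d 0 i) -> A *m K = K *m diag_mx d ->
    lagrange_mx m d A \in unitmx /\
    conj_involution J (PGL_class A) = PGL_class (lagrange_mx m d A).
  move=> uA uK dd p AK; have [ud ->] := diagonalized_class uA uK AK.
  rewrite conj_involutionE//; last by exists d.
  have LK := lagrange_mxE m dd AK.
  have -> : lagrange_mx m d A = K *m diag_mx m *m invmx K by rewrite -LK mulmxK.
  split; first by rewrite !unitmx_mul unitmx_inv uK um.
  by rewrite JE PGL_classV// !PGL_classM ?unitmx_mul ?unitmx_inv ?uK ?um.
have diagA (A : 'M[R]_n) : A \in unitmx -> positively_loxodromic (PGL_class A) ->
    simple_spectrum A.
  move=> uA /(positively_loxodromic_lift uA)[K [d [c [uK dd p c0 AK]]]].
  apply: (simple_spectrum_diagonalized uK AK) => i j; rewrite !mxE.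
  by move=> /(mulfI c0)/(decreasing_row_inj dd).
move=> [k [_ [[d0 [p0 dd0 ->]]]]]; rewrite -(PGL_liftK k).
move: (PGL_lift k) (PGL_liftP k) => K0 uK0 {k}.
have ud0 : diag_mx d0 \in unitmx.
  by rewrite unitmx_diag; apply/forallP => i; rewrite gt_eqF.
rewrite PGL_classV// !PGL_classM ?unitmx_mul ?unitmx_inv ?uK0 ?ud0//.
set A0 := _ *m _ *m _ => ->.
have uA0 : A0 \in unitmx by rewrite !unitmx_mul unitmx_inv uK0 ud0.
have AK0 : A0 *m K0 = K0 *m diag_mx d0 by rewrite mulmxKV.
have [uL0 ->] := cE _ _ _ uA0 uK0 dd0 p0 AK0.
move=> W /(PGL_class_nbhs uL0) /(lagrange_mx_cvg (m := m) dd0 (A0 := A0)).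
move=> [[U V] /= [/nbhs_ballP[e /= e0 eU] VA] UV].
have [e' [e'0 e'e e'd]] : exists e' : R, [/\ 0 < e', e' <= e & forall i, e' <= d0 0 i].
  have n1 : \forall r \near (0 : R)^'+, forall i, r < d0 0 i.
    by apply: filter_forall => i; exact: nbhs_right_lt.
  have n2 : \forall r \near (0 : R)^'+, r < e by exact: nbhs_right_lt.
  have n3 : \forall r \near (0 : R)^'+, 0 < r by exact: nbhs_right_gt.
  have [r [h1 [h2 h3]]] := filter_ex (filterI n1 (filterI n2 n3)).
  by exists r; split => // [|i]; exact: ltW.
have n1 := eigenvalues_continuous dd0 (char_poly_diagonalized uK0 AK0) e'0.
have gn := PGL_class_open uA0 (@filterI _ _ (nbhs_filter A0) _ _ VA n1).
suff : \forall g \near PGL_class A0, positively_loxodromic g ->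
  W (conj_involution J g) by [].
apply: filterS gn => _ [A [[VA' hA] uA] <-] lA /=.
have [K [d [uK dd AK]]] := simple_spectrumP (diagA _ uA lA).
have {}hA := hA d dd (char_poly_diagonalized uK AK).
have p i : 0 < d 0 i by have := hA i; have := e'd i; rewrite ltr_norml; lra.
have [_ ->] := cE _ _ _ uA uK dd p AK.
apply: (UV (d, A)); split => //=; apply: eU; split => // i j.
rewrite ord1; apply: lt_le_trans e'e; rewrite distrC; exact: hA.
Qed.

End ConjInvolutionContinuity.

Section SymmetricPower.
Context {R : realType}.

Let homog (u v : {poly R}) k (p : {poly R}) : {poly R} :=
  \sum_(j < k.+1) p`_j *: (u ^+ (k - j) * v ^+ j).

Let homog_mul u v k (a b : R) (p : {poly R}) : (size p <= k.+1)%N ->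
  homog u v k.+1 ((a%:P + b *: 'X) * p) = (a *: u + b *: v) * homog u v k p.
Proof.
move=> sp; rewrite /homog [RHS]mulrDl !mulr_sumr.
have coefE j : ((a%:P + b *: 'X) * p)`_j = a * p`_j + b * (if j is j'.+1 then p`_j' else 0).
  rewrite mulrDl coefD coefCM -scalerAl coefZ coefXM.
  by case: j => //=; rewrite mulr0.
under eq_bigr do rewrite coefE scalerDl.
rewrite big_split /=; congr (_ + _).
  rewrite big_ord_recr /= [p`_k.+1]nth_default// mulr0 scale0r addr0.
  apply: eq_bigr => j _; rewrite -scalerAl -scalerAr scalerA.
  by rewrite subSn ?exprS -?mulrA// -ltnS.
rewrite big_ord_recl /= mulr0 scale0r add0r.
apply: eq_bigr => j _; rewrite -scalerAl -scalerAr scalerA /bump /= add1n subSS.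
by rewrite exprS mulrCA.
Qed.

Let size_linear (a b : R) : (size (a%:P + b *: 'X)%R <= 2)%N.
Proof.
apply: leq_trans (size_polyD _ _) _; rewrite geq_max size_polyC.
by rewrite (leq_trans (size_scale_leq _ _)) ?size_polyX// andbT; case: eqP.
Qed.

Let homog_linear u v (a b c d : R) p q :
  homog u v (p + q) ((a%:P + b *: 'X) ^+ p * (c%:P + d *: 'X) ^+ q) =
  (a *: u + b *: v) ^+ p * (c *: u + d *: v) ^+ q.
Proof.
have sX (e f : R) k (r : {poly R}) m : (size r <= m.+1)%N ->
    (size ((e%:P + f *: 'X) ^+ k * r)%R <= (k + m).+1)%N.
  move=> sr; elim: k => [|k IHk]; first by rewrite expr0 mul1r.
  rewrite exprS -mulrA; apply: leq_trans (size_polyMleq _ _) _.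
  by have := size_linear e f; rewrite addSn; lia.
elim: p => [|p IHp].
  rewrite !expr0 !mul1r add0n; elim: q => [|q IHq].
    by rewrite !expr0 /homog big_ord1 coefC /= scale1r mulr1.
  rewrite !exprS homog_mul ?IHq//.
  by have := sX c d q 1 0%N; rewrite mulr1 addn0 size_poly1; exact.
rewrite !exprS -!mulrA addSn homog_mul ?IHp//; apply: (sX a b p).
by have := sX c d q 1 0%N; rewrite mulr1 addn0 size_poly1; exact.
Qed.

Lemma sym_mxM n (A B : 'M[R]_2) : sym_mx n (A *m B) = sym_mx n A *m sym_mx n B.
Proof.
case: n => [|n]; first by apply/matrixP => -[].
apply/matrixP => i k; rewrite [LHS]mxE [RHS]mxE.
have i_n : (i <= n)%N by rewrite -ltnS.
have lin r : ((A *m B) r 0)%:P + (A *m B) r 1 *: 'X =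
    A r 0 *: ((B 0 0)%:P + B 0 1 *: 'X) + A r 1 *: ((B 1 0)%:P + B 1 1 *: 'X).
  rewrite !mxE !big_ord_recl !big_ord0 !addr0 /=.
  have -> : lift ord0 ord0 = 1 :> 'I_2 by exact/val_inj.
  have -> : ord0 = 0 :> 'I_2 by exact/val_inj.
  rewrite polyCD !polyCM scalerDl !scalerDr -!scalerA -!mul_polyC; ring.
rewrite !lin -homog_linear subnK//.
rewrite /homog coef_sum; apply: eq_bigr => j _; rewrite coefZ.
by rewrite !mxE.
Qed.

Lemma sym_mx1 n : sym_mx n 1%:M = 1%:M :> 'M[R]_n.
Proof.
apply/matrixP => i j; rewrite !mxE /= !scale0r !addr0 add0r !scale1r expr1n mul1r.
by rewrite coefXn eq_sym -val_eqE.
Qed.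

Lemma sym_mx_unit n (A : 'M[R]_2) : A \in unitmx -> sym_mx n A \in unitmx.
Proof.
move=> uA; have := sym_mxM n A (invmx A); rewrite mulmxV// sym_mx1 => /esym e.
by have [] := mulmx1_unit e.
Qed.

Lemma sym_mxN n (A : 'M[R]_2) : sym_mx n (- A) = (-1) ^+ n.-1 *: sym_mx n A.
Proof.
apply/matrixP => i j; rewrite !mxE.
have N r : (- A r 0)%:P + - A r 1 *: 'X = -1 *: ((A r 0)%:P + A r 1 *: 'X).
  by rewrite scaleN1r polyCN scaleNr opprD.
rewrite !N !exprZn -scalerAl -scalerAr scalerA coefZ -exprD subnK//.
by have := ltn_ord i; lia.
Qed.

Lemma square_spectrum_ge0 n (S K : 'M[R]_n) (d : 'rV[R]_n) : K \in unitmx ->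
  decreasing_row d -> S *m S *m K = K *m diag_mx d -> forall i, 0 <= d 0 i.
Proof.
move=> uK dd e; pose T := invmx K *m S *m K.
have TT : T *m T = diag_mx d.
  rewrite /T -!mulmxA (mulmxA K) mulmxV// mul1mx (mulmxA S) e.
  by rewrite mulmxA mulVmx// mul1mx.
have Td : T *m diag_mx d = diag_mx d *m T by rewrite -TT mulmxA.
have T0 : T = diag_mx (\row_i T i i).
  apply: diag_mx_offdiag => i j; apply: contraNeq => Tij.
  exact/eqP/esym/(decreasing_row_inj dd)/(diag_mx_intertwined Td Tij).
move=> i; have := congr1 (fun M : 'M[R]_n => M i i) TT; rewrite T0 mul_diag_mx !mxE eqxx.
by rewrite !mulr1n => <-; rewrite -expr2 sqr_ge0.
Qed.

Lemma det_mx2 (A : 'M[R]_2) : \det A = A 0 0 * A 1 1 - A 0 1 * A 1 0.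
Proof.
rewrite (expand_det_row _ 0) !big_ord_recl big_ord0 addr0 /cofactor !det_mx11 !mxE.
rewrite /= addn0 expr0 mul1r add0n expr1 mulN1r mulrN.
by congr (A _ _ * A _ _ - A _ _ * A _ _); exact/val_inj.
Qed.

Lemma sqrt_mx2 (A : 'M[R]_2) : 0 < \det A -> exists E, E *m E = A \/ E *m E = - A.
Proof.
pose s := Num.sqrt (\det A) => dA.
have s0 : 0 < s by rewrite sqrtr_gt0.
have ss : s ^+ 2 = \det A by rewrite sqr_sqrtr// ltW.
wlog ts : A s s0 ss {dA} / 0 < \tr A + 2 * s.
  move=> wl; have [ts|ts] := ltP 0 (\tr A + 2 * s); first exact: (wl A s).
  have dN : \det (- A) = \det A by rewrite -scaleN1r detZ sqrrN expr1n mul1r.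
  have [||E [EE|EE]] := wl (- A) s s0; rewrite ?dN// ?raddfN /=; first by lra.
    by exists E; right.
  by exists E; left; rewrite EE opprK.
pose c := (Num.sqrt (\tr A + 2 * s))^-1; exists (c *: (A + s%:M)); left.
have cc : c * c * (\tr A + 2 * s) = 1.
  by rewrite -expr2 exprVn sqr_sqrtr ?mulVf ?gt_eqF// ltW.
rewrite -scalemxAl -scalemxAr scalerA.
rewrite [RHS](_ : _ = c * c *: ((\tr A + 2 * s) *: A)); last first.
  by rewrite scalerA cc scale1r.
congr (_ *: _).
apply/matrixP => i j; move: ss; rewrite det_mx2 !mxE /mxtrace.
rewrite !big_ord_recl !big_ord0 !addr0 /= !mxE.
have -> : lift ord0 ord0 = 1 :> 'I_2 by exact/val_inj.
have -> : ord0 = 0 :> 'I_2 by exact/val_inj.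
move=> ss.
have c2 (k : 'I_2) : k = 0 \/ k = 1.
  by case: k => -[|[|//]] h; [left|right]; exact/val_inj.
by have [->|->] := c2 i; have [->|->] := c2 j; rewrite /= ?mulr1n ?mulr0n; nra.
Qed.

End SymmetricPower.

Section FuchsianLoxodromic.
Context {R : realType}.

Lemma PSL_lift_det (g : PGL R 2) : PSL g -> 0 < \det (PGL_lift g).
Proof.
move=> [A dA <-]; have [c c0 ->] := PGL_classK (det1_unitmx dA).
by rewrite detZ dA mulr1 exprn_even_gt0.
Qed.

Lemma irreducible_hom_loxodromic n (g : PGL R 2) (h : PGL R n) : PSL g ->
  purely_loxodromic (h * irreducible_hom n g * h^-1)%g ->
  positively_loxodromic (h * irreducible_hom n g * h^-1)%g.
Proof.
move=> Sg; rewrite /irreducible_hom -(PGL_liftK h).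
move: (PGL_lift h) (PGL_liftP h) => H uH; have dg := PSL_lift_det Sg.
have uS := sym_mx_unit n (PGL_liftP g).
rewrite PGL_classV// !PGL_classM ?unitmx_mul ?unitmx_inv ?uH ?uS//.
set M := _ *m _ *m _ => lM.
have uM : M \in unitmx by rewrite !unitmx_mul unitmx_inv uH uS.
have [K [d [uK dd MK]]] := simple_spectrumP (purely_loxodromic_lift uM lM).
apply/(positively_loxodromicP uM uK dd MK).
have [ud _] := diagonalized_class uM uK MK.
have nz i : d 0 i != 0 by move: ud; rewrite unitmx_diag => /forallP.
suff [h1|h1] : (forall i, 0 <= d 0 i) \/ (forall i, d 0 i <= 0).
- by move=> i j; rewrite mulr_gt0// lt_neqAle eq_sym nz h1.
- by move=> i j; rewrite nmulr_rgt0 lt_neqAle nz h1.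
have conj S : H *m (S *m S) *m invmx H = (H *m S *m invmx H) *m (H *m S *m invmx H).
  by rewrite !mulmxA mulmxKV.
have [E [EE|EE]] := sqrt_mx2 dg.
  left; apply: (square_spectrum_ge0 (S := H *m sym_mx n E *m invmx H) uK dd).
  by rewrite -conj -sym_mxM EE.
have sM : M = (-1) ^+ n.-1 *: ((H *m sym_mx n E *m invmx H) *m (H *m sym_mx n E *m invmx H)).
  rewrite -conj -sym_mxM EE sym_mxN -scalemxAr -scalemxAl scalerA -expr2 -exprM.
  by rewrite muln2 -signr_odd odd_double expr0 scale1r.
move: sM; rewrite -signr_odd; case: (odd n.-1); rewrite ?expr1 ?expr0 ?scale1r => sM.
  right; have sA : simple_spectrum (- M).
    by rewrite -scaleN1r; apply: simple_spectrum_scale;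
      [rewrite oppr_eq0 oner_eq0|exact: simple_spectrum_diagonalized uK MK (decreasing_row_inj dd)].
  have [K' [d' [uK' dd' MK']]] := simple_spectrumP sA.
  have NK : - M *m K = K *m diag_mx (- d) by rewrite mulNmx MK raddfN /= mulmxN.
  have p' : forall i, 0 <= d' 0 i.
    apply: (square_spectrum_ge0 (S := H *m sym_mx n E *m invmx H) uK' dd').
    by rewrite -MK' sM scaleN1r opprK.
  move=> i; have [|l e] := (root_prod_row d' (- d 0 i)).1.
    rewrite -(char_poly_diagonalized uK' MK') (char_poly_diagonalized uK NK).
    by apply/root_prod_row; exists i; rewrite mxE.
  by rewrite -oppr_ge0 e.
by left; apply: (square_spectrum_ge0 uK dd); rewrite -MK sM.
Qed.

End FuchsianLoxodromic.

Lemma conj_mul {G : groupType} (g h x : G) :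
  (g * (h * x * h^-1) * g^-1 = g * h * x * (g * h)^-1)%g.
Proof. by rewrite invgM !mulgA. Qed.

Lemma conj_mulr {G : groupType} (h x y : G) :
  (h * (x * y) * h^-1 = h * x * h^-1 * (h * y * h^-1))%g.
Proof. by rewrite !mulgA mulgVK. Qed.

Lemma conj_mul3 {G : groupType} (g h k x : G) :
  (g * (h * (k * x * k^-1) * h^-1) * g^-1 =
   g * (h * k) * x * (g * (h * k))^-1)%g.
Proof. by rewrite (conj_mul h) (conj_mul g). Qed.

Lemma conj_mulVK {G : groupType} (g h k x : G) :
  (g * x * g^-1 = g * (k^-1 * h^-1) * (h * (k * x * k^-1) * h^-1) *
     (g * (k^-1 * h^-1))^-1)%g.
Proof. by rewrite conj_mul3 !mulgA !mulgVK. Qed.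

Lemma conj_loop {G : groupType} (g h x : G) :
  (g^-1 * (h * x * h^-1) * g^-1^-1 = (h^-1 * g)^-1 * x * (h^-1 * g))%g.
Proof. by rewrite invgM !invgK !mulgA. Qed.

Lemma conj_transfer {G : groupType} (g g' h h' x x' : G) :
  (g' * (h'^-1 * x' * h') * g'^-1 = g * (h^-1 * x * h) * g^-1 ->
   x' = h' * (g'^-1 * (g * h^-1)) * x * (h' * (g'^-1 * (g * h^-1)))^-1)%g.
Proof.
move=> e.
have -> : (x' = h' * (g'^-1 * (g' * (h'^-1 * x' * h') * g'^-1) * g') * h'^-1)%g.
  by rewrite !mulgA !mulgVK mulgV mul1g mulgK.
by rewrite e !invgM !invgK !mulgA.
Qed.

Lemma conj_invK {G : groupType} (h x : G) :
  (h^-1 * (h * x * h^-1) * h^-1^-1 = x)%g.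
Proof. by rewrite invgK !mulgA mulVg mul1g mulgVK. Qed.

Lemma conj_invVK {G : groupType} (h x : G) :
  (x = h * (h^-1 * x * h^-1^-1) * h^-1)%g.
Proof. by rewrite invgK !mulgA mulgV mul1g mulgK. Qed.

Section RepresentationTopology.
Context {R : realType} {n : nat} {X : topologicalType} {x : X}.

Lemma rep_hom_eval_continuous (a : pi1 R x) :
  continuous (fun f : rep_hom R n x => val f a).
Proof.
move=> f; apply: (@continuous_comp _ _ _ (set_val : rep_hom R n x -> _) (@^~ a)).
  exact: initial_continuous.
exact: (@proj_continuous _ (fun=> PGL R n) a).
Qed.

Lemma rep_hom_cvg {T : Type} {F : set_system T} {FF : Filter F}
    (k : T -> rep_hom R n x) (f : rep_hom R n x) :
  (forall a, val (k t) a @[t --> F] --> val f a) -> k @ F --> f.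
Proof.
move=> kf.
have h : (fun t => set_val (k t)) @ F --> (set_val f : {ptws pi1 R x -> PGL R n}).
  apply/cvg_sup => a W; rewrite (@nbhsE (initial_topology _)).
  move=> [_ [[V oV <-] Va] VW]; rewrite nbhs_simpl /=.
  have := kf a V (open_nbhs_nbhs (conj oV Va)); rewrite nbhs_simpl /=.
  by apply: filterS => t Vt; exact: VW.
move=> W; rewrite nbhsE => -[_ [[V oV <-] Vf] VW]; rewrite nbhs_simpl /=.
have := h V (open_nbhs_nbhs (conj oV Vf)); rewrite nbhs_simpl /=.
by apply: filterS => t Vt; exact: VW.
Qed.

Lemma rep_hom_eq (f g : rep_hom R n x) : (forall a, val f a = val g a) -> f = g.
Proof. by move=> fg; apply/val_inj/funext. Qed.

Lemma rep_homM (f : rep_hom R n x) a b : val f (a * b)%g = (val f a * val f b)%g.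
Proof. by have := valP f; rewrite inE => -[]. Qed.

Lemma rep_hom_PSL (f : rep_hom R n x) a : PSL (val f a).
Proof. by have := valP f; rewrite inE => -[]. Qed.

Lemma Rep_eq (f g : rep_hom R n x) : \pi_(Rep R n x) f = \pi_(Rep R n x) g <->
  exists2 h, PSL h & forall a, val g a = (h * val f a * h^-1)%g.
Proof. by split=> [/eqmodP/asboolP|?]; last exact/eqmodP/asboolP. Qed.

Definition hom_conj (h : PGL R n) (f : pi1 R x -> PGL R n) : pi1 R x -> PGL R n :=
  fun a => (h * f a * h^-1)%g.

Lemma hom_conj_subproof h (f : rep_hom R n x) : PSL h ->
  hom_conj h (val f) \in @rep_hom R n X x.
Proof.
move=> Sh; apply/mem_set; split=> [a b|a]; rewrite /hom_conj.
  by rewrite rep_homM conj_mulr.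
exact: PSLM (PSLM Sh (rep_hom_PSL _ _)) (PSLV Sh).
Qed.

Lemma Rep_pi_open (U : set (rep_hom R n x)) : open U ->
  open ((\pi_(Rep R n x) : rep_hom R n x -> _) @` U).
Proof.
move=> oU; suff : open (\pi_(Rep R n x) @^-1` (\pi_(Rep R n x) @` U) : set (rep_hom R n x)).
  by [].
rewrite openE => f [u Uu /Rep_eq[h Sh fE]].
pose k (g : rep_hom R n x) : rep_hom R n x := SigSub (hom_conj_subproof g (PSLV Sh)).
have kf : k f = u.
  by apply: rep_hom_eq => a; rewrite /= /hom_conj fE conj_invK.
have ck : k @ f --> k f.
  apply: (@rep_hom_cvg _ (nbhs f) (nbhs_filter f) k) => a; rewrite /= /hom_conj.
  apply: cvg_PGL_mul; last exact: cvg_cst.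
  by apply: cvg_PGL_mul; [exact: cvg_cst|exact: rep_hom_eval_continuous].
have : nbhs (k f) U by rewrite kf; exact: open_nbhs_nbhs.
move=> /ck; rewrite nbhs_simpl /=; apply: (@filterS _ _ (nbhs_filter f)) => g Ukg.
exists (k g) => //; apply/Rep_eq; exists h => // a.
exact: conj_invVK.
Qed.

End RepresentationTopology.

Section Classes.
Context {R : realType} {n : nat} {X : topologicalType} {x : X}.
Variable c : X -> R -> X.
Hypothesis cp : forall p, is_path x p (c p).
Implicit Types (f : rep_hom R n x).

Local Notation functor f := (hom_functor (val f) c).

Lemma rep_functorP f : path_functor (functor f).
Proof. exact: hom_functorP (rep_homM f) cp. Qed.

Lemma rep_functor_PSL f l : PSL (functor f l).
Proof. exact: rep_hom_PSL. Qed.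

Lemma rep_hom_loopE f l : is_path x x l ->
  val f (pi1_class x l) = ((val f (pi1_class x (c x)))^-1 * functor f l *
                           val f (pi1_class x (c x)))%g.
Proof.
move=> lp; rewrite (hom_functor_loop (rep_homM f) cp lp) !mulgA mulVg mul1g.
by rewrite mulgVK.
Qed.

Lemma rep_hom_lassoE f v p l : is_path x v p -> is_path v v l ->
  let w := ((val f (pi1_class x (c x)))^-1 * functor f p)%g in
  val f (pi1_class x (lasso p l)) = (w * functor f l * w^-1)%g.
Proof.
move=> pp lp /=; rewrite rep_hom_loopE; last exact: is_path_lasso pp lp.
by rewrite (path_functor_lasso (rep_functorP f) pp lp) invgM invgK !mulgA.
Qed.

Lemma in_classP f v (g : rep_hom R n v) :
  in_class (\pi_(Rep R n x) f) g <-> exists2 u, PSL u &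
    forall l, is_path v v l -> val g (pi1_class v l) = (u * functor f l * u^-1)%g.
Proof.
have /Rep_eq[h Sh rE] : \pi_(Rep R n x) f = \pi_(Rep R n x) (repr (\pi_(Rep R n x) f)).
  by rewrite reprK.
have Sw : PSL (val f (pi1_class x (c x)))^-1%g by exact/PSLV/rep_hom_PSL.
split=> [[p [k [pp Sk gE]]]|[u Su gE]].
  exists (k * (h * ((val f (pi1_class x (c x)))^-1 * functor f p)))%g.
    exact: PSLM Sk (PSLM Sh (PSLM Sw (rep_functor_PSL _ _))).
  move=> l lp; rewrite gE// rE (rep_hom_lassoE f pp lp).
  exact: conj_mul3.
have vp := cp v.
pose w := ((val f (pi1_class x (c x)))^-1 * functor f (c v))%g.
have Sw' : PSL w := PSLM Sw (rep_functor_PSL _ _).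
exists (c v), (u * (w^-1 * h^-1))%g; split=> // [|l lp].
  exact: PSLM Su (PSLM (PSLV Sw') (PSLV Sh)).
rewrite rE (rep_hom_lassoE f vp lp) gE//; exact: conj_mulVK.
Qed.

Lemma in_class_inj (rho rho' : Rep R n x) v (g : rep_hom R n v) :
  in_class rho g -> in_class rho' g -> rho = rho'.
Proof.
rewrite -(reprK rho) -(reprK rho').
move: (repr rho) (repr rho') => f f' /in_classP[u Su gE] /in_classP[u' Su' gE'].
apply/Rep_eq; have vp := cp v; have pf := rep_functorP f; have pf' := rep_functorP f'.
have Sw := rep_hom_PSL f (pi1_class x (c x)).
have Sw' := rep_hom_PSL f' (pi1_class x (c x)).
have Sv := rep_functor_PSL f (c v); have Sv' := rep_functor_PSL f' (c v).
pose w := ((val f (pi1_class x (c x)))^-1 * functor f (c v))%g.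
pose w' := ((val f' (pi1_class x (c x)))^-1 * functor f' (c v))%g.
have {}Sw : PSL w := PSLM (PSLV Sw) Sv.
have {}Sw' : PSL w' := PSLM (PSLV Sw') Sv'.
have loopE (k : rep_hom R n x) l : is_path x x l -> let z :=
    ((val k (pi1_class x (c x)))^-1 * functor k (c v))%g in
    functor k (lasso (path_rev (c v)) l) =
    (z^-1 * val k (pi1_class x l) * z)%g.
  move=> lp /=; have pk := rep_functorP k.
  rewrite (path_functor_lasso pk (is_path_rev vp) lp) (path_functor_rev pk vp).
  rewrite (hom_functor_loop (rep_homM k) cp lp).
  exact: conj_loop.
exists (w' * (u'^-1 * (u * w^-1)))%g.
  exact: PSLM Sw' (PSLM (PSLV Su') (PSLM Su (PSLV Sw))).
move=> a; have [l lp ->] := pi1P a.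
have := gE _ (is_path_lasso (is_path_rev vp) lp).
rewrite (gE' _ (is_path_lasso (is_path_rev vp) lp)) !loopE// -/w -/w'.
exact: conj_transfer.
Qed.

End Classes.

Lemma twist_conj_commutator {G : groupType} (g h k x : G) :
  (h * g * h^-1 * x * (k * g * k^-1)^-1 =
   (h * g * h^-1) * x * (h * g * h^-1)^-1 *
   (h * (g * (h^-1 * k) * g^-1 * (h^-1 * k)^-1) * h^-1))%g.
Proof. by rewrite !invgM !invgK !mulgA !(mulgVK, mulgK). Qed.

Section BoundaryArcs.
Context {R : realType} {X : topologicalType} {A : set (@chart R X)}.
Context {b : nat} {e : 'I_b -> R -> X} {G : groupType}.
Hypothesis eA : oriented_boundary A e.
Variable phi : (R -> X) -> G.
Hypothesis pphi : path_functor phi.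

Lemma boundary_arc_cat i r s t : phi (boundary_arc e i r t) =
  (phi (boundary_arc e i r s) * phi (boundary_arc e i s t))%g.
Proof.
pose L := `|r| + `|s| + `|t| + 1.
have L0 : 0 < L by rewrite /L; have := normr_ge0 r; have := normr_ge0 s;
  have := normr_ge0 t; lra.
have bound (a : R) : `|a| <= L -> 0 <= (a + L) / (2 * L) <= 1.
  rewrite ler_norml => aL; rewrite divr_ge0/= ?ler_pdivrMr ?mulr_gt0//; lra.
have [nr ns nt] : [/\ 0 <= `|r|, 0 <= `|s| & 0 <= `|t|] by rewrite !normr_ge0.
have r01 : 0 <= (r + L) / (2 * L) <= 1 by apply: bound; rewrite /L; lra.
have s01 : 0 <= (s + L) / (2 * L) <= 1 by apply: bound; rewrite /L; lra.
have t01 : 0 <= (t + L) / (2 * L) <= 1 by apply: bound; rewrite /L; lra.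
have fp := boundary_arc_is_path eA i (- L) L.
have E a a' : (fun u => boundary_arc e i (- L) L
    ((a + L) / (2 * L) + u * ((a' + L) / (2 * L) - (a + L) / (2 * L)))) =
    boundary_arc e i a a'.
  by apply/funext => u; rewrite /boundary_arc; congr (e i); field; lra.
have := subpath_cat fp r01 s01 t01; rewrite !E => h.
have rs := boundary_arc_is_path eA i r s; have st := boundary_arc_is_path eA i s t.
rewrite -(pphi.1 _ _ _ _ _ rs st).
by apply/esym/(pphi.2 _ _ _ _ (is_path_cat rs st) (boundary_arc_is_path eA i r t)).
Qed.

Lemma boundary_loop_arc i s : boundary_loop e i s = boundary_arc e i s (s + 1).
Proof. by apply/funext => t; rewrite /boundary_loop /boundary_arc; congr (e i); ring. Qed.

Lemma boundary_loop_conj i s t : phi (boundary_loop e i s) =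
  (phi (boundary_arc e i s t) * phi (boundary_loop e i t) *
   (phi (boundary_arc e i s t))^-1)%g.
Proof.
apply: (mulIg (phi (boundary_arc e i s t))); rewrite mulgVK !boundary_loop_arc.
have aE : phi (boundary_arc e i s t) = phi (boundary_arc e i (s + 1) (t + 1)).
  congr phi; apply/funext => u; rewrite /boundary_arc -[LHS](boundary_periodic eA _ _ 1).
  by congr (e i); rewrite mulr1z; ring.
by rewrite [in LHS]aE -boundary_arc_cat (boundary_arc_cat _ _ t).
Qed.

Definition loop_at (p : X) : R -> X :=
  xget (fun=> p) [set l | exists i s, p = e i s /\ l = boundary_loop e i s].

Lemma loop_atE i s : loop_at (e i s) = boundary_loop e i s.
Proof.
have [[_ ei] _] := eA.
rewrite /loop_at; case: xgetP => [l _ [k [t [/ei[<- [m sE]] ->]]]|].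
  apply/funext => u; rewrite /boundary_loop sE.
  by rewrite -[LHS](boundary_periodic eA _ _ m); congr (e i); ring.
by move=> /(_ (boundary_loop e i s)); case; exists i, s.
Qed.

End BoundaryArcs.

Section TwistedDouble.
Context {R : realType} {X : topologicalType} {A : set (@chart R X)}.
Context {b : nat} {e : 'I_b -> R -> X} {n : nat} {J : PGL R n}.
Hypotheses (sA : oriented_surface A) (eA : oriented_boundary A e).
Hypothesis JJ : (J * J = 1)%g.
Hypothesis Jd : forall d : 'rV[R]_n, (forall i, d 0 i != 0) ->
  (J * PGL_class (diag_mx d) = PGL_class (diag_mx d) * J)%g.
Local Notation B := (boundary A).
Local Notation Y := (surface_double B).
Local Notation j := (@Defs.double_inj X B).

(* The reflection of the double acts on the fibre over [p] of the extended flat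
   bundle by this involution; the value off the boundary is a choice of gauge. *)
Definition boundary_twist (phi : (R -> X) -> PGL R n) (p : X) : PGL R n :=
  if pselect (B p) then conj_involution J (phi (@loop_at R X b e p)) else J.

Lemma boundary_twistE phi i s :
  boundary_twist phi (e i s) = conj_involution J (phi (boundary_loop e i s)).
Proof.
rewrite /boundary_twist; case: pselect => [?|[]]; first by rewrite (loop_atE eA).
by have [_ <-] := eA; exists i => //; exists s.
Qed.

Lemma boundary_twist_interior phi p : ~ B p -> boundary_twist phi p = J.
Proof. by rewrite /boundary_twist; case: pselect. Qed.

Lemma boundary_twist_conj phi p : exists K, boundary_twist phi p = (K * J * K^-1)%g.
Proof.
rewrite /boundary_twist; case: pselect => ?; first exact: conj_involution_ex.
by exists 1%g; rewrite invg1 mulg1 mul1g.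
Qed.

Lemma boundary_twist_sq phi p : (boundary_twist phi p * boundary_twist phi p = 1)%g.
Proof.
have [K ->] := boundary_twist_conj phi p.
by rewrite !mulgA mulgVK -[(K * J * J)%g]mulgA JJ mulg1 mulgV.
Qed.

Lemma boundary_twistV phi p : (boundary_twist phi p)^-1%g = boundary_twist phi p.
Proof.
apply: (mulgI (boundary_twist phi p)).
by rewrite mulgV boundary_twist_sq.
Qed.

Section Functor.
Variable phi : (R -> X) -> PGL R n.
Hypotheses (pphi : path_functor phi) (phiS : forall l, PSL (phi l)).
Hypothesis phiL : forall i s, positively_loxodromic (phi (boundary_loop e i s)).
Local Notation t := (boundary_twist phi).

Lemma boundary_twist_arc i s s' :
  (t (e i s) * phi (boundary_arc e i s s') =
   phi (boundary_arc e i s s') * t (e i s'))%g.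
Proof.
rewrite !boundary_twistE (boundary_loop_conj eA pphi i s s').
by rewrite conj_involution_conj// mulgVK.
Qed.

Lemma twisted_double_ex : exists Phi : (R -> Y) -> PGL R n, path_functor Phi /\
  forall k x y f, is_path x y f ->
    Phi (j k \o f) = (if k then t x * phi f * (t y)^-1 else phi f)%g.
Proof.
apply: (double_extension (surface_locally_contractible sA) pphi).
move=> o Bo; have [M [oM Mo Mt]] := boundary_flat sA eA pphi boundary_twist_arc Bo.
by exists M; split => // p f fp fM; exact: Mt.
Qed.

Variable Phi : (R -> Y) -> PGL R n.
Hypothesis pPhi : path_functor Phi.
Hypothesis PhiE : forall k x y f, is_path x y f ->
  Phi (j k \o f) = (if k then t x * phi f * (t y)^-1 else phi f)%g.

Lemma twisted_double_PSL x y f : is_path x y f -> PSL (Phi f).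
Proof.
have cB := closed_boundary sA; have lc := surface_locally_contractible sA.
move: x y f; apply: (double_path_ind cB lc).
- move=> k x y f fp; rewrite (PhiE k fp); case: k => //.
  have [K ->] := boundary_twist_conj phi x; have [L ->] := boundary_twist_conj phi y.
  rewrite twist_conj_commutator.
  by apply: PSLM; apply: PSL_conj; [exact: phiS|exact: PSL_commutator].
- by move=> x y z f g fp gp; rewrite (pPhi.1 _ _ _ _ _ fp gp); exact: PSLM.
- move=> x y f g fp fg; have gp := path_homotopic_path fp fg.
  by rewrite (pPhi.2 _ _ _ _ fp gp fg).
Qed.

Lemma twisted_double_bar x y f : is_path x y f ->
  Phi (@double_bar X B \o f) = (t (fold x) * Phi f * (t (fold y))^-1)%g.
Proof.
have cB := closed_boundary sA; have lc := surface_locally_contractible sA.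
have cbar := @double_bar_continuous X B.
move=> fp; have [_ f0 f1] := fp.
pose psi (f : R -> Y) := (t (fold (f 0%R)) * Phi f * (t (fold (f 1%R)))^-1)%g.
have ppsi : path_functor psi := path_functor_gauge (t \o (@fold X B)) pPhi.
have pbar := path_functor_comp cbar pPhi.
rewrite -[RHS](_ : psi f = _); last by rewrite /psi f0 f1.
apply: (double_functor_eq cB lc pbar ppsi _ fp) => k x' y' f' fp'.
have -> : @double_bar X B \o (j k \o f') = j (~~ k) \o f'.
  by apply/funext => u /=; rewrite double_barE.
have [_ f'0 f'1] := fp'.
rewrite /psi (PhiE k fp') (PhiE (~~ k) fp') /= !foldE f'0 f'1.
case: k => //=; rewrite !boundary_twistV.
by rewrite !mulgA boundary_twist_sq mul1g -!mulgA boundary_twist_sq mulg1.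
Qed.

End Functor.

End TwistedDouble.

Lemma purely_loxodromic_conj {R : realType} {n : nat} (g h : PGL R n) :
  purely_loxodromic g -> purely_loxodromic (h * g * h^-1)%g.
Proof.
move=> [M [dM -> [s us cM]]]; rewrite -(PGL_liftK h).
move: (PGL_lift h) (PGL_liftP h) => H uH; have uM := det1_unitmx dM.
exists (H *m M *m invmx H); split.
- by rewrite !det_mulmx det_inv dM mulr1 mulrV// -unitmxE.
- by rewrite PGL_classV// !PGL_classM ?unitmx_mul ?unitmx_inv ?uH ?uM.
- by exists s => //; rewrite -cM; apply: (char_poly_sim (K := H)); rewrite ?mulmxKV.
Qed.

Lemma conj_commuting {G : groupType} (h d x : G) : (d * x = x * d)%g ->
  ((h * d)^-1 * (h * x * h^-1) * (h * d)^-1^-1 = x)%g.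
Proof.
by move=> dx; rewrite invgK invgM !mulgA !mulgVK -mulgA -dx mulKg.
Qed.

Lemma positively_loxodromic_PSL {R : realType} {n : nat} (g : PGL R n) :
  positively_loxodromic g -> exists2 h, PSL h & decreasing_diagonal (h * g * h^-1)%g.
Proof.
move=> [K [D [dD ->]]]; rewrite -(PGL_liftK K).
move: (PGL_lift K) (PGL_liftP K) => {}K uK.
have [d d0 dK] : exists2 d : 'rV[R]_n, diag_mx d \in unitmx & \det (K *m diag_mx d) = 1.
  case: n K uK {g dD D} => [|n] K uK.
    by exists 0; rewrite ?unitmxE det_mx00 ?unitr1.
  have dK : \det K != 0 by rewrite -unitfE -unitmxE.
  pose d : 'rV[R]_n.+1 := \row_i if i == ord0 then (\det K)^-1 else 1.
  have dd : \det (diag_mx d) = (\det K)^-1.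
    by rewrite det_diag big_ord_recl big1 ?mulr1 => [|i _]; rewrite mxE.
  exists d; first by rewrite unitmxE dd unitfE invr_eq0.
  by rewrite det_mulmx dd mulfV.
have [d' [p' dd' DE]] := dD.
have d'0 : diag_mx d' \in unitmx by rewrite unitmx_diag; apply/forallP => i; rewrite gt_eqF.
exists (PGL_class (K *m diag_mx d))^-1%g.
  by apply: PSLV; exists (K *m diag_mx d).
rewrite -PGL_classM// conj_commuting// DE !PGL_classM// diag_mxC; exact.
Qed.

Section HitchinPositive.
Context {R : realType} {n : nat} {X : topologicalType} {b : nat}.
Context {e : 'I_b -> R -> X} {x : X}.

Lemma hitchin_loxodromic (f : rep_hom R n x) i s p :
  is_path (e i s) (e i s) (boundary_loop e i s) ->
  hitchin e (\pi_(Rep R n x) f) -> is_path x (e i s) p ->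
  let a := pi1_class x (lasso p (boundary_loop e i s)) in
  purely_loxodromic (val f a) /\ positively_loxodromic (val f a).
Proof.
move=> lp [g [cg g0 [f0 [_ _ _ [h hE]]] gl]] pp a.
have [k Sk fE] := (Rep_eq _ _).1 g0.
have ga t : 0 <= t <= 1 -> purely_loxodromic (val (g t) a) by move=> /gl; exact.
suff P0 : positively_loxodromic (val (g 0) a).
  rewrite fE; split; last exact: positively_loxodromic_conj.
  by apply: purely_loxodromic_conj; apply: ga; rewrite lexx ler01.
apply: (positively_loxodromic_path (g := fun t => val (g t) a)) => //.
  exact: (@continuous_comp_within _ _ _ _ g (fun k : rep_hom R n x => val k a)
    (@rep_hom_eval_continuous _ _ _ _ a) cg).
have := ga 1; rewrite lexx ler01 hE => /(_ isT).
exact/irreducible_hom_loxodromic/rep_hom_PSL.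
Qed.

End HitchinPositive.

Lemma hom_functor_base {R : realType} {X : topologicalType} {G : groupType}
    (x0 x : X) (f : pi1 R x0 -> G) (c : X -> R -> X) :
  (forall x, is_path x0 x (c x)) ->
  hom_functor f c (c x) = f (pi1_class x0 (c x0)).
Proof.
move=> cp; have [_ h0 h1] := cp x; rewrite /hom_functor h0 h1.
have xr := is_path_cat (cp x) (is_path_rev (cp x)).
congr f; apply/pi1_class_eq => //; first exact: is_path_cat (cp x0) xr.
apply: path_homotopic_trans (path_homotopic_1cat (cp x0)).
exact: path_homotopic_catl (cp x0) xr (path_homotopic_Vcat (cp x)).
Qed.

Section FunctorRepresentations.
Context {R : realType} {n : nat} {Z : topologicalType}.
Variable Phi : (R -> Z) -> PGL R n.
Hypothesis pPhi : path_functor Phi.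

Definition functor_rep (u : PGL R n) (q : Z) : pi1 R q -> PGL R n :=
  fun a => (u * Phi (val (repr a)) * u^-1)%g.

Lemma functor_rep_class u q l : is_path q q l ->
  functor_rep u (pi1_class q l) = (u * Phi l * u^-1)%g.
Proof.
move=> lp; rewrite /functor_rep.
by rewrite (pPhi.2 _ _ _ _ (loopP _) lp (repr_pi1_class lp)).
Qed.

Hypothesis PhiS : forall x y f, is_path x y f -> PSL (Phi f).

Lemma functor_rep_hom u q : PSL u -> @rep_hom R n Z q (@functor_rep u q).
Proof.
move=> Su; split=> [a a'|a].
  have [l lp ->] := pi1P a; have [l' lp' ->] := pi1P a'.
  have -> : (pi1_class q l * pi1_class q l')%g = pi1_class q (path_cat l l').
    exact: pi1_mulE.
  rewrite !functor_rep_class//; last exact: is_path_cat lp lp'.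
  by rewrite (pPhi.1 _ _ _ _ _ lp lp'); exact: conj_mulr.
have Sa := PhiS (loopP (repr a)).
exact: PSLM (PSLM Su Sa) (PSLV Su).
Qed.

Lemma functor_rep_in_class (y q : Z) (p : R -> Z) u (E : rep_hom R n y) (F : rep_hom R n q) :
  is_path y q p -> PSL u -> val E = @functor_rep 1%g y ->
  (forall l, is_path q q l -> val F (pi1_class q l) = (u * Phi l * u^-1)%g) ->
  in_class (\pi_(Rep R n y) E) F.
Proof.
move=> pp Su EE FE.
have /Rep_eq[h Sh rE] : \pi_(Rep R n y) E = \pi_(Rep R n y) (repr (\pi_(Rep R n y) E)).
  by rewrite reprK.
exists p, (u * ((Phi p)^-1 * h^-1))%g; split=> // [|l lp].
  exact: PSLM Su (PSLM (PSLV (PhiS pp)) (PSLV Sh)).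
rewrite FE// rE EE functor_rep_class; last exact: is_path_lasso pp lp.
rewrite (path_functor_lasso pPhi pp lp) invg1 mul1g mulg1; exact: conj_mulVK.
Qed.

End FunctorRepresentations.

Section DoubleArms.
Context {R : realType} {X : topologicalType} (B : set X) (v : X).
Variable c : X -> R -> X.
Hypotheses (Bv : B v) (cp : forall p, is_path v p (c p)).
Local Notation Y := (surface_double B).
Local Notation j := (@Defs.double_inj X B).

Definition double_arm (q : Y) : R -> Y :=
  j (if pselect (B (fold q)) then false else (repr q).1) \o c (fold q).

Lemma double_armE k p : double_arm (j k p) = j (if pselect (B p) then false else k) \o c p.
Proof.
rewrite /double_arm foldE; case: pselect => // nBp.
by have /double_injE[_ [<-|]] := double_reprE (j k p).
Qed.

Lemma double_arm_is_path q : is_path (j false v) q (double_arm q).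
Proof.
have [k [p ->]] := double_case q; rewrite double_armE.
have := is_path_comp (@double_side_continuous X B (if pselect (B p) then false else k)) (cp p).
rewrite (double_injC _ false Bv); congr is_path.
by apply/double_injE; case: pselect; split; auto.
Qed.

End DoubleArms.

Section JExtensionUnique.
Context {R : realType} {n : nat} {X : topologicalType} {A : set (@chart R X)}.
Context {b : nat} {e : 'I_b -> R -> X} {J : PGL R n}.
Hypotheses (sA : oriented_surface A) (eA : oriented_boundary A e).
Local Notation B := (boundary A).
Local Notation Y := (surface_double B).
Local Notation j := (@Defs.double_inj X B).

Lemma J_extension_hom_uniq i s (f : rep_hom R n (e i s))
    (F F' : rep_hom R n (j false (e i s))) :
  J_extension_hom J f F -> J_extension_hom J f F' -> F = F'.
Proof.
have cB := closed_boundary sA; have lc := surface_locally_contractible sA.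
have [_ [_ cX] _ _ _] := sA.
have /choice[c cp] (p : X) : exists f : R -> X, is_path (e i s) p f.
  exact: locally_contractible_path_connected lc cX.
have Bv : B (e i s) by have [_ <-] := eA; exists i => //; exists s.
have Cp := double_arm_is_path Bv cp.
move=> [F1 F2 F3] [F1' F2' F3'].
have loopE k l : is_path (e i s) (e i s) l ->
    val F (pi1_class (j false (e i s)) (j k \o l)) =
    val F' (pi1_class (j false (e i s)) (j k \o l)).
  move=> lp; case: k; last by rewrite F1 ?F1'.
  have jl := is_path_comp (@double_side_continuous X B false) lp.
  have -> : j true \o l = @double_bar X B \o (j false \o l).
    by apply/funext => t /=; rewrite double_barE.
  by rewrite F2 ?F2'// F1 ?F1'.
pose psi (F : rep_hom R n (j false (e i s))) := hom_functor (val F) (@double_arm R X B c).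
have ppsi G : path_functor (psi G) := hom_functorP (rep_homM G) Cp.
pose w (G : rep_hom R n (j false (e i s))) :=
  val G (pi1_class (j false (e i s)) (@double_arm R X B c (j false (e i s)))).
have ww : w F = w F'.
  by rewrite /w double_armE; exact: loopE.
have psil G l : is_path (j false (e i s)) (j false (e i s)) l ->
    psi G l = (w G * val G (pi1_class (j false (e i s)) l) * (w G)^-1)%g.
  exact: hom_functor_loop (rep_homM G) Cp l.
have psiC G q : psi G (@double_arm R X B c q) = w G by exact: hom_functor_base.
have jp k q := is_path_comp (@double_side_continuous X B k) (cp q).
have arms k q : psi F (j k \o c q) = psi F' (j k \o c q).
  have [Bq|nBq] := pselect (B q); last first.
    have := psiC F (j k q); have := psiC F' (j k q).
    by rewrite double_armE; case: pselect => // _ -> ->.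
  have a0 G : psi G (j false \o c q) = w G.
    by have := psiC G (j false q); rewrite double_armE; case: pselect.
  case: k; last by rewrite !a0.
  have [m [t qE]] : exists m t, q = e m t.
    by move: Bq; have [_ <-] := eA => -[m _ [t _ <-]]; exists m, t.
  move: (jp true q) (jp false q) (F3 m t) (F3' m t) a0.
  rewrite -qE => p1 p0 h h' a0.
  have bE : @double_bar X B \o (j false \o c q) = j true \o c q.
    by apply/funext => u /=; rewrite double_barE.
  move: h h'; rewrite qE => /(_ (c (e m t))); rewrite -qE bE => h /(_ (c q)); rewrite bE => h'.
  have {}h := h (cp q); have {}h' := h' (cp q).
  rewrite (double_injC true false Bq) (double_injC true false Bv) in p1.
  have lp := is_path_cat p0 (is_path_rev p1).
  have E G : psi G (j true \o c q) =
      ((psi G (path_cat (j false \o c q) (path_rev (j true \o c q))))^-1 * w G)%g.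
    rewrite ((ppsi G).1 _ _ _ _ _ p0 (is_path_rev p1)).
    by rewrite (path_functor_rev (ppsi G) p1) a0 invgM invgK mulgVK.
  by rewrite !E !psil// h h' ww.
have psiE q q' f' : is_path q q' f' -> psi F f' = psi F' f'.
  move: q q' f'; apply: (double_functor_eq cB lc (ppsi F) (ppsi F')) => k q q' f' fp.
  have cj := @double_side_continuous X B k.
  have lp := is_path_cat (cp q) (is_path_cat fp (is_path_rev (cp q'))).
  have jlp := is_path_comp cj lp; rewrite (double_injC k false Bv) in jlp.
  set l := path_cat _ _ in lp jlp.
  have E G : psi G (j k \o f') =
      ((psi G (j k \o c q))^-1 * (psi G (j k \o l) * psi G (j k \o c q')))%g.
    exact: path_functor_close (path_functor_comp cj (ppsi G)) (cp q) (cp q') fp.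
  have lE : psi F (j k \o l) = psi F' (j k \o l).
    by rewrite (psil F _ jlp) (psil F' _ jlp) (loopE k _ lp) ww.
  by rewrite (E F) (arms k q) (arms k q') lE -(E F').
apply: rep_hom_eq => a; have [l lp ->] := pi1P a.
rewrite (rep_hom_loopE Cp F lp) (rep_hom_loopE Cp F' lp) -/(psi F) -/(psi F').
by rewrite (psiE _ _ _ lp) -/(w F) -/(w F') ww.
Qed.

End JExtensionUnique.

Lemma conj_reflection {G : groupType} (J u t x : G) :
  (J * J = 1 -> u * t * u^-1 = J ->
   u * (t * x * t^-1) * u^-1 = J * (u * x * u^-1) * J)%g.
Proof.
move=> JJ e; have JV : (J^-1 = J)%g by apply: (mulgI J); rewrite mulgV.
transitivity (J * (u * x * u^-1) * J^-1)%g; last by rewrite JV.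
by rewrite -e !invgM !invgK !mulgA !mulgVK.
Qed.

Lemma conj_reflection_arm {G : groupType} (J u t s p : G) :
  (J * J = 1 -> u * t * u^-1 = J ->
   u * (p * (t * p * s^-1)^-1) * u^-1 = (u * p) * s * (u * p)^-1 * J)%g.
Proof.
move=> JJ e; have JV : (J^-1 = J)%g by apply: (mulgI J); rewrite mulgV.
transitivity (u * p * s * (u * p)^-1 * J^-1)%g; last by rewrite JV.
by rewrite -e !invgM !invgK !mulgA !mulgVK.
Qed.

Section JExtensionExists.
Context {R : realType} {X : topologicalType} {A : set (@chart R X)}.
Context {b : nat} {e : 'I_b -> R -> X} {n : nat} {J : PGL R n}.
Hypotheses (sA : oriented_surface A) (eA : oriented_boundary A e).
Hypothesis JJ : (J * J = 1)%g.
Hypothesis Jd : forall d : 'rV[R]_n, (forall i, d 0 i != 0) ->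
  (J * PGL_class (diag_mx d) = PGL_class (diag_mx d) * J)%g.
Local Notation B := (boundary A).
Local Notation Y := (surface_double B).
Local Notation j := (@Defs.double_inj X B).

Definition twisted_double (phi : (R -> X) -> PGL R n) (Phi : (R -> Y) -> PGL R n) :=
  path_functor Phi /\ forall k x y f, is_path x y f -> Phi (j k \o f) =
    (if k then @boundary_twist R X A b e n J phi x * phi f *
      (@boundary_twist R X A b e n J phi y)^-1 else phi f)%g.

Lemma twisted_double_J_extension (phi : (R -> X) -> PGL R n) Phi u i s
    (g : rep_hom R n (e i s)) (F : rep_hom R n (j false (e i s))) :
  path_functor phi ->
  (forall i s, positively_loxodromic (phi (boundary_loop e i s))) ->
  twisted_double phi Phi ->
  decreasing_diagonal (val g (pi1_class (e i s) (boundary_loop e i s))) ->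
  (forall l, is_path (e i s) (e i s) l ->
    val g (pi1_class (e i s) l) = (u * phi l * u^-1)%g) ->
  (forall l, is_path (j false (e i s)) (j false (e i s)) l ->
    val F (pi1_class (j false (e i s)) l) = (u * Phi l * u^-1)%g) ->
  J_extension_hom J g F.
Proof.
move=> pphi phiL [pPhi PhiE] dg gE FE.
have cj k := @double_side_continuous X B k.
have blp m t := boundary_loop_is_path eA m t.
have uJ : (u * @boundary_twist R X A b e n J phi (e i s) * u^-1 = J)%g.
  rewrite (boundary_twistE eA) -conj_involution_conj// -gE//.
  by have := conj_involutionE Jd 1%g dg; rewrite !mul1g invg1 !mulg1.
split=> [l lp|l lp|m t c cp].
- by rewrite FE ?gE//; [rewrite (PhiE false _ _ _ lp)|exact: is_path_comp (cj false) lp].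
- have blp' := is_path_comp (@double_bar_continuous X B) lp.
  rewrite double_barE (double_injC _ false) in blp'; last first.
    by have [_ <-] := eA; exists i => //; exists s.
  rewrite (FE _ blp') (FE _ lp) (twisted_double_bar sA JJ pPhi PhiE lp) foldE.
  exact: conj_reflection.
have bE : @double_bar X B \o (j false \o c) = j true \o c.
  by apply/funext => v /=; rewrite double_barE.
rewrite bE.
have p0 := is_path_comp (cj false) cp; have p1 := is_path_comp (cj true) cp.
have inB m' t' : B (e m' t') by have [_ <-] := eA; exists m' => //; exists t'.
rewrite (double_injC true false (inB i s)) (double_injC true false (inB m t)) in p1.
rewrite FE; last exact: is_path_cat p0 (is_path_rev p1).
rewrite (pPhi.1 _ _ _ _ _ p0 (is_path_rev p1)) (path_functor_rev pPhi p1).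
rewrite (PhiE false _ _ _ cp) (PhiE true _ _ _ cp).
rewrite (conj_reflection_arm _ _ JJ uJ).
rewrite -[underline _ _ _ _]/(conj_involution J
  (val g (pi1_class (e i s) (lasso c (boundary_loop e m t))))).
rewrite gE; last exact: is_path_lasso cp (blp m t).
rewrite (path_functor_lasso pphi cp (blp m t)) (conj_mul u).
congr (_ * J)%g; rewrite (boundary_twistE eA).
exact: esym (conj_involution_conj Jd _ (phiL m t)).
Qed.

End JExtensionExists.

Lemma within_cvg_eq {T : topologicalType} {U : topologicalType} (S : set T) (x : T)
    (g h : T -> U) :
  (forall t, S t -> g t = h t) -> S x ->
  h @ within S (nbhs x) --> h x -> g @ within S (nbhs x) --> g x.
Proof.
move=> gh Sx hx W; rewrite gh// => /hx; rewrite !nbhs_simpl /= /within /=.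
by apply: filterS => t hW St; rewrite gh//; exact: hW.
Qed.

Section HitchinExtension.
Context {R : realType} {X : topologicalType} {A : set (@chart R X)}.
Context {b : nat} {e : 'I_b -> R -> X} {n : nat} {J : PGL R n} {x : X}.
Hypotheses (sA : oriented_surface A) (eA : oriented_boundary A e).
Hypothesis JJ : (J * J = 1)%g.
Hypothesis Jd : forall d : 'rV[R]_n, (forall i, d 0 i != 0) ->
  (J * PGL_class (diag_mx d) = PGL_class (diag_mx d) * J)%g.
Local Notation B := (boundary A).
Local Notation Y := (surface_double B).
Local Notation j := (@Defs.double_inj X B).
Context {y : Y}.
Variables (c : X -> R -> X) (C : Y -> R -> Y).
Hypotheses (cp : forall p, is_path x p (c p)) (Cp : forall q, is_path y q (C q)).
Implicit Types (f : rep_hom R n x) (Phi : (R -> Y) -> PGL R n).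
Local Notation holonomy f := (hom_functor (val f) c).
Local Notation hitchin_hom f := (hitchin e (\pi_(Rep R n x) f)).
Local Notation twist f := (@boundary_twist R X A b e n J (holonomy f)).
Local Notation is_double f := (@twisted_double R X A b e n J (holonomy f)).

Lemma hitchin_boundary f i s : hitchin_hom f ->
  purely_loxodromic (holonomy f (boundary_loop e i s)) /\
  positively_loxodromic (holonomy f (boundary_loop e i s)).
Proof.
move=> Hf; have lp := boundary_loop_is_path eA i s.
have := hitchin_loxodromic lp Hf (cp (e i s)).
by rewrite /hom_functor; have [_ -> ->] := lp.
Qed.

Lemma hitchin_good f i s : hitchin_hom f ->
  exists g : rep_hom R n (e i s), good_hom g /\ in_class (\pi_(Rep R n x) f) g.
Proof.
move=> Hf; have pf := rep_functorP cp f.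
have blp m t := boundary_loop_is_path eA m t.
have [u Su du] := positively_loxodromic_PSL (hitchin_boundary i s Hf).2.
have gh := functor_rep_hom pf (fun _ _ l _ => rep_functor_PSL c f l) (e i s) Su.
pose g : rep_hom R n (e i s) := SigSub (mem_set gh).
have gE l : is_path (e i s) (e i s) l ->
    val g (pi1_class (e i s) l) = (u * holonomy f l * u^-1)%g.
  exact: functor_rep_class.
exists g; split; last by apply/(in_classP cp); exists u.
split; first by rewrite gE.
move=> m t d dp; rewrite gE; last exact: is_path_lasso dp (blp m t).
rewrite (path_functor_lasso pf dp (blp m t)) (conj_mul u).
exact: purely_loxodromic_conj (hitchin_boundary m t Hf).1.
Qed.

Lemma hitchin_double_ex f : hitchin_hom f -> exists Phi, is_double f Phi.
Proof.
move=> Hf; apply: (twisted_double_ex sA eA Jd (rep_functorP cp f)) => i s.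
exact: (hitchin_boundary i s Hf).2.
Qed.

Lemma is_double_PSL f Phi p q l : is_double f Phi -> is_path p q l -> PSL (Phi l).
Proof.
move=> [pPhi PhiE] lp.
exact: (twisted_double_PSL sA (rep_functor_PSL c f) pPhi PhiE lp).
Qed.

Lemma hitchin_J_extension f Phi (E : rep_hom R n y) : hitchin_hom f ->
  is_double f Phi -> val E = @functor_rep R n Y Phi 1%g y ->
  J_extension e J (\pi_(Rep R n x) f) (\pi_(Rep R n y) E).
Proof.
move=> Hf PhiP EE i s g [dg _] /(in_classP cp)[u Su gE]; have [pPhi _] := PhiP.
have PhiS p q l : is_path p q l -> PSL (Phi l) := is_double_PSL PhiP.
have Fh := functor_rep_hom pPhi PhiS (j false (e i s)) Su.
pose F : rep_hom R n (j false (e i s)) := SigSub (mem_set Fh).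
have FE l : is_path (j false (e i s)) (j false (e i s)) l ->
    val F (pi1_class (j false (e i s)) l) = (u * Phi l * u^-1)%g.
  exact: functor_rep_class.
exists F; last exact: (@functor_rep_in_class R n Y Phi pPhi PhiS y _ (C _) u E F (Cp _) Su EE FE).
have JF : J_extension_hom J g F.
  apply: (twisted_double_J_extension sA eA JJ Jd (rep_functorP cp f) _ PhiP dg gE FE).
  by move=> m t; exact: (hitchin_boundary m t Hf).2.
by split=> // F' /(J_extension_hom_uniq sA eA JF).
Qed.

Lemma J_extension_uniq (rho : Rep R n x) (rhoh rhoh' : Rep R n y) : B !=set0 ->
  hitchin e rho -> J_extension e J rho rhoh -> J_extension e J rho rhoh' ->
  rhoh = rhoh'.
Proof.
move=> [p Bp]; have [i [s _]] : exists i s, p = e i s.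
  by move: Bp; have [_ <-] := eA => -[i _ [s _ <-]]; exists i, s.
rewrite -{1}(reprK rho) => Hf; have [g [gg]] := hitchin_good i s Hf.
rewrite reprK => cg Jh Jh'.
have [F [JF uF] cF] := Jh i s g gg cg; have [F' [JF' _] cF'] := Jh' i s g gg cg.
by apply: (in_class_inj Cp cF); rewrite (uF F' JF').
Qed.

Section Continuity.
Variables (f0 : rep_hom R n x) (Phi : rep_hom R n x -> (R -> Y) -> PGL R n).
Local Notation S := [set f | hitchin_hom f].
Hypotheses (Hf0 : S f0) (PhiP : forall f, S f -> is_double f (Phi f)).

Lemma holonomy_cvg l : holonomy f l @[f --> within S (nbhs f0)] --> holonomy f0 l.
Proof.
apply: cvg_trans (@rep_hom_eval_continuous R n X x _ f0).
exact/cvg_app/cvg_within.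
Qed.

Lemma twist_cvg p : twist f p @[f --> within S (nbhs f0)] --> twist f0 p.
Proof.
have [Bp|nBp] := pselect (B p); last first.
  rewrite (boundary_twist_interior _ nBp).
  rewrite (_ : (fun f => _) = fun=> J); first exact: cvg_cst.
  by apply/funext => f; rewrite (boundary_twist_interior _ nBp).
have [i [s ->]] : exists i s, p = e i s.
  by move: Bp; have [_ <-] := eA => -[i _ [s _ <-]]; exists i, s.
rewrite (boundary_twistE eA).
rewrite (_ : (fun f => _) = fun f => conj_involution J (holonomy f (boundary_loop e i s))); last first.
  by apply/funext => f; rewrite (boundary_twistE eA).
apply: cvg_trans (conj_involution_continuous Jd (hitchin_boundary i s Hf0).2).
move=> W /=; rewrite !nbhs_simpl /= => /(@holonomy_cvg (boundary_loop e i s)).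
rewrite !nbhs_simpl /= /within /=; apply: filterS => f h Sf.
exact: h Sf (hitchin_boundary i s Sf).2.
Qed.

Lemma double_cvg p q l : is_path p q l ->
  Phi f l @[f --> within S (nbhs f0)] --> Phi f0 l.
Proof.
have cB := closed_boundary sA; have lc := surface_locally_contractible sA.
move: p q l; apply: (double_path_ind cB lc).
- move=> k p q l lp.
  apply: (within_cvg_eq (h := fun f => (if k then twist f p * holonomy f l * twist f q
      else holonomy f l)%g)) => //.
    move=> f Sf; rewrite ((PhiP Sf).2 _ _ _ _ lp).
    by case: (k) => //; rewrite boundary_twistV.
  case: k; last exact: holonomy_cvg.
  apply: cvg_PGL_mul; last exact: twist_cvg.
  apply: cvg_PGL_mul; [exact: twist_cvg|exact: holonomy_cvg].
- move=> p q r l m lp mp cl cm.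
  apply: (within_cvg_eq (h := fun f => (Phi f l * Phi f m)%g)) => //.
    by move=> f Sf; rewrite ((PhiP Sf).1.1 _ _ _ _ _ lp mp).
  exact: cvg_PGL_mul.
- move=> p q l m lp lm; apply: within_cvg_eq => // f Sf.
  exact/esym/((PhiP Sf).1.2 _ _ _ _ lp (path_homotopic_path lp lm) lm).
Qed.

End Continuity.

Lemma J_extension_continuous (F : Rep R n x -> Rep R n y) : B !=set0 ->
  (forall rho, hitchin e rho -> J_extension e J rho (F rho)) ->
  {within hitchin e, continuous F}.
Proof.
move=> B0 FJ; apply/subspace_continuousP => rho0.
have [f0 ->] : exists f0, rho0 = \pi_(Rep R n x) f0 by exists (repr rho0); rewrite reprK.
move=> Hf0.
pose S := [set f | hitchin_hom f].
have /choice[Phi PhiP] f : exists Phi, S f -> is_double f Phi.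
  have [/hitchin_double_ex[Phi PhiP]|nS] := pselect (S f); first by exists Phi.
  by exists (fun=> 1%g) => /nS.
pose E f : rep_hom R n y :=
  insubd (repr (F (\pi_(Rep R n x) f0))) (@functor_rep R n Y (Phi f) 1%g y).
have EE f : S f -> val (E f) = @functor_rep R n Y (Phi f) 1%g y.
  move=> Sf; have PhiS p q l : is_path p q l -> PSL (Phi f l) := is_double_PSL (PhiP f Sf).
  rewrite insubdK//; apply: mem_set.
  have Eh := functor_rep_hom (PhiP f Sf).1 PhiS y (@PSL1 R n); exact Eh.
have FE f : S f -> F (\pi_(Rep R n x) f) = \pi_(Rep R n y) (E f).
  move=> Sf; apply: (J_extension_uniq B0 Sf (FJ _ Sf)).
  exact: hitchin_J_extension Sf (PhiP f Sf) (EE f Sf).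
have cE : E @ within S (nbhs f0) --> E f0.
  apply: rep_hom_cvg => a.
  apply: (within_cvg_eq (h := fun f => Phi f (val (repr a)))) => //.
    by move=> f Sf; rewrite EE// /functor_rep invg1 mul1g mulg1.
  exact: (double_cvg Hf0 PhiP (loopP (repr a))).
move=> W; rewrite /from_subspace (FE f0 Hf0) nbhsE => -[V [oV Vf0] VW]; rewrite nbhs_simpl /=.
have : nbhs (E f0) (\pi_(Rep R n y) @^-1` V : set (rep_hom R n y)).
  exact: open_nbhs_nbhs.
move=> /cE; rewrite nbhs_simpl /= /within /= nbhsE => -[U [oU Uf0] UV].
rewrite /within /=; have oU' := Rep_pi_open oU.
have : nbhs (\pi_(Rep R n x) f0) ((\pi_(Rep R n x) : rep_hom R n x -> _) @` U).
  by apply: open_nbhs_nbhs; split => //; exists f0.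
apply: filterS => _ [f Uf <-] Hf /=; rewrite FE//; apply: VW.
exact: UV f Uf Hf.
Qed.

End HitchinExtension.

Theorem theorem9p2p4 (R : realType) (X : topologicalType)
    (A : set (@chart R X)) (b : nat) (e : 'I_b -> R -> X) (n : nat)
    (J : PGL R n) (x : X) (y : surface_double (boundary A)) :
  oriented_surface A ->
  oriented_boundary A e ->
  boundary A !=set0 ->
  @genus_ge R (surface_double (boundary A)) 2 ->
  (J * J = 1)%g ->
  (forall d : 'rV[R]_n, (forall i, d 0 i != 0) ->
    (J * PGL_class (diag_mx d) = PGL_class (diag_mx d) * J)%g) ->
  (forall rho : Rep R n x, hitchin e rho ->
    exists! rhoh : Rep R n y, J_extension e J rho rhoh) /\
  (forall F : Rep R n x -> Rep R n y,
    (forall rho, hitchin e rho -> J_extension e J rho (F rho)) ->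
    {within hitchin e, continuous F}).
Proof.
move=> sA eA B0 _ JJ Jd; have [_ [_ cX] _ _ _] := sA.
have lc := surface_locally_contractible sA.
have pX v : exists c : X -> R -> X, forall p, is_path v p (c p).
  have /choice[c cp] p : exists f : R -> X, is_path v p f.
    exact: locally_contractible_path_connected lc cX.
  by exists c.
have [c cp] := pX x; have [v Bv] := B0; have [c' cp'] := pX v.
have ap := double_arm_is_path Bv cp'.
pose C q := path_cat (path_rev (@double_arm R X (boundary A) c' y))
  (@double_arm R X (boundary A) c' q).
have Cp q : is_path y q (C q) by exact: is_path_cat (is_path_rev (ap y)) (ap q).
split; last by move=> F; exact: (J_extension_continuous sA eA JJ Jd cp Cp).
move=> rho.
have [f ->] : exists f, rho = \pi_(Rep R n x) f by exists (repr rho); rewrite reprK.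
move=> Hf; have [Phi PhiP] := hitchin_double_ex sA eA Jd cp Hf.
have PhiS p q l : is_path p q l -> PSL (Phi l) := is_double_PSL sA PhiP.
have Eh := functor_rep_hom PhiP.1 PhiS y (@PSL1 R n).
pose E : rep_hom R n y := SigSub (mem_set Eh).
have JE := hitchin_J_extension sA eA JJ Jd cp Cp Hf PhiP (erefl : val E = _).
exists (\pi_(Rep R n y) E); split => // rhoh.
exact: (J_extension_uniq eA cp Cp B0 Hf JE).
Qed.
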